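(* Let $b\ge 2$ be an integer. For every $\epsilon>0$ there exist $\sigma(b,\epsilon)>0$ and $C(b,\epsilon)>0$, depending only on $b$ and $\epsilon$, such that for every real $x\ge 1$, $$\sum_{\substack{q\le x^{1/5-\epsilon}\\ (q,b^3-b)=1}}\ \sup_{y\le x}\ \max_{a\in\mathbb{Z}}\left|\sum_{n\in\mathscr{P}_b^*(y)}\left(\mathbf{1}_{n\equiv a\ (\mathrm{mod}\ q)}-\frac1q\right)\right|\ \le\ C(b,\epsilon)\,\frac{\#\mathscr{P}_b^*(x)}{e^{\sigma(b,\epsilon)\sqrt{\log x}}}.$$
   Context: A positive integer is $b$-palindromic if the sequence of its base-$b$ digits (without leading zeros) is a palindrome. $\mathscr{P}_b^*(y)$ is the set of positive $b$-palindromic integers $n\le y$ with $(n,b^3-b)=1$, where $(m,n)$ denotes the greatest common divisor. The outer sum is over positive integers $q$, and the supremum is over real $y\le x$. $\mathbf{1}_E$ equals $1$ if $E$ is true and $0$ otherwise. *)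

(* Defs.v *)
From mathcomp Require Import all_boot all_order all_algebra.
From mathcomp Require Import all_classical all_reals all_analysis.

Set Implicit Arguments.
Unset Strict Implicit.
Unset Printing Implicit Defensive.

Import Order.TTheory GRing.Theory Num.Theory.

Local Open Scope ring_scope.

(* Least significant digit first. For b >= 2 and n >= 1 there are exactly
   (trunc_log b n).+1 digits, since b ^ trunc_log b n <= n < b ^ (trunc_log b n).+1;
   in particular the last entry is nonzero. *)
Definition digits (b n : nat) : seq nat :=
  mkseq (fun i => ((n %/ b ^ i) %% b)%N) (trunc_log b n).+1.

Definition palindromic (b n : nat) : bool :=
  (0 < n)%N && (rev (digits b n) == digits b n).

(* [Num.truncn y] is the floor of y when y >= 0 and is 0 when y < 0, so
   [iota 1 (Num.truncn y)] lists, without repetition, the positive integers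
   n <= y. *)
Definition pal_star (R : realType) (b : nat) (y : R) : seq nat :=
  [seq n <- iota 1 (Num.truncn y) | palindromic b n && coprime n (b ^ 3 - b)].

Definition discrepancy (R : realType) (b q : nat) (y : R) (a : int) : R :=
  \sum_(n <- pal_star b y) ((n%:Z == a %[mod q%:Z])%Z%:R - q%:R^-1).

(* Main.v *)
(** Only palindromes with an odd number [2 M + 1] of digits count, since [b + 1]
    divides the others.  Such a palindrome is [\sum_i u_i y_i] with [y_0 = b ^ M]
    and [y_i = b ^ (M - i) + b ^ (M + i)], so an exponential sum over its free
    digits is a product of the factors [|\sum_(c < b) e(c y_i t)|].  Orthogonality
    modulo [q (b ^ 2 - 1)] bounds the discrepancy by an average of these products
    over the fractions [t = l / (q (b ^ 2 - 1))] with [q] not dividing [l].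
    Reduce [l / q] to lowest terms and let [d] be its denominator, with
    [b ^ k <= d < b ^ (k + 1)].

    Since [b y_i - y_(i+1)] and [b y_(i+1) - y_i] are powers of [b] times
    [b ^ 2 - 1], two consecutive factors can both be near their maximum only if
    the base-[b] digits of [l / d] do not change at two prescribed places.
    - For small [d], every [k + 1] consecutive places contain a change, which
      gives a saving [exp (- c M / k)] for each fraction.
    - For large [d], use three disjoint blocks of digits.  On two blocks of length
      [k], Parseval and the divisor bound give a mean square [d ^ (-1 + o(1))].
      On the block of the [K ~ k / 2 + k / e] central digits, a product larger
      than a small negative power of [d] forces the leading [2 K] digits of a
      multiple of [l / d] to change rarely; few digit strings do so, and reduced
      fractions are well spaced, so there are at most [d ^ (1 - c)] such
      fractions.  The total length [5 k / 2] of the blocks is the source of the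
      exponent [1 / 5].

    To reach the supremum over [y], fix the outer digits: this cuts the palindromes
    into consecutive blocks of which at most one for each length is cut by [y]. *)

Require Import Defs.
From mathcomp Require Import all_boot all_order all_algebra.
From mathcomp Require Import all_classical all_reals all_analysis.
From mathcomp Require Import complex ring lra zify.

Set Implicit Arguments.
Unset Strict Implicit.
Unset Printing Implicit Defensive.

Import Order.TTheory GRing.Theory Num.Theory.

(** * The divisor function *)

Lemma leq_exp2rW (m n e : nat) : (m <= n)%N -> (m ^ e <= n ^ e)%N.
Proof. by move=> mn; case: e => // e; rewrite leq_exp2r. Qed.

(** The gcd of a divisor [d] with [p ^ e] is some [p ^ i] with [i <= e], and the cofactor divides
    [n]; so all divisors occur in a list of [e.+1 * size (divisors n)] products. *)
Lemma size_divisors_primepow_mul (p e n : nat) : prime p -> (0 < n)%N ->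
  (size (divisors (p ^ e * n)) <= e.+1 * size (divisors n))%N.
Proof.
move=> pr_p n0.
rewrite -[e.+1](size_iota 0) -(size_allpairs (fun i d => p ^ i * d)%N).
apply: uniq_leq_size; first exact: divisors_uniq.
move=> d; rewrite -dvdn_divisors; last by rewrite muln_gt0 expn_gt0 prime_gt0.
move=> /dvdnP [c E].
have ce : (d %/ gcdn d (p ^ e) %| n)%N.
  have d0 : (0 < d)%N.
    by case: (d) E => //; rewrite muln0 => /eqP; rewrite muln_eq0 expn_eq0;
      case: (p) pr_p => // ? _ ; case: n n0.
  have : (d %/ gcdn d (p ^ e) %| (p ^ e %/ gcdn d (p^e)) * n)%N.
    rewrite -(@dvdn_pmul2r (gcdn d (p ^ e))) ?gcdn_gt0 ?d0 // divnK ?dvdn_gcdl //.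
    by rewrite mulnAC divnK ?dvdn_gcdr // E dvdn_mull.
  rewrite Gauss_dvdr // /coprime.
  rewrite -(@eqn_pmul2r (gcdn d (p ^ e))) ?gcdn_gt0 ?d0 // mul1n muln_gcdl.
  by rewrite !divnK ?dvdn_gcdl ?dvdn_gcdr.
have : (gcdn d (p ^ e) %| p ^ e)%N by exact: dvdn_gcdr.
move=> /(dvdn_pfactor _ _ pr_p) [i ile Ei].
apply/allpairsP; exists (i, (d %/ gcdn d (p ^ e))%N); split => /=.
- by change (i \in iota 0 e.+1); rewrite mem_iota.
- by rewrite -dvdn_divisors.
- by rewrite /= -Ei mulnC divnK // dvdn_gcdl.
Qed.

(** The power is at most a falling factorial of [e + m], which is the factorial of [m] times a
    binomial coefficient of the row [e + m], and that row sums to [2 ^ (e + m)]. *)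
Lemma expn_leq_mul_exp2 (m e : nat) : (e.+1 ^ m <= m`! * 2 ^ m * 2 ^ e)%N.
Proof.
have H : (e.+1 ^ m <= (e + m) ^_ m)%N.
  elim: m => [|m IH]; first by rewrite ffactn0.
  by rewrite expnS addnS ffactSS leq_mul // ltnS leq_addr.
apply: leq_trans H _; rewrite -bin_ffact mulnC -mulnA leq_mul2l; apply/orP; right.
rewrite -expnD addnC -[2%N]/(1 + 1)%N expnDn.
have L : (e < (m + e).+1)%N by rewrite ltnS leq_addl.
rewrite (bigD1 (Ordinal L)) //= !exp1n !muln1.
suff -> : 'C(m + e, m) = 'C(m + e, e) by exact: leq_addr.
by rewrite -(bin_sub (leq_addr e m)) addKn.
Qed.

(** A prime power [p ^ e] with [p >= 2 ^ m] contributes [(e + 1) ^ m <= 2 ^ (m e) <= p ^ e]; the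
    prime powers are stripped one by one, least prime first. *)
Lemma size_divisors_exp_le_large (m n : nat) : (0 < n)%N ->
  (forall p, prime p -> (p %| n)%N -> (2 ^ m <= p)%N) ->
  (size (divisors n) ^ m <= n)%N.
Proof.
elim/ltn_ind: n => n IH n0 Hp.
have [n1|n1] := leqP n 1.
  have -> : n = 1%N by lia.
  by rewrite exp1n.
set p := pdiv n.
have pr_p : prime p by exact: pdiv_prime.
have pn : (p %| n)%N by exact: pdiv_dvd.
have [n' cop En] := pfactor_coprime pr_p n0.
set e := logn p n in En.
have e0 : (0 < e)%N by rewrite /e -pfactor_dvdn // expn1.
have n'0 : (0 < n')%N by case: n' En {cop} => //; rewrite mul0n => En; rewrite En in n0.
rewrite En mulnC.
apply: leq_trans (_ : _ <= (e.+1 * size (divisors n')) ^ m)%N _.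
  by rewrite leq_exp2rW // size_divisors_primepow_mul.
rewrite expnMn leq_mul //.
  have h2 : (e.+1 ^ m <= (2 ^ m) ^ e)%N.
    by rewrite -expnM mulnC expnM leq_exp2rW // ltn_expl.
  by apply: leq_trans h2 _; rewrite leq_exp2rW // Hp.
apply: IH => //.
  rewrite [X in (_ < X)%N]En -{1}[n']muln1 ltn_pmul2l //.
  by rewrite -(expn0 p) ltn_exp2l // prime_gt1.
by move=> r pr_r rn'; apply: Hp => //; rewrite En dvdn_mulr.
Qed.

(** The divisor bound [O(n ^ (1 / m))]. Primes from [2 ^ m] on cost nothing. The threshold is then
    lowered by one at a time, and each step enlarges the constant by the factor of
    [expn_leq_mul_exp2], enough for one more prime. *)
Lemma size_divisors_exp_le (m : nat) : exists C : nat,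
  (0 < C)%N /\ forall n, (0 < n)%N -> (size (divisors n) ^ m <= C * n)%N.
Proof.
have main : forall j, (j <= 2 ^ m)%N -> exists C : nat, (0 < C)%N /\
   forall n, (0 < n)%N -> (forall p, prime p -> (p %| n)%N -> (2 ^ m - j <= p)%N) ->
   (size (divisors n) ^ m <= C * n)%N.
  elim=> [_|j IH jm].
    exists 1%N; split=> // n n0 Hp; rewrite mul1n size_divisors_exp_le_large //.
    by move=> p; move: (Hp p); rewrite subn0.
  have [C [C0 HC]] := IH (ltnW jm).
  set s := (2 ^ m - j.+1)%N.
  exists (C * (m`! * 2 ^ m))%N; split.
    by rewrite !muln_gt0 C0 fact_gt0 expn_gt0.
  move=> n n0 Hp.
  have [/andP [prs sn]|sn] := boolP (prime s && (s %| n)%N); last first.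
    apply: leq_trans (HC n n0 _) _.
      move=> p prp pn; have := Hp p prp pn.
      rewrite leq_eqVlt => /orP [/eqP E|]; last by rewrite /s; lia.
      by case/negP: sn; rewrite E prp pn.
    by rewrite leq_mul2r leq_pmulr ?orbT // muln_gt0 fact_gt0 expn_gt0.
  have [n' cop En] := pfactor_coprime prs n0.
  set e := logn s n in En.
  have n'0 : (0 < n')%N by case: n' En {cop} => //; rewrite mul0n => En; rewrite En in n0.
  rewrite [in X in (X <= _)%N]En mulnC.
  apply: leq_trans (_ : _ <= (e.+1 * size (divisors n')) ^ m)%N _.
    by rewrite leq_exp2rW // size_divisors_primepow_mul.
  rewrite expnMn.
  have h1 : (size (divisors n') ^ m <= C * n')%N.
    apply: HC => // p prp pn'.
    have := Hp p prp; rewrite En dvdn_mulr // => /(_ isT).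
    rewrite leq_eqVlt => /orP [/eqP E|]; last by rewrite /s; lia.
    move: cop; rewrite prime_coprime // -/s E pn' //.
  have h2 : (e.+1 ^ m <= m`! * 2 ^ m * s ^ e)%N.
    apply: leq_trans (expn_leq_mul_exp2 m e) _.
    by rewrite leq_mul2l leq_exp2rW ?orbT // prime_gt1.
  apply: leq_trans (leq_mul h2 h1) _; rewrite En; apply/eq_leq; ring.
have [C [C0 HC]] := main (2 ^ m)%N (leqnn _).
by exists C; split=> // n n0; apply: HC => // p _ _; rewrite subnn.
Qed.

(** * Digits *)

Section DigitSums.
Local Open Scope ring_scope.

(** Serves to compare a sum over fractions with a sum over their digit strings or over their reduced
    forms. *)
Lemma ler_sum_inj (R : numDomainType) (I J : eqType) (r : seq I) (s : seq J)
    (phi : I -> J) (F : I -> R) (G : J -> R) :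
  uniq r -> {in r &, injective phi} -> (forall i, i \in r -> phi i \in s) ->
  (forall j, j \in s -> 0 <= G j) -> (forall i, i \in r -> F i <= G (phi i)) ->
  \sum_(i <- r) F i <= \sum_(j <- s) G j.
Proof.
elim: r s => [|i r IH] s ur inj sub G0 le.
  by rewrite big_nil big_seq sumr_ge0.
have si : phi i \in s by rewrite sub // mem_head.
rewrite big_cons (perm_big _ (perm_to_rem si)) big_cons.
move: ur => /= /andP [ir ur].
apply: lerD; first by rewrite le // mem_head.
apply: IH => //.
- by move=> x y xr yr; apply: inj; rewrite inE ?xr ?yr orbT.
- move=> x xr.
  have := sub x; rewrite inE xr orbT => /(_ isT) px.
  move: (px); rewrite (perm_mem (perm_to_rem si)) inE => /orP [/eqP E|//].
  have : x = i by apply: inj => //; rewrite inE ?xr ?eqxx ?orbT.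
  by move=> xi; move: ir; rewrite -xi xr.
- by move=> j js; apply: G0; exact: (mem_rem js).
- by move=> x xr; apply: le; rewrite inE xr orbT.
Qed.

Lemma big_nat_mul_digits (R : nmodType) (a c : nat) (F : nat -> R) :
  \sum_(0 <= v < a * c) F v =
  \sum_(0 <= i < a) \sum_(0 <= j < c) F (i * c + j)%N.
Proof.
rewrite big_nat_mul; apply: eq_bigr => i _.
rewrite mulSn -{1}[(i * c)%N]add0n addnC [(c + _)%N]addnC.
by rewrite addn0 -{1}[(i * c)%N]add0n big_addn addKn; apply: eq_bigr => j _; rewrite addnC.
Qed.

Definition dig (b i v : nat) : nat := ((v %/ b ^ i) %% b)%N.

Lemma dig_ltn b i v : (0 < b)%N -> (dig b i v < b)%N.
Proof. by move=> b0; rewrite /dig ltn_mod. Qed.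

Lemma dig_add_low b i m c v : (0 < b)%N -> (i < m)%N ->
  dig b i (c * b ^ m + v) = dig b i v.
Proof.
move=> b0 im; rewrite /dig -(subnK (ltnW im)) expnD mulnA divnMDl ?expn_gt0 ?b0 //.
have : (0 < m - i)%N by lia.
case: (m - i)%N => // k _.
by rewrite expnS mulnC -mulnA mulnC modnMDl.
Qed.

Lemma dig_add_top b m c v : (v < b ^ m)%N ->
  dig b m (c * b ^ m + v) = (c %% b)%N.
Proof.
move=> vm; rewrite /dig divnMDl ?(leq_ltn_trans _ vm) //.
by rewrite (divn_small vm) addn0.
Qed.

(** Summing over [v] is summing over its digits independently; this turns an exponential sum over
    digits into a product. *)
Lemma sum_prod_digits (R : comPzSemiRingType) (b m : nat) (G : nat -> nat -> R) :
  (0 < b)%N ->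
  \sum_(0 <= v < b ^ m) \prod_(0 <= i < m) G i (dig b i v) =
  \prod_(0 <= i < m) \sum_(0 <= c < b) G i c.
Proof.
move=> b0; elim: m => [|m IH].
  by rewrite expn0 big_nat1 !big_geq.
rewrite expnS big_nat_mul_digits big_nat_recr //= -IH mulr_sumr.
apply: eq_big_nat => c /andP [_ cb].
rewrite mulr_suml; apply: eq_big_nat => v /andP [_ vm].
rewrite big_nat_recr //= dig_add_top // modn_small //; congr (_ * _).
by apply: eq_big_nat => i /andP [_ im]; rewrite dig_add_low.
Qed.

Lemma sum_digits_val b m v : (0 < b)%N -> (v < b ^ m)%N ->
  (\sum_(0 <= i < m) dig b i v * b ^ i)%N = v.
Proof.
move=> b0; elim: m v => [|m IH] v.
  by rewrite expn0 big_geq //; case: v.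
move=> vm; rewrite big_nat_recr //=.
rewrite [in RHS](divn_eq v (b ^ m)) [in RHS]addnC; congr (_ + _)%N.
  have vm' : (v %% b ^ m < b ^ m)%N by rewrite ltn_mod expn_gt0 b0.
  rewrite -[RHS](IH _ vm'); apply: eq_big_nat => i /andP [_ im].
  by rewrite {1}(divn_eq v (b ^ m)) dig_add_low.
by rewrite /dig modn_small // ltn_divLR ?expn_gt0 ?b0 // mulnC -expnSr.
Qed.

(* [la j] weighs a change between the leading digits number [j] and [j + 1] *)
Definition change_weight (R : pzSemiRingType) (b m : nat) (la : nat -> R) (z : nat) : R :=
  \prod_(0 <= j < m.-1)
    if (dig b (m - j.+1) z != dig b (m - j.+2) z) then la j else 1.

(** The leading digit is free, whence [b%:R]; each later digit either repeats its predecessor or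
    takes one of [b - 1] other values at the cost [la j]. The induction appends a least significant
    digit. *)
Lemma sum_change_weight (R : comPzRingType) (b m : nat) (la : nat -> R) :
  (0 < b)%N ->
  \sum_(0 <= z < b ^ m.+1) change_weight b m.+1 la z =
  b%:R * \prod_(0 <= j < m) (1 + (b%:R - 1) * la j).
Proof.
move=> b0; elim: m => [|m IH].
  rewrite big_geq // expn1 mulr1 /change_weight.
  under eq_bigr do rewrite big_geq //.
  by rewrite sumr_const_nat subn0.
rewrite expnSr big_nat_mul_digits big_nat_recr //= mulrA -IH mulr_suml.
apply: eq_big_nat => z' /andP [_ z'm].
have digE i c : (c < b)%N -> dig b i.+1 (z' * b + c) = dig b i z'.
  by move=> cb; rewrite /dig expnS divnMA divnMDl // (divn_small cb) addn0.
have dig0 c : (c < b)%N -> dig b 0 (z' * b + c) = c.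
  by move=> cb; rewrite /dig divn1 modnMDl modn_small.
transitivity (\sum_(0 <= c < b) change_weight b m.+1 la z' *
    (if dig b 0 z' != c then la m else 1)).
  apply: eq_big_nat => c /andP [_ cb].
  rewrite /change_weight /= big_nat_recr //=; congr (_ * _).
    apply: eq_big_nat => j /andP [_ jm].
    have -> : (m.+2 - j.+1 = (m.+1 - j.+1).+1)%N by lia.
    have -> : (m.+2 - j.+2 = (m.+1 - j.+2).+1)%N by lia.
    by rewrite !digE.
  have -> : (m.+2 - m.+1 = 1)%N by lia.
  by rewrite subnn digE // dig0.
rewrite -mulr_sumr; congr (_ * _).
have db : (dig b 0 z' < b)%N by exact: dig_ltn.
rewrite big_mkord (bigD1 (Ordinal db)) //= eqxx; congr (_ + _).
rewrite (eq_bigr (fun _ => la m)); last first.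
  by move=> i ne; rewrite ifT // eq_sym.
rewrite sumr_const cardC1 card_ord -[LHS]mulr_natl; congr (_ * _).
by rewrite -subn1 natrB.
Qed.

End DigitSums.

(** * Positions at which a fraction is far from the integers *)

(** For [r < d] this says that [r / d] is at distance at least [1 / b ^ 2] from both [0] and [1]. *)
Definition far_from_int (b d r : nat) : bool :=
  (d <= b ^ 2 * r) && (d <= b ^ 2 * (d - r)).

(** Place [m - j - 1] of the quotient holds digit number [j + 1] after the point of [h / d], that
    is, the integer part of [b] times the fractional part of [b ^ j h / d]. *)
Lemma dig_quotient b d h m j : 0 < b -> 0 < d -> j < m ->
  dig b (m - j.+1) (b ^ m * h %/ d) = b * (b ^ j * h %% d) %/ d.
Proof.
move=> b0 d0 jm; rewrite /dig -divnMA.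
have -> : b ^ m * h %/ (d * b ^ (m - j.+1)) = b ^ j.+1 * h %/ d.
  have -> : b ^ m = b ^ j.+1 * b ^ (m - j.+1) by rewrite -expnD; congr (_ ^ _); lia.
  by rewrite mulnAC divnMr // expn_gt0 b0.
have -> : b ^ j.+1 * h = (b * (b ^ j * h %/ d)) * d + b * (b ^ j * h %% d).
  by rewrite expnS -mulnA {1}(divn_eq (b ^ j * h) d) mulnDr mulnA.
rewrite divnMDl // mulnC modnMDl modn_small // ltn_divLR // ltn_pmul2l //.
by rewrite ltn_mod.
Qed.

(** If [b ^ j h / d] is less than [1 / b ^ 2] away from an integer, its next two digits are both [0]
    or both [b - 1], so they agree. *)
Lemma change_far b d h m j : 1 < b -> 0 < d -> j.+1 < m ->
  dig b (m - j.+1) (b ^ m * h %/ d) != dig b (m - j.+2) (b ^ m * h %/ d) ->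
  far_from_int b d (b ^ j * h %% d).
Proof.
move=> b1 d0 jm; apply: contraNT; rewrite /far_from_int negb_and -!ltnNge => H.
have b0 : 0 < b by lia.
rewrite !dig_quotient //; last by lia.
have -> : b ^ j.+1 * h %% d = (b * (b ^ j * h %% d)) %% d.
  by rewrite modnMmr mulnA expnS.
have rd : (b ^ j * h %% d) < d by rewrite ltn_mod.
move: H rd; move: (_ %% d) => r H rd.
move: H; rewrite expnS expn1 => /orP [H|H].
  have brd : b * r < d by nia.
  by rewrite (modn_small brd) !divn_small // mulnA.
(* Just below an integer: both digits are [b - 1], and the remainder is measured downwards from
   [d]. *)
have E1 : b * r = b.-1 * d + (d - b * (d - r)).
  have : b * (d - r) < d by nia.
  case: b b0 {b1 jm H} => // b _ /=; nia.
have P1 : d - b * (d - r) < d by nia.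
rewrite E1 divnMDl // modnMDl (modn_small P1) (divn_small P1) addn0.
have -> : b * (d - b * (d - r)) = b.-1 * d + (d - b * b * (d - r)).
  have : b * b * (d - r) < d by nia.
  case: b b0 {b1 jm H E1 P1} => // b _ /=; nia.
by rewrite divnMDl // divn_small ?addn0 //; nia.
Qed.

(** Distinct reduced fractions are at least [1 / (d d')] apart; as [d d' <= X], multiplication by
    [X] gives them different integer parts. *)
Lemma quotient_inj (X d d' h h' : nat) : 0 < d -> 0 < d' -> d * d' <= X ->
  coprime h d -> coprime h' d' ->
  X * h %/ d = X * h' %/ d' -> h = h' /\ d = d'.
Proof.
move=> d0 d'0 XX cop cop' E.
have H1 := leq_divM (X * h) d; have H2 := ltn_ceil (X * h) d0.
have H1' := leq_divM (X * h') d'; have H2' := ltn_ceil (X * h') d'0.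
rewrite -E in H1' H2'; set z := _ %/ _ in H1 H2 H1' H2'.
have K : h * d' = h' * d.
  have K1 : X * (h * d') < X * (h' * d + 1).
    have : X * h * d' < z.+1 * d * d' by rewrite ltn_pmul2r.
    have : z * d' * d <= X * h' * d by rewrite leq_mul2r H1' orbT.
    nia.
  have K2 : X * (h' * d) < X * (h * d' + 1).
    have : X * h' * d < z.+1 * d' * d by rewrite ltn_pmul2r.
    have : z * d * d' <= X * h * d' by rewrite leq_mul2r H1 orbT.
    nia.
  have X0 : 0 < X by nia.
  move: K1 K2; rewrite !ltn_pmul2l //; lia.
have D : d = d'.
  apply/eqP; rewrite eqn_dvd; apply/andP; split.
    by rewrite -(@Gauss_dvdr d h) ?K ?dvdn_mull // coprime_sym.
  by rewrite -(@Gauss_dvdr d' h') -?K ?dvdn_mull // coprime_sym.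
split=> //; move: K; rewrite -D => /eqP; rewrite eqn_pmul2r // => /eqP //.
Qed.

(** A distance to the integers below [1 / b ^ 2] is multiplied by [b] at the next place. It starts
    at [1 / d > b ^ -(k + 1)] or more, so it cannot stay below [1 / b ^ 2] at all [k + 1] places. *)
Lemma far_in_window b d k r : 1 < b -> d < b ^ k.+1 -> 0 < r < d ->
  exists2 j, j <= k & far_from_int b d (b ^ j * r %% d).
Proof.
move=> b1 dk /andP [r0 rd].
have b0 : 0 < b by lia.
have [/hasP [j] | /hasPn no] := boolP (has (fun j => far_from_int b d (b ^ j * r %% d)) (iota 0 k.+1)).
  by rewrite mem_iota ltnS => jk far; exists j.
(* The multiples stay close to integers either always from above or always from below; the side
   cannot change while no place is far. *)
have main : forall i, i <= k ->
  (b ^ i.+2 * r < d) \/ (b ^ i.+2 * (d - r) < d /\ b ^ i * r %% d = d - b ^ i * (d - r)).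
  elim=> [_|i IH ik].
    have := no 0; rewrite mem_iota /= expn0 mul1n modn_small // => /(_ isT).
    by rewrite /far_from_int negb_and -!ltnNge mul1n => /orP [?|?]; [left|right; split=> //; lia].
  have := no i.+1; rewrite mem_iota /= ltnS => /(_ ik).
  rewrite /far_from_int negb_and -!ltnNge.
  have [H|[H E]] := IH (ltnW ik).
    have E1 : b ^ i.+1 * r < d.
      by apply: leq_ltn_trans H; rewrite leq_mul2r leq_pexp2l ?orbT.
    rewrite modn_small // => /orP [K|K].
      by left; move: K; rewrite mulnA -expnD.
    exfalso; have : b * (b ^ i.+1 * r) < d by rewrite mulnA -expnS.
    move: K; move: (b ^ i.+1 * r) E1 => s E1 K bs.
    have h1 : 2 * s <= b * s by rewrite leq_mul2r b1 orbT.
    have h2 : 2 * (d - s) <= b ^ 2 * (d - s).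
      by rewrite leq_mul2r (leq_trans b1) ?orbT // -{1}[b]expn1 leq_pexp2l.
    lia.
  have E1 : b ^ i.+1 * r %% d = d - b ^ i.+1 * (d - r).
    rewrite expnS -mulnA -modnMmr E.
    have H' : b ^ i.+1 * (d - r) < d.
      by apply: leq_ltn_trans H; rewrite leq_mul2r leq_pexp2l ?orbT.
    have -> : b * (d - b ^ i * (d - r)) = b.-1 * d + (d - b ^ i.+1 * (d - r)).
      move: H'; rewrite expnS -mulnA; move: (b ^ i * (d - r)) => s; rewrite mulnBr; move: (b * s) => X Xd.
      by case: (b) b0 => // b' _ /=; rewrite mulSn; move: (b' * d) => Y; lia.
    rewrite modnMDl modn_small //; first by rewrite expnS.
    have : 0 < b ^ i.+1 * (d - r) by rewrite muln_gt0 expn_gt0 b0; lia.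
    by move: (_ * (d - r)) H' => s; lia.
  rewrite E1.
  have H' : b * (b ^ i.+1 * (d - r)) < d by rewrite mulnA -expnS.
  move: H'; set s := b ^ i.+1 * (d - r) => H' /orP [K|K].
    exfalso.
    have h1 : 2 * s <= b * s by rewrite leq_mul2r b1 orbT.
    have h2 : 2 * (d - s) <= b ^ 2 * (d - s).
      by rewrite leq_mul2r (leq_trans b1) ?orbT // -{1}[b]expn1 leq_pexp2l.
    lia.
  right; split => //.
  have -> : b ^ i.+3 * (d - r) = b ^ 2 * s by rewrite /s mulnA -expnD.
  by move: K; rewrite subKn // (leq_trans _ (ltnW H')) // leq_pmull.
exfalso; have bk : b ^ k.+1 <= b ^ k.+2 by rewrite leq_pexp2l.
have [H|[H _]] := main k (leqnn _).
  have : b ^ k.+2 * 1 <= b ^ k.+2 * r by rewrite leq_mul2l r0 orbT.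
  lia.
have : b ^ k.+2 * 1 <= b ^ k.+2 * (d - r) by rewrite leq_mul2l subn_gt0 rd orbT.
lia.
Qed.

(** * Palindromes *)

Lemma sum_digits_lt b m (c : nat -> nat) : 0 < b -> (forall j, c j < b) ->
  \sum_(0 <= i < m) c i * b ^ i < b ^ m.
Proof.
move=> b0 cb; elim: m => [|m IH]; first by rewrite big_geq.
rewrite big_nat_recr //= expnS.
have : c m * b ^ m <= b.-1 * b ^ m by rewrite leq_mul2r -ltnS prednK // cb orbT.
case: b b0 {cb} IH => //= b _; rewrite mulSn; lia.
Qed.

Lemma dig_sum b m j (c : nat -> nat) : 0 < b -> (forall j, c j < b) -> j < m ->
  dig b j (\sum_(0 <= i < m) c i * b ^ i) = c j.
Proof.
move=> b0 cb; elim: m => [//|m IH]; rewrite ltnS leq_eqVlt => /orP [/eqP ->|jm].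
  by rewrite big_nat_recr //= addnC dig_add_top ?modn_small // sum_digits_lt.
by rewrite big_nat_recr //= addnC dig_add_low // IH.
Qed.

Lemma dig_div b m i v : dig b i (v %/ b ^ m) = dig b (m + i) v.
Proof. by rewrite /dig expnD divnMA. Qed.

Lemma eq_from_digits b m v v' : 0 < b -> v < b ^ m -> v' < b ^ m ->
  (forall i, i < m -> dig b i v = dig b i v') -> v = v'.
Proof.
move=> b0 vm v'm H; rewrite -(sum_digits_val b0 vm) -(sum_digits_val b0 v'm).
by apply: eq_big_nat => i /andP [_ im]; rewrite H.
Qed.

(* [u] is the upper half of the palindrome, so that its digit number [i] occurs
   in the palindrome at the places [M - i] and [M + i]. *)
Definition pal_weight (b M i : nat) : nat :=
  if i == 0 then b ^ M else b ^ (M - i) + b ^ (M + i).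

Definition pal (b M u : nat) : nat :=
  \sum_(0 <= i < M.+1) dig b i u * pal_weight b M i.

(** The lower [M] digits, which mirror the digits [1] to [M] of [u]; digit [0] of [u] is the
    centre. *)
Definition pal_low (b M u : nat) : nat :=
  \sum_(0 <= j < M) dig b (M - j) u * b ^ j.

Lemma pal_low_lt b M u : 0 < b -> pal_low b M u < b ^ M.
Proof.
by move=> b0; apply: (sum_digits_lt M b0 (c := fun j => dig b (M - j) u)) => j; exact: dig_ltn.
Qed.

Lemma palE b M u : 0 < b -> u < b ^ M.+1 -> pal b M u = u * b ^ M + pal_low b M u.
Proof.
move=> b0 uM.
have E : u * b ^ M = dig b 0 u * b ^ M + \sum_(0 <= i < M) dig b i.+1 u * b ^ (M + i.+1).
  rewrite -{1}(sum_digits_val b0 uM) big_nat_recl //= mulnDl expn0 muln1; congr (_ + _).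
  rewrite big_distrl /=; apply: eq_bigr => i _.
  by rewrite -mulnA -expnD [M + _]addnC.
rewrite E -addnA /pal /pal_low big_nat_recl //= {1}/pal_weight /=; congr (_ + _).
under eq_bigr do rewrite /pal_weight /= mulnDr.
rewrite big_split /= addnC; congr (_ + _).
rewrite big_nat_rev /=; apply: eq_big_nat => j /andP [_ jM].
by rewrite add0n subnSK // (subKn (ltnW jM)).
Qed.

Lemma pal_div b M u : 0 < b -> u < b ^ M.+1 -> pal b M u %/ b ^ M = u.
Proof.
move=> b0 uM; rewrite palE // divnMDl ?expn_gt0 ?b0 //.
by rewrite divn_small ?addn0 // pal_low_lt.
Qed.

Lemma dig_pal_low b M u j : 0 < b -> u < b ^ M.+1 -> j < M ->
  dig b j (pal b M u) = dig b (M - j) u.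
Proof.
move=> b0 uM jM; rewrite palE // dig_add_low //.
by rewrite (dig_sum b0 (c := fun j => dig b (M - j) u)) // => i; exact: dig_ltn.
Qed.

Lemma dig_pal_high b M u j : 0 < b -> u < b ^ M.+1 ->
  dig b (M + j) (pal b M u) = dig b j u.
Proof. by move=> b0 uM; rewrite -dig_div pal_div. Qed.

Lemma trunc_log_pal b M u : 1 < b -> b ^ M <= u < b ^ M.+1 ->
  trunc_log b (pal b M u) = M.*2.
Proof.
move=> b1 /andP [uM1 uM2]; have b0 : 0 < b by lia.
apply: trunc_log_eq => //; rewrite palE //; have := pal_low_lt M u b0 => ll.
have E1 : b ^ M.*2 = b ^ M * b ^ M by rewrite -expnD addnn.
have E2 : b ^ M.*2.+1 = b ^ M.+1 * b ^ M by rewrite -expnD -addnn addSn.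
rewrite E1 E2; apply/andP; split.
  by apply: leq_trans (leq_addr _ _); rewrite leq_mul2r uM1 orbT.
have : u.+1 * b ^ M <= b ^ M.+1 * b ^ M by rewrite leq_mul2r uM2 orbT.
by rewrite mulSn; lia.
Qed.

Lemma palindromicP b n : reflect
  (0 < n /\ forall j, j <= trunc_log b n -> dig b j n = dig b (trunc_log b n - j) n)
  (palindromic b n).
Proof.
have sz : size (digits b n) = (trunc_log b n).+1 by rewrite size_mkseq.
have nd i : i <= trunc_log b n -> nth 0 (digits b n) i = dig b i n.
  by move=> iL; rewrite nth_mkseq.
have nr j : j <= trunc_log b n ->
    nth 0 (rev (digits b n)) j = dig b (trunc_log b n - j) n.
  by move=> jL; rewrite nth_rev sz // subSS nd // leq_subr.
apply: (iffP andP) => -[n0 H]; split=> //.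
  by move=> j jL; rewrite -nr // (eqP H) nd.
apply/eqP; apply: (@eq_from_nth _ 0); rewrite size_rev // sz => j jL.
by rewrite nr // nd // -H.
Qed.

Lemma palindromic_pal b M u : 1 < b -> b ^ M <= u < b ^ M.+1 ->
  palindromic b (pal b M u).
Proof.
move=> b1 uM; have b0 : 0 < b by lia.
have uM2 : u < b ^ M.+1 by case/andP: uM.
apply/palindromicP; rewrite trunc_log_pal //; split.
  have : 0 < pal b M u %/ b ^ M.
    by rewrite pal_div //; case/andP: uM => [+ _]; apply: leq_trans; rewrite expn_gt0 b0.
  by case: (pal b M u) => //; rewrite div0n.
move=> j jM.
have [jM1|jM1] := ltnP j M.
  rewrite dig_pal_low //.
  have -> : M.*2 - j = M + (M - j) by lia.
  by rewrite dig_pal_high.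
have [->|jM2] := eqVneq j M; first by rewrite -addnn addnK.
have -> : j = M + (j - M) by lia.
rewrite dig_pal_high // dig_pal_low //; last by lia.
by congr dig; lia.
Qed.

(** An even [trunc_log] means an odd number of digits: the upper half includes the central digit and
    determines the rest. *)
Lemma palindromic_even_length b n M : 1 < b -> palindromic b n ->
  trunc_log b n = M.*2 ->
  b ^ M <= n %/ b ^ M < b ^ M.+1 /\ n = pal b M (n %/ b ^ M).
Proof.
move=> b1 /palindromicP [n0 H] L; have b0 : 0 < b by lia.
have bM0 : 0 < b ^ M by rewrite expn_gt0 b0.
have := trunc_log_bounds b1 n0; rewrite L => /andP [n1 n2].
have h : b ^ M <= n %/ b ^ M < b ^ M.+1.
  by rewrite leq_divRL // ltn_divLR // -!expnD addnn addSn addnn n1 n2.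
split=> //; rewrite palE //; last by case/andP: h.
rewrite {1}(divn_eq n (b ^ M)); congr (_ + _).
have lt : n %% b ^ M < b ^ M by rewrite ltn_mod.
apply: (eq_from_digits b0 lt (pal_low_lt M _ b0)) => i iM.
have -> : dig b i (n %% b ^ M) = dig b i n.
  by rewrite {2}(divn_eq n (b ^ M)) dig_add_low.
rewrite /pal_low (dig_sum b0 (c := fun j => dig b (M - j) (n %/ b ^ M))) //; last first.
  by move=> j; exact: dig_ltn.
rewrite dig_div H ?L; last by lia.
by congr dig; lia.
Qed.

Lemma dvdn_succ_odd_expn b k : 0 < b -> b.+1 %| b ^ k.*2.+1 + 1.
Proof.
move=> b0; elim: k => [|k IH]; first by rewrite expn1 addn1.
have E : b ^ k.+1.*2.+1 + 1 + b.+1 * b.-1 = b ^ 2 * (b ^ k.*2.+1 + 1).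
  have -> : b ^ k.+1.*2.+1 = b ^ 2 * b ^ k.*2.+1 by rewrite -expnD; congr (_ ^ _); lia.
  case: b b0 {IH} => // b _ /=.
  by move: (_ ^ k.*2.+1) => X; nia.
by rewrite -(dvdn_addl _ (dvdn_mulr b.-1 (dvdnn b.+1))) E dvdn_mull.
Qed.

(** With an even number of digits the places [j] and [2 M + 1 - j] carry the same digit, and
    [b ^ j + b ^ (2 M + 1 - j)] is [b ^ j] times one plus an odd power of [b], a multiple of
    [b + 1]. *)
Lemma palindromic_odd_length b n M : 1 < b -> palindromic b n ->
  trunc_log b n = M.*2.+1 -> b.+1 %| n.
Proof.
move=> b1 /palindromicP [n0 H] L; have b0 : 0 < b by lia.
have := trunc_log_bounds b1 n0; rewrite L => /andP [_ n2].
rewrite -(sum_digits_val b0 n2) (big_cat_nat (n := M.+1)) //=; last by lia.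
rewrite -{2}[M.+1]add0n big_addn [X in _ + X]big_nat_rev /=.
have -> : M.*2.+2 - M.+1 = M.+1 by lia.
rewrite -big_split /= big_nat; apply: dvdn_sum => j /andP [_ jM].
have -> : 0 + M.+1 - j.+1 + M.+1 = M.*2.+1 - j by lia.
rewrite -L -H ?L; last by lia.
rewrite -mulnDr dvdn_mull //.
have -> : M.*2.+1 - j = j + (M - j).*2.+1 by lia.
by rewrite expnD -{1}[b ^ j]muln1 -mulnDr dvdn_mull // addnC dvdn_succ_odd_expn.
Qed.

Lemma expn3_subE b : b ^ 3 - b = b * (b ^ 2 - 1).
Proof. by rewrite mulnBr muln1 -expnS. Qed.

Lemma coprime_palindromic_length b n : 1 < b -> palindromic b n ->
  coprime n (b ^ 3 - b) -> exists M, trunc_log b n = M.*2.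
Proof.
move=> b1 pn cop; exists (trunc_log b n)./2; rewrite -[LHS]odd_double_half.
have [od|//] := boolP (odd (trunc_log b n)).
have := @palindromic_odd_length b n (trunc_log b n)./2 b1 pn.
rewrite -{1}[trunc_log b n]odd_double_half od => /(_ erefl) dv.
have : b.+1 %| gcdn n (b ^ 3 - b).
  rewrite dvdn_gcd dv expn3_subE dvdn_mull //.
  by rewrite -[1](exp1n 2) subn_sqr addn1 dvdn_mull.
by rewrite (eqP cop) dvdn1; move=> /eqP [] /eqP; rewrite eqn_leq; lia.
Qed.

(** Coprimality with [b ^ 3 - b], a multiple of [b + 1], leaves only odd lengths; there each [n] is
    [pal b M u] for exactly one pair [(M, u)]. *)
Lemma big_pal_star (V : nmodType) (b Y N : nat) (F : nat -> V) : 1 < b ->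
  Y < b ^ N.+1.*2 ->
  (\sum_(n <- [seq n <- iota 1 Y | palindromic b n && coprime n (b ^ 3 - b)]) F n)%R =
  (\sum_(0 <= M < N.+1) \sum_((b ^ M)%N <= u < (b ^ M.+1)%N |
      (pal b M u <= Y)%N && coprime (pal b M u) (b ^ 3 - b)) F (pal b M u))%R.
Proof.
move=> b1 YN; have b0 : 0 < b by lia.
pose T := [seq (M, u) | M <- index_iota 0 N.+1, u <- index_iota (b ^ M) (b ^ M.+1)].
pose P p := (pal b p.1 p.2 <= Y) && coprime (pal b p.1 p.2) (b ^ 3 - b).
have TP p : p \in T -> p.1 <= N /\ b ^ p.1 <= p.2 < b ^ p.1.+1.
  by move=> /allpairsPdep [M [u [+ + ->]]]; rewrite !mem_index_iota /= ltnS.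
transitivity (\sum_(p <- T | P p) F (pal b p.1 p.2))%R; last first.
  by rewrite big_mkcond big_allpairs_dep; apply: eq_bigr => M _; rewrite -big_mkcond.
transitivity (\sum_(n <- [seq pal b p.1 p.2 | p <- T & P p]) F n)%R; last first.
  by rewrite big_map big_filter.
apply: perm_big; apply: uniq_perm.
- by rewrite filter_uniq ?iota_uniq.
- rewrite map_inj_in_uniq.
    rewrite filter_uniq // allpairs_uniq_dep ?iota_uniq //.
      by move=> M _; exact: iota_uniq.
    by move=> [M u] [M' u'] _ _ /= [-> ->].
  move=> [M u] [M' u']; rewrite !mem_filter => /andP [_ /TP /= [_ h]] /andP [_ /TP /= [_ h']] E.
  have MM : M = M'.
    by apply: double_inj; rewrite -(trunc_log_pal b1 h) -(trunc_log_pal b1 h') E.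
  subst M'; congr (_, _).
  have u1 : u < b ^ M.+1 by case/andP: h.
  have u2 : u' < b ^ M.+1 by case/andP: h'.
  by rewrite -(pal_div b0 u1) -(pal_div b0 u2) E.
move=> n; apply/idP/mapP.
  rewrite mem_filter mem_iota => /andP [/andP [pn cop] /andP [n1 nY]].
  have [M L] := coprime_palindromic_length b1 pn cop.
  have [h E] := palindromic_even_length b1 pn L.
  exists (M, n %/ b ^ M); last by [].
  rewrite mem_filter /P /= -E cop; apply/andP; split; first by lia.
  apply/allpairsPdep; exists M, (n %/ b ^ M); rewrite !mem_index_iota; split=> //.
  rewrite /= ltnS -ltnS -ltn_double -L.
  have := trunc_log_bounds b1 n1; move=> /andP [lo _].
  by rewrite -(ltn_exp2l _ _ b1); apply: leq_ltn_trans lo _; lia.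
move=> [[M u]]; rewrite mem_filter /P /= => /andP [/andP [pY cop] /TP /= [MN h]] ->.
rewrite mem_filter palindromic_pal // cop mem_iota.
case/palindromicP: (palindromic_pal b1 h) => p0 _; lia.
Qed.

Lemma expn_mod_sqr_sub1 b k j : 1 < b -> b ^ (k + j.*2) = b ^ k %[mod b ^ 2 - 1].
Proof.
move=> b1; have h : b ^ 2 = 1 %[mod b ^ 2 - 1].
  by rewrite -{1}(@subnK 1 (b ^ 2)) ?expn_gt0 ?(ltnW b1) // modnDl.
by rewrite expnD -mul2n expnM -modnMmr -modnXm h modnXm exp1n modnMmr muln1.
Qed.

Lemma coprime_sqr_sub1 b : 1 < b -> coprime b (b ^ 2 - 1).
Proof.
move=> b1; apply: (@coprime_dvdl _ (b ^ 2)); first by rewrite dvdn_exp.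
by rewrite subn1 coprimenP // expn_gt0 (ltnW b1).
Qed.

Lemma eqmodnD (d a a' c c' : nat) :
  a = a' %[mod d] -> c = c' %[mod d] -> a + c = a' + c' %[mod d].
Proof. by move=> ea ec; rewrite -modnDm ea ec modnDm. Qed.

(** Mirror places contribute equally modulo [b ^ 2 - 1], because [b ^ 2] is [1] there. The central
    digit is [1], and the two digits next to it are chosen to cancel all the other pairs, which
    leaves a power of [b]. The last digit of the palindrome is the leading digit [1] of [s], so it
    is coprime to [b] as well. *)
Lemma pal_coprime_exists b K s : 1 < b -> s < b ^ K.+1 -> b ^ K <= s ->
  dig b K s = 1 -> exists2 a, a < b ^ 3 &
  coprime (pal b K.+3 (s * b ^ 3 + a)) (b ^ 3 - b).
Proof.
move=> b1 sK sK' d1; have b0 : 0 < b by lia.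
set B := b ^ 2 - 1.
have B0 : 0 < B by rewrite subn_gt0 -{1}(exp1n 2) ltn_exp2r.
pose X := \sum_(0 <= j < K.+1) dig b j s * b ^ (K - j).
(* [B.-1] stands for [-1], and [b ^ K.+1] is its own inverse modulo [B]. As [t < b ^ 2], two digits
   suffice to write it. *)
pose t := (B.-1 * X * b ^ K.+1) %% B.
have tb : t %/ b < b.
  rewrite ltn_divLR // -[b * b]/(b ^ 2); apply: leq_trans (ltn_pmod _ B0) _.
  exact: leq_subr.
have tm : t %% b < b by rewrite ltn_mod.
pose a := (t %% b) * b ^ 2 + ((t %/ b) * b ^ 1 + 1).
have a1 : (t %/ b) * b ^ 1 + 1 < b ^ 2 by rewrite expn1 expnS expn1; nia.
have a3 : a < b ^ 3.
  have : (t %% b).+1 * b ^ 2 <= b * b ^ 2 by rewrite leq_mul2r tm orbT.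
  by rewrite mulSn -expnS /a; move: a1; move: (_ + 1) => Y; lia.
exists a => //; set u := _ + a.
have dg0 : dig b 0 u = 1.
  by rewrite /u dig_add_low // /a dig_add_low // dig_add_low // /dig divn1 modn_small.
have dg1 : dig b 1 u = t %/ b.
  by rewrite /u dig_add_low // /a dig_add_low // dig_add_top ?expn1 // modn_small.
have dg2 : dig b 2 u = t %% b.
  by rewrite /u dig_add_low // /a dig_add_top // modn_small.
have us : u %/ b ^ 3 = s by rewrite /u divnMDl ?expn_gt0 ?b0 // divn_small // addn0.
have dg3 j : dig b j.+3 u = dig b j s by rewrite -us dig_div.
have uK : u < b ^ K.+4.
  have : s.+1 * b ^ 3 <= b ^ K.+1 * b ^ 3 by rewrite leq_mul2r sK orbT.
  rewrite -expnD addSn addnS !addnS addn0 mulSn /u; lia.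
set n := pal b K.+3 u.
have nb : coprime n b.
  rewrite coprime_sym -coprime_modr.
  have -> : n %% b = dig b 0 n by rewrite /dig divn1.
  by rewrite /n dig_pal_low // subn0 dg3 d1 coprimen1.
have nB : n = b ^ K.+3 %[mod B].
  rewrite /n /pal big_nat_recl // big_nat_recl // big_nat_recl // dg0 dg1 dg2 /pal_weight /= mul1n.
  under eq_bigr do rewrite dg3.
  rewrite -[in RHS](addn0 (b ^ K.+3)) -[LHS]modnDmr -[RHS]modnDmr; congr ((_ + _) %% B).
  have -> : K.+3 - 1 = K.+2 by lia.
  have -> : K.+3 - 2 = K.+1 by lia.
  have e1 : (t %/ b) * (b ^ K.+2 + b ^ (K.+3 + 1)) = 2 * ((t %/ b) * b ^ K.+2) %[mod B].
    rewrite mulnCA -modnMmr -[RHS]modnMmr; congr ((_ * _) %% B).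
    rewrite mul2n -addnn -modnDmr -[RHS]modnDmr; congr ((_ + _) %% _).
    have -> : K.+3 + 1 = K.+2 + 1.*2 by clear; lia.
    exact: expn_mod_sqr_sub1.
  have e2 : (t %% b) * (b ^ K.+1 + b ^ (K.+3 + 2)) = 2 * ((t %% b) * b ^ K.+1) %[mod B].
    rewrite mulnCA -modnMmr -[RHS]modnMmr; congr ((_ * _) %% B).
    rewrite mul2n -addnn -modnDmr -[RHS]modnDmr; congr ((_ + _) %% _).
    have -> : K.+3 + 2 = K.+1 + 2.*2 by clear; lia.
    exact: expn_mod_sqr_sub1.
  have e3 : \sum_(0 <= i < K.+1) dig b i s * (b ^ (K.+3 - i.+3) + b ^ (K.+3 + i.+3))
      = 2 * X %[mod B].
    rewrite /X big_distrr /= -modn_summ -[RHS]modn_summ; congr (_ %% _).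
    apply: eq_big_nat => i /andP [_ iK].
    rewrite mulnCA -modnMmr -[RHS]modnMmr; congr ((_ * _) %% B).
    rewrite !subSS mul2n -addnn -modnDmr -[RHS]modnDmr; congr ((_ + _) %% _).
    have -> : K.+3 + i.+3 = (K - i) + i.+3.*2 by clear -iK; lia.
    exact: expn_mod_sqr_sub1.
  rewrite (eqmodnD e1 (eqmodnD e2 e3)).
  have -> : 2 * (t %/ b * b ^ K.+2) + (2 * (t %% b * b ^ K.+1) + 2 * X) =
     2 * (X + t * b ^ K.+1).
    by rewrite {3}(divn_eq t b) [b ^ K.+2]expnS; ring.
  have ht : t * b ^ K.+1 = B.-1 * X %[mod B].
    rewrite /t modnMml -mulnA -expnD addnn -[K.+1.*2]add0n -modnMmr.
    by rewrite expn_mod_sqr_sub1 // expn0 modnMmr muln1.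
  rewrite -modnMmr (eqmodnD (erefl (X %% B)) ht) -{1}[X]mul1n -mulnDl add1n prednK //.
  by rewrite modnMr muln0.
rewrite expn3_subE coprimeMr nb /= -coprime_modl -/B nB coprime_modl.
by rewrite coprimeXl // coprime_sqr_sub1.
Qed.

(** Put the digit [1] before an arbitrary string [v] of [K] digits and append the three digits of
    [pal_coprime_exists]. The resulting palindrome has [2 (K + 3) + 1] digits, and [v] can be read
    off from it. *)
Lemma size_pal_star_ge b Y K : 1 < b -> b ^ (K.+3.*2.+1) <= Y ->
  b ^ K <= size [seq n <- iota 1 Y | palindromic b n && coprime n (b ^ 3 - b)].
Proof.
move=> b1 hY; have b0 : 0 < b by lia.
have ex v : v < b ^ K -> exists n, [/\ n \in [seq n <- iota 1 Y | palindromic b n && coprime n (b ^ 3 - b)]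
   & n %/ b ^ K.+3 %/ b ^ 3 = b ^ K + v].
  move=> vK; pose s := 1 * b ^ K + v.
  have sK : s < b ^ K.+1.
    rewrite /s mul1n expnS; have : 2 * b ^ K <= b * b ^ K by rewrite leq_mul2r b1 orbT.
    lia.
  have s1 : dig b K s = 1 by rewrite /s dig_add_top // modn_small.
  have s2 : b ^ K <= s by rewrite /s mul1n leq_addr.
  have [a a3 cop] := pal_coprime_exists b1 sK s2 s1.
  set u := _ + a in cop.
  have us : u %/ b ^ 3 = s by rewrite /u divnMDl ?expn_gt0 ?b0 // divn_small // addn0.
  have uK : b ^ K.+3 <= u < b ^ K.+4.
    have h1 : s.+1 * b ^ 3 <= b ^ K.+1 * b ^ 3 by rewrite leq_mul2r sK orbT.
    have h2 : b ^ K * b ^ 3 <= s * b ^ 3 by rewrite leq_mul2r s2 orbT.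
    move: h1 h2; rewrite -!expnD !addSn !addnS addn0 mulSn /u; lia.
  have uK2 : u < b ^ K.+4 by case/andP: uK.
  exists (pal b K.+3 u); split; last by rewrite pal_div // us /s mul1n.
  have pp := palindromic_pal b1 uK.
  rewrite mem_filter pp cop mem_iota /=.
  case/palindromicP: (pp) => p0 _; rewrite p0 add1n ltnS /=.
  have := trunc_log_bounds b1 p0; rewrite trunc_log_pal // => /andP [_ lt].
  exact: leq_trans (ltnW lt) hY.
set r := [seq n <- _ | _].
rewrite -(size_iota 0 (b ^ K)) -(size_map (fun n => n %/ b ^ K.+3 %/ b ^ 3 - b ^ K) r).
apply: uniq_leq_size; first exact: iota_uniq.
move=> v; rewrite mem_iota => /andP [_ vK].
have [n [nr E]] := ex v vK.
by apply/mapP; exists n => //; rewrite E addKn.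
Qed.

Local Open Scope ring_scope.

(** * Exponential sums *)

Section Exponentials.
Variable R : realType.
Local Notation C := R[i].
Local Notation nc := (@Normc.normc R).

Lemma nc_ge0 (z : C) : 0 <= nc z.
Proof. by case: z => x y; rewrite sqrtr_ge0. Qed.

Lemma ncD (x y : C) : nc (x + y) <= nc x + nc y.
Proof. exact: le_normcD. Qed.

Lemma ncE (z : C) : nc z ^+ 2 = complex.Re z ^+ 2 + complex.Im z ^+ 2.
Proof. by case: z => x y /=; rewrite sqr_sqrtr // addr_ge0 ?sqr_ge0. Qed.

Lemma nc_sum (I : Type) (r : seq I) (P : pred I) (F : I -> C) :
  nc (\sum_(i <- r | P i) F i) <= \sum_(i <- r | P i) nc (F i).
Proof.
elim/big_ind2: _ => [|x x' y y' h h'|//]; first by rewrite Normc.normc0.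
by apply: le_trans (ncD _ _) _; exact: lerD.
Qed.

Lemma nc_prod (I : Type) (r : seq I) (P : pred I) (F : I -> C) :
  nc (\prod_(i <- r | P i) F i) = \prod_(i <- r | P i) nc (F i).
Proof.
elim/big_ind2: _ => [|x x' y y' <- <-|//]; first by rewrite Normc.normc1.
by rewrite Normc.normcM.
Qed.

Lemma nc_real (x : R) : nc (x%:C)%C = `|x|.
Proof. by rewrite /= expr0n addr0 sqrtr_sqr. Qed.

Definition expi (t : R) : C := (cos (2 * pi * t) +i* sin (2 * pi * t))%C.

Lemma expi0 : expi 0 = 1.
Proof. by rewrite /expi mulr0 cos0 sin0. Qed.

Lemma expiD s t : expi (s + t) = expi s * expi t.
Proof.
rewrite /expi mulrDr cosD sinD; apply/eqP; rewrite eq_complex /= eqxx /=.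
by rewrite addrC.
Qed.

Lemma expiMn t n : expi (n%:R * t) = expi t ^+ n.
Proof.
elim: n => [|n IH]; first by rewrite mul0r expi0 expr0.
by rewrite -addn1 natrD mulrDl mul1r expiD IH exprD expr1.
Qed.

Lemma expi1 : expi 1 = 1.
Proof. by rewrite /expi mulr1 mulr_natl cos2pi sin2pi. Qed.

Lemma expi_nat n : expi n%:R = 1.
Proof. by rewrite -[n%:R]mulr1 expiMn expi1 expr1n. Qed.

Lemma nc_expi t : nc (expi t) = 1.
Proof. by rewrite /= cos2Dsin2 sqrtr1. Qed.

Lemma conj_expi t : (expi t)^*%C = expi (- t).
Proof. by rewrite /expi mulrN cosN sinN. Qed.

Lemma nc_1subexpi t : nc (1 - expi t) ^+ 2 = 2 - 2 * cos (2 * pi * t).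
Proof.
rewrite ncE /=.
have := cos2Dsin2 (2 * pi * t); move: (cos _) (sin _) => c s; lra.
Qed.

Lemma nc_1addexpi t : nc (1 + expi t) ^+ 2 = 2 + 2 * cos (2 * pi * t).
Proof.
rewrite ncE /=.
have := cos2Dsin2 (2 * pi * t); move: (cos _) (sin _) => c s; lra.
Qed.

Lemma nc_1subexpiMn t n : nc (1 - expi (n%:R * t)) <= n%:R * nc (1 - expi t).
Proof.
elim: n => [|n IH]; first by rewrite mul0r expi0 subrr Normc.normc0 mul0r.
have -> : 1 - expi (n.+1%:R * t) = (1 - expi (n%:R * t)) + expi (n%:R * t) * (1 - expi t).
  by rewrite -addn1 natrD mulrDl mul1r expiD; ring.
apply: le_trans (ncD _ _) _.
rewrite Normc.normcM nc_expi mul1r -addn1 natrD mulrDl mul1r lerD2r; exact: IH.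
Qed.

Lemma expi_mod (a d : nat) : (0 < d)%N -> expi (a%:R / d%:R) = expi ((a %% d)%N%:R / d%:R).
Proof.
move=> d0; have d0' : d%:R != 0 :> R by rewrite pnatr_eq0 -lt0n.
by rewrite {1}(divn_eq a d) natrD mulrDl natrM mulfK // expiD expi_nat mul1r.
Qed.

Lemma cos2pi_lt1 (t : R) : 0 < t < 1 -> cos (2 * pi * t) < 1.
Proof.
move=> /andP [t0 t1].
have -> : 2 * pi * t = (pi * t) *+ 2 by rewrite mulr2n; ring.
have : 0 < sin (pi * t) by rewrite sin_gt0_pi // mulr_gt0 ?pi_gt0 //= gtr_pMr ?pi_gt0.
rewrite cos_mulr2n => s0; have := cos2Dsin2 (pi * t).
have : 0 < sin (pi * t) ^+ 2 by rewrite exprn_gt0.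
by rewrite mulr2n; lra.
Qed.

(** The symmetry between [t] and [1 - t] reduces to [t <= 1 / 2], where the cosine decreases. *)
Lemma cos2pi_far (u t : R) : 0 < u -> u <= t <= 1 - u ->
  cos (2 * pi * t) <= cos (2 * pi * u).
Proof.
move=> u0 /andP [ut tu]; have p0 := pi_gt0 R.
wlog th : t ut tu / t <= 1 / 2.
  move=> H; have [h|h] := leP t (1 / 2); first exact: H.
  have -> : cos (2 * pi * t) = cos (2 * pi * (1 - t)).
    have -> : 2 * pi * (1 - t) = - (2 * pi * t) + pi *+ 2 by rewrite mulr2n; ring.
    by rewrite cosD2pi cosN.
  by apply: H; lra.
rewrite leNgt ltr_cos ?in_itv /=; last 2 first.
- by rewrite mulr_ge0 /= ?mulr_ge0 ?(ltW p0) //; [nra | lra].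
- by rewrite mulr_ge0 /= ?mulr_ge0 ?(ltW p0) //; [nra | lra].
by rewrite -leNgt ler_pM2l ?mulr_gt0.
Qed.

(** Orthogonality of the additive characters modulo [n]: the sum is geometric, with a ratio [z] such
    that [z ^ n = 1]. *)
Lemma expi_sum_eq0 (n a c : nat) : (0 < n)%N ->
  \sum_(0 <= l < n) expi (l%:R * ((a%:R - c%:R) / n%:R)) =
  if (a == c %[mod n])%N then n%:R else 0.
Proof.
move=> n0; have n0' : n%:R != 0 :> R by rewrite pnatr_eq0 -lt0n.
set z := expi ((a%:R - c%:R) / n%:R).
have zn : z ^+ n = 1.
  rewrite -expiMn mulrC divfK // expiD expi_nat mul1r -conj_expi expi_nat.
  by rewrite /conjc /= oppr0.
have zE : z = expi ((a %% n)%N%:R / n%:R) * (expi ((c %% n)%N%:R / n%:R))^*%C.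
  by rewrite -!expi_mod // conj_expi -expiD; congr expi; field.
have E1 : expi ((c %% n)%N%:R / n%:R) * (expi ((c %% n)%N%:R / n%:R))^*%C = 1.
  by rewrite conj_expi -expiD subrr expi0.
under eq_bigr do rewrite expiMn -/z.
case: ifPn => [/eqP E|ne].
  have -> : z = 1 by rewrite zE E E1.
  under eq_bigr do rewrite expr1n.
  by rewrite sumr_const_nat subn0.
have z1 : z != 1.
  apply/eqP => z1.
  (* Distinct fractions of denominator [n] in the unit interval have distinct images: otherwise the
     cosine of their difference would be [1]. *)
  have K (x y : nat) : (x < y)%N -> (y < n)%N -> expi (x%:R / n%:R) != expi (y%:R / n%:R).
    move=> xy yn; apply/eqP => E.
    have h : expi ((y - x)%N%:R / n%:R) = 1.
      rewrite natrB 1?ltnW // mulrBl expiD -E -expiD subrr; exact: expi0.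
    have : cos (2 * pi * ((y - x)%N%:R / n%:R)) < 1 :> R.
      apply: cos2pi_lt1; rewrite divr_gt0 ?ltr0n ?subn_gt0 //=.
      by rewrite ltr_pdivrMr ?ltr0n // mul1r ltr_nat; lia.
    by move/(congr1 (@complex.Re R)): h => /= ->; rewrite ltxx.
  have E : expi ((a %% n)%N%:R / n%:R) = expi ((c %% n)%N%:R / n%:R).
    by rewrite -[RHS]mul1r -z1 zE -mulrA [_^*%C * _]mulrC E1 mulr1.
  have [lt|gt|eq] := ltngtP (a %% n)%N (c %% n)%N.
  - by have := K _ _ lt (ltn_pmod _ n0); rewrite E eqxx.
  - by have := K _ _ gt (ltn_pmod _ n0); rewrite E eqxx.
  - by rewrite eq eqxx in ne.
apply: (mulfI (x := z - 1)); first by rewrite subr_eq0.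
by rewrite big_mkord -subrX1 zn subrr mulr0.
Qed.

End Exponentials.

(** * The factor of a single digit *)

Section DigitFactor.
Variables (R : realType) (b : nat).
Hypothesis b1 : (1 < b)%N.
Local Notation C := R[i].
Local Notation nc := (@Normc.normc R).
Local Notation e := (@expi R).

Let b0 : (0 < b)%N. Proof. exact: ltnW. Qed.
Let b0R : 0 < b%:R :> R. Proof. by rewrite ltr0n. Qed.

(** Division by [b] brings the factor into the unit interval, so that factors may be dropped from a
    product. *)
Definition digit_factor (t : R) : R :=
  nc (\sum_(0 <= c < b) e (c%:R * t)) / b%:R.
Local Notation w := digit_factor.

Lemma digit_factor_ge0 t : 0 <= w t.
Proof. by rewrite divr_ge0 ?nc_ge0. Qed.

(** The gain comes from the digits [0] and [1]: with [c = cos (2 pi t)], squaring shows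
    [|1 + e(t)| <= (3 + c) / 2]. Each other digit contributes at most [1]. *)
Lemma digit_factor_le t : w t <= 1 - (1 - cos (2 * pi * t)) / (2 * b%:R).
Proof.
rewrite /w ler_pdivrMr //.
have -> : (1 - (1 - cos (2 * pi * t)) / (2 * b%:R)) * b%:R =
  b%:R - (1 - cos (2 * pi * t)) / 2 by field; rewrite lt0r_neq0.
have [b' Eb] : exists b', b = b'.+2 by case: b b1 => [|[|b']] // _; exists b'.
rewrite Eb big_nat_recl // big_nat_recl // mul0r mul1r expi0 addrA.
apply: le_trans (ncD _ _) _.
have h1 : nc (\sum_(0 <= i < b') e (i.+2%:R * t)) <= b'%:R.
  apply: le_trans (nc_sum _ _ _) _.
  under eq_bigr do rewrite nc_expi.
  by rewrite sumr_const_nat subn0.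
have h2 : nc (1 + e t) <= 2 - (1 - cos (2 * pi * t)) / 2.
  have := nc_1addexpi t; have := nc_ge0 (1 + e t); have := cos_geN1 (2 * pi * t).
  move: (nc _) (cos _) => x c c1 x0 xE.
  have -> : 2 - (1 - c) / 2 = (3 + c) / 2 by field.
  rewrite -(ler_pXn2r (n := 2)) ?nnegrE //; last by lra.
  have := sqr_ge0 (c - 1); rewrite xE; lra.
have -> : b'.+2%:R = 2 + b'%:R :> R by rewrite -natrD.
lra.
Qed.

Lemma digit_factor_le1 t : w t <= 1.
Proof.
apply: le_trans (digit_factor_le t) _.
by rewrite gerBl divr_ge0 ?mulr_ge0 // subr_ge0 cos_le1.
Qed.

(* [e (a / d)] is at a distance bounded below from [1], while it is
   [e t1 ^+ b * (e t2)^-1]; so [e t1] and [e t2] cannot both be close to [1] *)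
Lemma digit_factor_pair : exists rho : R, [/\ 0 < rho, rho < 1 &
  forall (t1 t2 : R) (a d : nat), (0 < d)%N ->
    b%:R * t1 - t2 = a%:R / d%:R -> far_from_int b d (a %% d) ->
    w t1 * w t2 <= rho].
Proof.
have b2R : 2 <= b%:R :> R by rewrite ler_nat.
set u : R := (b%:R ^+ 2)^-1.
have u0 : 0 < u by rewrite invr_gt0 exprn_gt0.
have ub : u * b%:R ^+ 2 = 1 by rewrite mulVf // gt_eqF // exprn_gt0.
have u1 : u < 1 by nra.
pose kap := cos (2 * pi * u).
have kap1 : kap < 1 by apply: cos2pi_lt1; rewrite u0.
(* A far fraction has [|1 - e(a / d)| ^ 2 >= 2 (1 - kap)]. Two distances with squares below [2 eta],
   combined with the weights [b] and [1], stay strictly below that. *)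
pose eta := (1 - kap) / (b%:R + 1) ^+ 2.
have eta0 : 0 < eta by rewrite divr_gt0 ?subr_gt0 // exprn_gt0 // ltr_wpDl // ltW.
have etaE : eta * (b%:R + 1) ^+ 2 = 1 - kap.
  by rewrite mulrVK // unitfE expf_neq0 // gt_eqF // ltr_wpDl // ltW.
have eta2 : eta <= 2.
  have : -1 <= kap by exact: cos_geN1.
  nra.
exists (1 - eta / (2 * b%:R)); split.
- by rewrite subr_gt0 ltr_pdivrMr; nra.
- by rewrite gtrBl divr_gt0 // mulr_gt0.
move=> t1 t2 a d d0 E /andP [f1 f2].
have wprod t t' : cos (2 * pi * t) <= 1 - eta -> w t * w t' <= 1 - eta / (2 * b%:R).
  move=> h; apply: le_trans (_ : _ <= w t) _.
    by rewrite ler_piMr ?digit_factor_ge0 // digit_factor_le1.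
  apply: le_trans (digit_factor_le t) _; rewrite lerD2l lerN2 ler_pM2r ?invr_gt0 ?mulr_gt0 //.
  lra.
have [h1|h1] := leP (cos (2 * pi * t1)) (1 - eta); first exact: wprod.
have [h2|h2] := leP (cos (2 * pi * t2)) (1 - eta); first by rewrite mulrC; exact: wprod.
exfalso.
have far : 2 * (1 - kap) <= nc (1 - e (a%:R / d%:R)) ^+ 2.
  rewrite expi_mod // nc_1subexpi.
  have : cos (2 * pi * ((a %% d)%N%:R / d%:R)) <= kap; last by lra.
  have dR : 0 < d%:R :> R by rewrite ltr0n.
  apply: cos2pi_far => //.
  rewrite ler_pdivlMr // ler_pdivrMr // mulrBl mul1r.
  have g1 : d%:R <= b%:R ^+ 2 * (a %% d)%N%:R :> R by rewrite -natrX -natrM ler_nat.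
  have g2 : d%:R <= b%:R ^+ 2 * (d%:R - (a %% d)%N%:R) :> R.
    rewrite -natrB; last by rewrite ltnW ?ltn_mod.
    by rewrite -natrX -natrM ler_nat.
  have E3 (y : R) : y = u * (b%:R ^+ 2 * y) by rewrite mulrA ub mul1r.
  have : u * d%:R <= (a %% d)%N%:R by rewrite [leRHS]E3 ler_pM2l.
  have : u * d%:R <= d%:R - (a %% d)%N%:R by rewrite [leRHS]E3 ler_pM2l.
  lra.
have near : nc (1 - e (a%:R / d%:R)) <= b%:R * nc (1 - e t1) + nc (1 - e t2).
  rewrite -E expiD.
  have -> : 1 - e (b%:R * t1) * e (- t2) =
    (1 - e (b%:R * t1)) * e (- t2) + (1 - e (- t2)) by ring.
  apply: le_trans (ncD _ _) _; apply: lerD.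
    by rewrite Normc.normcM nc_expi mulr1 nc_1subexpiMn.
  by rewrite -(ler_pXn2r (n := 2)) ?nnegrE ?nc_ge0 // !nc_1subexpi mulrN cosN.
have s1 : nc (1 - e t1) ^+ 2 < 2 * eta by rewrite nc_1subexpi; lra.
have s2 : nc (1 - e t2) ^+ 2 < 2 * eta by rewrite nc_1subexpi; lra.
have n1 := nc_ge0 (1 - e t1); have n2 := nc_ge0 (1 - e t2).
have n3 := nc_ge0 (1 - e (a%:R / d%:R)).
move: far near s1 s2 n1 n2 n3 etaE; move: (nc (1 - e t1)) (nc (1 - e t2)) (nc _) => x y z far near s1 s2 n1 n2 n3 etaE.
have : z ^+ 2 <= (b%:R * x + y) ^+ 2 by apply: lerXn2r; rewrite ?nnegrE // addr_ge0 // mulr_ge0.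
(* Cauchy-Schwarz with the weights [b] and [1]. *)
have : (b%:R * x + y) ^+ 2 <= (b%:R + 1) * (b%:R * x ^+ 2 + y ^+ 2).
  rewrite -subr_ge0.
  have -> : (b%:R + 1) * (b%:R * x ^+ 2 + y ^+ 2) - (b%:R * x + y) ^+ 2 = b%:R * (x - y) ^+ 2 by ring.
  by rewrite mulr_ge0 ?sqr_ge0.
have : (b%:R + 1) * (b%:R * x ^+ 2 + y ^+ 2) < (b%:R + 1) * ((b%:R + 1) * (2 * eta)).
  rewrite ltr_pM2l; last by rewrite ltr_wpDl.
  by rewrite mulrDl mul1r ltrD // ltr_pM2l.
have -> : (b%:R + 1) * ((b%:R + 1) * (2 * eta)) = 2 * (1 - kap) by rewrite -etaE; ring.
lra.
Qed.

Definition digit_form (y : nat -> nat) (m v : nat) : nat :=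
  (\sum_(0 <= i < m) dig b i v * y i)%N.

Lemma sum_expi_digit_form (y : nat -> nat) (m : nat) (t : R) :
  \sum_(0 <= v < b ^ m) e ((digit_form y m v)%:R * t) =
  \prod_(0 <= i < m) \sum_(0 <= c < b) e (c%:R * ((y i)%:R * t)).
Proof.
rewrite -(sum_prod_digits m (fun i c => e (c%:R * ((y i)%:R * t))) b0).
apply: eq_big_nat => v _; rewrite /digit_form natr_sum mulr_suml.
elim/big_rec2: _ => [|i z x _ <-]; first by rewrite expi0.
by rewrite expiD natrM mulrA.
Qed.

Lemma nc_sum_expi_digit_form (y : nat -> nat) (m : nat) (t : R) :
  nc (\sum_(0 <= v < b ^ m) e ((digit_form y m v)%:R * t)) =
  b%:R ^+ m * \prod_(0 <= i < m) w ((y i)%:R * t).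
Proof.
rewrite sum_expi_digit_form nc_prod /w big_split /= prodr_const_nat subn0.
by rewrite exprVn mulrCA mulfV ?mulr1 // expf_neq0 // lt0r_neq0.
Qed.

(** Parseval: the left side sums the squared moduli of the exponential sums at all [l / n], and
    orthogonality keeps the congruent pairs. *)
Lemma sum_sqr_digit_factor (y : nat -> nat) (m n : nat) : (0 < n)%N ->
  \sum_(0 <= l < n) (b%:R ^+ m * \prod_(0 <= i < m) w ((y i)%:R * (l%:R / n%:R))) ^+ 2 =
  \sum_(0 <= v < b ^ m) \sum_(0 <= v' < b ^ m)
    (if (digit_form y m v == digit_form y m v' %[mod n])%N then n%:R else 0) :> R.
Proof.
move=> n0; apply: (@complexI R); rewrite rmorph_sum /=.
transitivity (\sum_(0 <= l < n) \sum_(0 <= v < b ^ m) \sum_(0 <= v' < b ^ m)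
   e (l%:R * (((digit_form y m v)%:R - (digit_form y m v')%:R) / n%:R))).
  apply: eq_bigr => l _.
  rewrite -nc_sum_expi_digit_form.
  pose S := \sum_(0 <= v < b ^ m) e ((digit_form y m v)%:R * (l%:R / n%:R)).
  rewrite -/S.
  transitivity (S * S^*%C).
    rewrite ncE /S; case: (\sum_(_ <= _ < _) _) => x z /=.
    by apply/eqP; rewrite eq_complex /=; apply/andP; split; apply/eqP; ring.
  have -> : S^*%C = \sum_(0 <= v < b ^ m) e (- ((digit_form y m v)%:R * (l%:R / n%:R))).
    by rewrite /S rmorph_sum; apply: eq_bigr => v _; exact: conj_expi.
  rewrite /S mulr_suml; apply: eq_bigr => v _.
  rewrite mulr_sumr; apply: eq_bigr => v' _.
  by rewrite -expiD; congr e; ring.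
rewrite exchange_big /=.
have -> : (\sum_(0 <= v < b ^ m) \sum_(0 <= v' < b ^ m)
    (if (digit_form y m v == digit_form y m v' %[mod n])%N then n%:R else 0 : R))%:C%C =
  \sum_(0 <= v < b ^ m) \sum_(0 <= v' < b ^ m)
    (if (digit_form y m v == digit_form y m v' %[mod n])%N then n%:R else 0) :> C.
  rewrite rmorph_sum; apply: eq_bigr => v _; rewrite rmorph_sum; apply: eq_bigr => v' _.
  by case: ifP => _; [exact: (rmorph_nat (real_complex R)) | exact: (rmorph0 (real_complex R))].
apply: eq_bigr => v _; rewrite exchange_big /=; apply: eq_bigr => v' _.
by rewrite expi_sum_eq0.
Qed.

End DigitFactor.

(** * Detection of residue classes by exponential sums *)

Section Detection.
Variables (R : realType) (b : nat).
Hypothesis b1 : (1 < b)%N.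
Local Notation C := R[i].
Local Notation e := (@expi R).
Local Notation w := (@digit_factor R b).

Lemma sum_expi_dvd (q B : nat) (t : R) : (0 < q)%N -> (0 < B)%N ->
  \sum_(0 <= l < q * B | (q %| l)%N) e (l%:R * (t / (q * B)%N%:R)) =
  \sum_(0 <= l < B) e (l%:R * (t / B%:R)).
Proof.
move=> q0 B0; rewrite mulnC big_mkcond big_nat_mul_digits.
apply: eq_bigr => i _; rewrite -{1}(prednK q0) big_nat_recl //= addn0 dvdn_mull //.
rewrite big_nat big1 ?addr0 => [|j /andP [_ jq]]; last first.
  by rewrite dvdn_addr ?dvdn_mull // gtnNdvd //; lia.
congr e; rewrite !natrM; field.
by rewrite !pnatr_eq0 -!lt0n B0 q0.
Qed.

(** All [l] together detect [a'] modulo [q B], and the multiples of [q] alone detect [c] modulo [B].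
    The difference is the deviation from equidistribution modulo [q] inside the class of [c]. *)
Lemma sum_expi_ndvd (q B n a c a' : nat) : (0 < q)%N -> (0 < B)%N -> coprime q B ->
  a' = a %[mod q] -> a' = c %[mod B] ->
  \sum_(0 <= l < q * B | ~~ (q %| l)%N) e (l%:R * ((n%:R - a'%:R) / (q * B)%N%:R)) =
  ((q * B)%:R * ((n == c %[mod B])%N%:R * ((n == a %[mod q])%N%:R - q%:R^-1)))%:C%C.
Proof.
move=> q0 B0 cop Ea Ec.
have qB0 : (0 < q * B)%N by rewrite muln_gt0 q0.
have := expi_sum_eq0 R n a' qB0; rewrite (bigID (fun l => q %| l)%N) /=.
rewrite sum_expi_dvd // expi_sum_eq0 // chinese_remainder // Ea Ec => /eqP.
rewrite addrC eq_sym -subr_eq eq_sym => /eqP ->.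
have q0' : q%:R != 0 :> R by rewrite pnatr_eq0 -lt0n.
case: (n == c %[mod B])%N; rewrite ?andbF ?andbT /=; last by rewrite mul0r mulr0 subrr.
have -> : (q * B)%:R * (1 * ((n == a %[mod q])%N%:R - q%:R^-1)) =
    (q * B)%:R * (n == a %[mod q])%N%:R - B%:R :> R by rewrite natrM; field.
rewrite -natrM rmorphB; congr (_ - _); last by rewrite (rmorph_nat (real_complex R)).
by rewrite (rmorph_nat (real_complex R)); case: ifP => _; rewrite ?muln1 ?muln0.
Qed.

Lemma class_discrepancy_le (y : nat -> nat) (m n0 q B a c : nat) :
  (0 < q)%N -> (0 < B)%N -> coprime q B ->
  `|\sum_(0 <= v < b ^ m) ((n0 + digit_form b y m v == c %[mod B])%N%:R *
      ((n0 + digit_form b y m v == a %[mod q])%N%:R - q%:R^-1))| * (q * B)%:R <=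
  b%:R ^+ m * \sum_(0 <= l < q * B | ~~ (q %| l)%N)
     \prod_(0 <= i < m) w ((y i)%:R * (l%:R / (q * B)%:R)) :> R.
Proof.
move=> q0 B0 cop.
set a' := chinese q B a c.
have Ea : a' = a %[mod q] by exact: chinese_modl.
have Ec : a' = c %[mod B] by exact: chinese_modr.
rewrite -[X in _ * X]ger0_norm // -normrM -nc_real.
have -> : ((\sum_(0 <= v < b ^ m) ((n0 + digit_form b y m v == c %[mod B])%N%:R *
      ((n0 + digit_form b y m v == a %[mod q])%N%:R - q%:R^-1))) * (q * B)%:R)%:C%C =
  \sum_(0 <= l < q * B | ~~ (q %| l)%N) \sum_(0 <= v < b ^ m)
    e (l%:R * (((n0 + digit_form b y m v)%N%:R - a'%:R) / (q * B)%N%:R)).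
  rewrite exchange_big /= mulrC mulr_sumr rmorph_sum; apply: eq_bigr => v _.
  by rewrite (sum_expi_ndvd _ q0 B0 cop Ea Ec).
apply: le_trans (nc_sum _ _ _) _; rewrite mulr_sumr; apply: ler_sum => l _.
have -> : \sum_(0 <= v < b ^ m)
    e (l%:R * (((n0 + digit_form b y m v)%N%:R - a'%:R) / (q * B)%N%:R)) =
  e (l%:R * ((n0%:R - a'%:R) / (q * B)%N%:R)) *
  \sum_(0 <= v < b ^ m) e ((digit_form b y m v)%:R * (l%:R / (q * B)%:R)).
  rewrite mulr_sumr; apply: eq_bigr => v _; rewrite -expiD; congr e.
  by rewrite natrD; ring.
by rewrite Normc.normcM nc_expi mul1r nc_sum_expi_digit_form.
Qed.

(** [U] is a union of at most [B] classes modulo [B], each with the bound of [class_discrepancy_le]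
    divided by [q B]; so only the denominator [q] remains. *)
Lemma residue_set_discrepancy_le (y : nat -> nat) (m n0 q B a : nat) (U : pred nat) :
  (0 < q)%N -> (0 < B)%N -> coprime q B ->
  `|\sum_(0 <= v < b ^ m | U ((n0 + digit_form b y m v) %% B)%N)
      ((n0 + digit_form b y m v == a %[mod q])%N%:R - q%:R^-1)| <=
  b%:R ^+ m / q%:R * \sum_(0 <= l < q * B | ~~ (q %| l)%N)
     \prod_(0 <= i < m) w ((y i)%:R * (l%:R / (q * B)%:R)) :> R.
Proof.
move=> q0 B0 cop; set n := fun v => (n0 + digit_form b y m v)%N.
pose D c := \sum_(0 <= v < b ^ m) ((n v == c %[mod B])%N%:R *
      ((n v == a %[mod q])%N%:R - q%:R^-1)) : R.
have -> : \sum_(0 <= v < b ^ m | U (n v %% B)%N) ((n v == a %[mod q])%N%:R - q%:R^-1) =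
   \sum_(0 <= c < B | U c) D c.
  rewrite [RHS]exchange_big /= big_mkcond; apply: eq_bigr => v _.
  have lt : (n v %% B < B)%N by rewrite ltn_mod.
  rewrite big_mkcond big_mkord (bigD1 (Ordinal lt)) //= modn_mod eqxx mul1r.
  rewrite big1 ?addr0 // => i ne; case: ifP => // _.
  case: eqP => [E|]; last by rewrite mul0r.
  by case/negP: ne; apply/eqP/val_inj; rewrite /= E modn_small.
set S := \sum_(0 <= l < q * B | _) _.
have q0' : 0 < q%:R :> R by rewrite ltr0n.
have B0' : 0 < B%:R :> R by rewrite ltr0n.
have S0 : 0 <= S.
  rewrite /S; apply: sumr_ge0 => l _; apply: prodr_ge0 => i _.
  exact: digit_factor_ge0.
have DS c : `|D c| <= b%:R ^+ m * S / (q * B)%:R.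
  rewrite ler_pdivlMr ?natrM ?mulr_gt0 // -natrM; exact: class_discrepancy_le.
apply: le_trans (ler_norm_sum _ _ _) _.
apply: le_trans (ler_sum _ (fun c _ => DS c)) _.
rewrite big_mkcond /=.
apply: le_trans (_ : _ <= \sum_(0 <= c < B) (b%:R ^+ m * S / (q * B)%:R)) _.
  apply: ler_sum => c _; case: ifP => // _.
  by rewrite divr_ge0 // mulr_ge0 // exprn_ge0.
rewrite sumr_const_nat subn0 -mulr_natr natrM le_eqVlt; apply/orP; left; apply/eqP.
by field; rewrite !lt0r_neq0.
Qed.

End Detection.

(** * Moments of the digit products *)

Lemma prod_nat_ge0 (R : numDomainType) (m n : nat) (f : nat -> R) :
  (forall i, 0 <= f i) -> 0 <= \prod_(m <= i < n) f i.
Proof. by move=> f0; apply: prodr_ge0 => i _. Qed.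

Lemma prod_nat_le1 (R : numDomainType) (m n : nat) (f : nat -> R) :
  (forall i, 0 <= f i <= 1) -> \prod_(m <= i < n) f i <= 1.
Proof.
move=> f01; apply: le_trans (_ : _ <= \prod_(m <= i < n) 1) _.
  by apply: ler_prod => i _.
by rewrite big1.
Qed.

(** In the product of the pairs every inner factor occurs twice and the two end factors once; the
    remaining copies of the latter are at most [1]. *)
Lemma sqr_prod_le_pairs (R : numDomainType) (a c : nat) (f : nat -> R) :
  (a <= c)%N -> (forall i, 0 <= f i <= 1) ->
  (\prod_(a <= i < c.+1) f i) ^+ 2 <= \prod_(a <= i < c) (f i * f i.+1).
Proof.
move=> ac f01; have f0 i : 0 <= f i by case/andP: (f01 i).
have f1 i : f i <= 1 by case/andP: (f01 i).
rewrite big_split /= expr2; apply: ler_pM; rewrite ?prod_nat_ge0 //.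
  by rewrite big_nat_recr //= ler_piMr // prod_nat_ge0.
rewrite big_nat_recl // -[X in _ <= X]mul1r.
by rewrite ler_wpM2r // prod_nat_ge0.
Qed.

Lemma prod_windows_le (R : numDomainType) (L n : nat) (rho : R) (g : nat -> R) :
  (0 < L)%N -> 0 <= rho -> (forall i, 0 <= g i <= 1) ->
  (forall p, exists2 j, (j < L)%N & g (p + j)%N <= rho) ->
  \prod_(0 <= i < n) g i <= rho ^+ (n %/ L).
Proof.
move=> L0 rho0 g01 win; have g0 i : 0 <= g i by case/andP: (g01 i).
rewrite (big_cat_nat (n := (n %/ L * L)%N)) ?leq_divM //=.
apply: le_trans (_ : _ <= rho ^+ (n %/ L) * 1) _; last by rewrite mulr1.
apply: ler_pM; rewrite ?prod_nat_ge0 ?prod_nat_le1 //.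
rewrite big_nat_mul -[X in rho ^+ X]subn0 -prodr_const_nat.
apply: ler_prod => i _; rewrite prod_nat_ge0 //=.
have [j jL gj] := win (i * L)%N.
rewrite (big_cat_nat (n := (i * L + j)%N)) /=; first last.
- by rewrite mulSn; lia.
- exact: leq_addr.
rewrite [X in _ * X]big_ltn; last by rewrite mulSn; lia.
apply: le_trans (_ : _ <= 1 * (rho * 1)) _; last by rewrite mul1r mulr1.
apply: ler_pM; rewrite ?mulr_ge0 ?prod_nat_ge0 ?prod_nat_le1 //.
by apply: ler_pM; rewrite ?prod_nat_ge0 ?prod_nat_le1.
Qed.

(** * Pointwise bounds on blocks of factors *)

Section Blocks.
Variables (R : realType) (b : nat).
Hypothesis b1 : (1 < b)%N.
Local Notation w := (@digit_factor R b).
Local Notation B := (b ^ 2 - 1)%N.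

Let b0 : (0 < b)%N. Proof. exact: ltnW. Qed.
Let B0 : (0 < B)%N. Proof. by rewrite subn_gt0 -{1}(exp1n 2) ltn_exp2r. Qed.

Let w01 t : 0 <= w t <= 1.
Proof. by rewrite digit_factor_ge0 // digit_factor_le1. Qed.

Definition pal_factor (M : nat) (t : R) (i : nat) : R := w ((pal_weight b M i)%:R * t).

Lemma pal_factor01 M t i : 0 <= pal_factor M t i <= 1.
Proof. exact: w01. Qed.

(* The block [i0 < i <= i0 + J]; up to a power of [b] its frequencies are
   [P v = \sum_j v_j (b ^ (J - 1 - j) + b ^ (2 i0 + J + 1 + j))], whose residue
   modulo [b ^ J] determines [v]. *)
Definition block_form (i0 J v : nat) : nat :=
  digit_form b (fun j => b ^ (J.-1 - j) + b ^ (i0.*2 + J + 1 + j))%N J v.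

Lemma block_formE i0 J v : (v < b ^ J)%N ->
  block_form i0 J v = (v * b ^ (i0.*2 + J + 1) +
    \sum_(0 <= j < J) dig b (J.-1 - j) v * b ^ j)%N.
Proof.
move=> vJ; rewrite /block_form /digit_form; under eq_bigr do rewrite mulnDr.
rewrite big_split /= addnC; congr (_ + _)%N.
  rewrite -{2}(sum_digits_val b0 vJ) big_distrl; apply: eq_bigr => i _.
  by rewrite /= expnD [(b ^ _ * b ^ i)%N]mulnC mulnA.
rewrite big_nat_rev /=; apply: eq_big_nat => j /andP [_ jJ].
by congr (dig b _ v * b ^ _)%N; lia.
Qed.

Lemma block_form_lt i0 J v : (v < b ^ J)%N -> (block_form i0 J v < b ^ (i0 + J).*2.+1)%N.
Proof.
move=> vJ; rewrite block_formE //.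
have h := sum_digits_lt J b0 (c := fun j => dig b (J.-1 - j) v) (fun j => dig_ltn _ _ b0).
have h2 : (v.+1 * b ^ (i0.*2 + J + 1) <= b ^ J * b ^ (i0.*2 + J + 1))%N by rewrite leq_mul2r vJ orbT.
have h3 : (b ^ J <= b ^ (i0.*2 + J + 1))%N by rewrite leq_pexp2l //; lia.
have -> : ((i0 + J).*2.+1 = J + (i0.*2 + J + 1))%N by lia.
rewrite (expnD b J); move: h h2 h3; rewrite mulSn.
move: (b ^ (i0.*2 + J + 1))%N => X; lia.
Qed.

Lemma block_form_inj i0 J v v' : (v < b ^ J)%N -> (v' < b ^ J)%N ->
  block_form i0 J v = block_form i0 J v' -> v = v'.
Proof.
move=> vJ v'J E; apply: (eq_from_digits b0 vJ v'J) => i iJ.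
have D u : (u < b ^ J)%N -> dig b (J.-1 - i) (block_form i0 J u) = dig b i u.
  move=> uJ; rewrite block_formE //.
  have -> : (i0.*2 + J + 1 = (i0.*2 + 1) + J)%N by lia.
  rewrite expnD mulnA dig_add_low //; last by lia.
  rewrite (dig_sum b0 (c := fun j => dig b (J.-1 - j) u)); last 2 first.
  - by move=> j; exact: dig_ltn.
  - by lia.
  by congr dig; lia.
by rewrite -D // E D.
Qed.

Lemma digit_form_block M i0 J v : (i0 + J <= M)%N ->
  digit_form b (fun j => pal_weight b M (i0 + 1 + j)) J v =
  (b ^ (M - (i0 + J)) * block_form i0 J v)%N.
Proof.
move=> h; rewrite /block_form /digit_form big_distrr /=.
apply: eq_big_nat => j /andP [_ jJ]; rewrite mulnCA; congr (_ * _)%N.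
rewrite /pal_weight ifF; last by lia.
by rewrite mulnDr -!expnD; congr (b ^ _ + b ^ _)%N; lia.
Qed.

Variable rho : R.
Hypothesis rho01 : 0 < rho < 1.
Hypothesis rho_pair : forall (t1 t2 : R) (a d : nat), (0 < d)%N ->
    b%:R * t1 - t2 = a%:R / d%:R -> far_from_int b d (a %% d) ->
    w t1 * w t2 <= rho.

(** The differences [b y_i - y_(i+1)] and [b y_(i+1) - y_i] contain the factor [B], which cancels
    here; what remains concerns the expansion of [l / d]. *)
Lemma natr_expn_B (d l j : nat) : (0 < d)%N ->
  (b ^ j * B)%:R * (l%:R / (d * B)%:R) = (b ^ j * l)%:R / d%:R :> R.
Proof.
move=> d0; rewrite !natrM; field.
by rewrite !pnatr_eq0 -!lt0n B0 d0.
Qed.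

(** Here [b y_(i+1) - y_i = b ^ (M + i) B]. *)
Lemma pal_factor_pair_high (M i d l : nat) : (0 < d)%N -> (0 < i < M)%N ->
  far_from_int b d ((b ^ (M + i) * l) %% d) ->
  pal_factor M (l%:R / (d * B)%:R) i * pal_factor M (l%:R / (d * B)%:R) i.+1 <= rho.
Proof.
move=> d0 /andP [i0 iM]; rewrite mulrC.
apply: rho_pair => //; rewrite -natr_expn_B // mulrA -mulrBl; congr (_ * _).
rewrite /pal_weight /= gtn_eqF // -natrM -natrB; last first.
  rewrite mulnDr -!expnS; apply: leq_add; rewrite leq_pexp2l //; lia.
congr _%:R; rewrite mulnDr -!expnS mulnBr muln1 -expnD.
have -> : ((M - i.+1).+1 = M - i)%N by lia.
have -> : ((M + i.+1).+1 = M + i + 2)%N by lia.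
by rewrite subnDl.
Qed.

(** Here [b y_i - y_(i+1) = b ^ (M - i - 1) B]. *)
Lemma pal_factor_pair_low (M i d l : nat) : (0 < d)%N -> (0 < i < M)%N ->
  far_from_int b d ((b ^ (M - i.+1) * l) %% d) ->
  pal_factor M (l%:R / (d * B)%:R) i * pal_factor M (l%:R / (d * B)%:R) i.+1 <= rho.
Proof.
move=> d0 /andP [i0 iM].
apply: rho_pair => //; rewrite -natr_expn_B // mulrA -mulrBl; congr (_ * _).
rewrite /pal_weight /= gtn_eqF // -natrM -natrB; last first.
  rewrite mulnDr -!expnS; apply: leq_add; rewrite leq_pexp2l //; lia.
congr _%:R; rewrite mulnDr -!expnS mulnBr muln1 -expnD.
have -> : ((M - i).+1 = M - i.+1 + 2)%N by lia.
have -> : ((M + i).+1 = M + i.+1)%N by lia.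
by rewrite subnDr.
Qed.

(** The saving for small denominators: by [far_in_window] every run of [k + 1] consecutive places
    contains a far one, which makes a pair of factors at most [rho]. The square allows each factor
    to serve in two pairs. *)
Lemma pal_factor_pointwise (M N k d l : nat) : (N <= M)%N -> (0 < N)%N ->
  (1 < d)%N -> (d < b ^ k.+1)%N -> coprime d b -> coprime l d ->
  (\prod_(1 <= i < N.+1) pal_factor M (l%:R / (d * B)%:R) i) ^+ 2 <=
  rho ^+ (N.-1 %/ k.+1).
Proof.
move=> NM N0 d1 dk db ld; set f := pal_factor M _.
have d0 : (0 < d)%N by lia.
have f01 i : 0 <= f i <= 1 by exact: pal_factor01.
apply: le_trans (sqr_prod_le_pairs N0 f01) _.
case/andP: rho01 => rho0 rho1.
pose g i : R := if far_from_int b d ((b ^ (M + i.+1) * l) %% d) then rho else 1.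
have g01 i : 0 <= g i <= 1.
  by rewrite /g; case: ifP => _; rewrite ?ler01 ?lexx // !ltW.
apply: le_trans (_ : _ <= \prod_(0 <= i < N.-1) g i) _.
  rewrite -[1%N]add0n big_addn subn1 !big_nat; apply: ler_prod => i /andP [_ iN].
  rewrite addn1; case/andP: (f01 i.+1) => p1 p2; case/andP: (f01 i.+2) => p3 p4.
  rewrite mulr_ge0 //= /g; case: ifPn => far; last exact: mulr_ile1.
  by apply: pal_factor_pair_high => //; lia.
apply: prod_windows_le => //; first exact: ltW.
move=> p; pose r := ((b ^ (M + p.+1) * l) %% d)%N.
have r0 : (0 < r < d)%N.
  rewrite ltn_mod d0 andbT lt0n; apply/negP => dv.
  have : coprime (b ^ (M + p.+1) * l) d by rewrite coprimeMl ld andbT coprimeXl // coprime_sym.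
  rewrite coprime_sym /coprime; move/gcdn_idPl: (dv : (d %| _)%N) => ->.
  by rewrite gtn_eqF.
have [j jk far] := far_in_window b1 dk r0.
exists j; first by rewrite ltnS.
rewrite /g; have -> : ((b ^ (M + (p + j).+1) * l) %% d = (b ^ j * r) %% d)%N.
  rewrite /r modnMmr mulnA -expnD; congr ((b ^ _ * l) %% d)%N; lia.
by rewrite far.
Qed.

End Blocks.

Section Moments.
Variables (R : realType) (b : nat).
Hypothesis b1 : (1 < b)%N.
Local Notation w := (@digit_factor R b).
Local Notation B := (b ^ 2 - 1)%N.

Let b0 : (0 < b)%N. Proof. exact: ltnW. Qed.
Let B0 : (0 < B)%N. Proof. by rewrite subn_gt0 -{1}(exp1n 2) ltn_exp2r. Qed.
Let bR : 0 < b%:R :> R. Proof. by rewrite ltr0n. Qed.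

(** Parseval modulo [d B]. The congruences are weakened to the modulus [d], where the power of [b]
    from [digit_form_block] cancels because [d] is coprime to [b]. *)
Lemma block_sum_sqr (M i0 J d : nat) : (i0 + J <= M)%N -> (0 < d)%N -> coprime d b ->
  \sum_(0 <= l < d * B)
     (b%:R ^+ J * \prod_((i0 + 1)%N <= i < i0 + 1 + J) pal_factor b M (l%:R / (d * B)%:R) i) ^+ 2 <=
  \sum_(0 <= v < b ^ J) \sum_(0 <= v' < b ^ J)
    (if (block_form b i0 J v == block_form b i0 J v' %[mod d])%N then (d * B)%:R else 0) :> R.
Proof.
move=> hM d0 db.
have dB0 : (0 < d * B)%N by rewrite muln_gt0 d0 B0.
pose y j := pal_weight b M (i0 + 1 + j).
have E := sum_sqr_digit_factor R b1 y J dB0.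
apply: le_trans (_ : _ <= \sum_(0 <= v < b ^ J) \sum_(0 <= v' < b ^ J)
  (if (digit_form b y J v == digit_form b y J v' %[mod d * B])%N then (d * B)%:R else 0)) _.
  rewrite le_eqVlt; apply/orP; left; apply/eqP; rewrite -E; apply: eq_bigr => l _.
  congr ((_ * _) ^+ 2); rewrite -{1}[(i0 + 1)%N]add0n big_addn addKn.
  by apply: eq_bigr => i _; rewrite /pal_factor addnC.
apply: ler_sum => v _; apply: ler_sum => v' _.
rewrite /y !digit_form_block //.
case: ifPn => [h|_]; last by case: ifP.
rewrite ifT //; move: h.
wlog le : v v' / (block_form b i0 J v <= block_form b i0 J v')%N.
  move=> H h; have [le|le] := leqP (block_form b i0 J v) (block_form b i0 J v').
    exact: H.
  by rewrite eq_sym; apply: H; [exact: ltnW | rewrite eq_sym].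
rewrite eq_sym => h; rewrite eq_sym; move: h; rewrite !eqn_mod_dvd ?leq_mul2l ?le ?orbT // -mulnBr.
move=> h; rewrite -(@Gauss_dvdr d (b ^ (M - (i0 + J)))) ?coprimeXr //.
by apply: dvdn_trans h; rewrite dvdn_mulr.
Qed.

(* Summing over [d] first, an off-diagonal pair [v, v'] is counted once for each
   divisor [d] of a nonzero difference of block frequencies. *)
Lemma block_second_moment (M i0 k tau : nat) : (i0 + k <= M)%N ->
  (forall n, (0 < n)%N -> (n < b ^ (i0 + k).*2.+1)%N -> (size (divisors n) <= tau)%N) ->
  \sum_((b ^ k)%N <= d < (b ^ k.+1)%N | coprime d b) \sum_(0 <= l < d * B)
     (\prod_((i0 + 1)%N <= i < i0 + 1 + k) pal_factor b M (l%:R / (d * B)%:R) i) ^+ 2 <=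
  B%:R * b%:R ^+ k.+1 * (b + tau)%:R :> R.
Proof.
move=> hM htau.
have bk0 : 0 < (b%:R ^+ k) ^+ 2 :> R by rewrite !exprn_gt0.
rewrite -(ler_pM2l bk0) mulr_sumr.
pose cg d v v' := (block_form b i0 k v == block_form b i0 k v' %[mod d])%N.
pose X := (b ^ k.+1 * B)%:R : R.
apply: le_trans (_ : _ <= \sum_((b ^ k)%N <= d < (b ^ k.+1)%N)
   \sum_(0 <= v < b ^ k) \sum_(0 <= v' < b ^ k) (if cg d v v' then X else 0)) _.
  rewrite big_mkcond big_nat [leRHS]big_nat; apply: ler_sum => d /andP [dk1 dk2].
  have d0 : (0 < d)%N by apply: leq_trans dk1; rewrite expn_gt0 b0.
  case: ifPn => cop; last first.
    by apply: sumr_ge0 => v _; apply: sumr_ge0 => v' _; case: ifP.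
  rewrite mulr_sumr; under eq_bigr do rewrite -exprMn.
  apply: le_trans (block_sum_sqr hM d0 cop) _.
  apply: ler_sum => v _; apply: ler_sum => v' _; rewrite /cg; case: ifP => // _.
  by rewrite ler_nat leq_mul2r ltnW ?orbT.
rewrite exchange_big /=; under eq_bigr do rewrite exchange_big /=.
have inner v v' : (v < b ^ k)%N -> (v' < b ^ k)%N ->
   \sum_((b ^ k)%N <= d < (b ^ k.+1)%N) (if cg d v v' then X else 0) <=
   X * ((if v == v' then (b ^ k.+1)%:R else 0) + tau%:R).
  move=> vk v'k; rewrite -big_mkcond big_const_seq iter_addr addr0 -[X *+ _]mulr_natr.
  apply: ler_wpM2l => //.
  have [->|ne] := eqVneq v v'.
    rewrite -natrD ler_nat; apply: leq_trans (count_size _ _) _.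
    by rewrite size_iota; lia.
  rewrite add0r ler_nat.
  have key u u' : (u < b ^ k)%N -> (u' < b ^ k)%N -> u != u' -> (block_form b i0 k u <= block_form b i0 k u')%N ->
     (count (fun d => cg d u' u) (index_iota (b ^ k) (b ^ k.+1)) <= tau)%N.
    move=> uk u'k uu' le; set n := (block_form b i0 k u' - block_form b i0 k u)%N.
    have n0 : (0 < n)%N.
      rewrite subn_gt0 ltn_neqAle le andbT.
      by apply: contra uu' => /eqP E; apply/eqP; exact: block_form_inj E.
    have nlt : (n < b ^ (i0 + k).*2.+1)%N.
      by apply: leq_ltn_trans (leq_subr _ _) _; exact: block_form_lt.
    apply: leq_trans (htau n n0 nlt); rewrite -size_filter.
    apply: uniq_leq_size; first by rewrite filter_uniq ?iota_uniq.
    by move=> d; rewrite mem_filter /cg eqn_mod_dvd // -dvdn_divisors // => /andP [].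
  have [le|le] := leqP (block_form b i0 k v) (block_form b i0 k v').
    rewrite (@eq_count _ _ (fun d => cg d v' v)); first exact: key.
    by move=> d; rewrite /cg eq_sym.
  by apply: key => //; [rewrite eq_sym | exact: ltnW].
apply: le_trans (_ : _ <= \sum_(0 <= v < b ^ k) \sum_(0 <= v' < b ^ k)
    X * ((if v == v' then (b ^ k.+1)%:R else 0) + tau%:R)) _.
  rewrite big_nat [leRHS]big_nat; apply: ler_sum => v /andP [_ vk].
  rewrite big_nat [leRHS]big_nat; apply: ler_sum => v' /andP [_ v'k].
  exact: inner.
rewrite (eq_big_nat _ _ (F2 := fun v => X * ((b ^ k.+1)%:R + (b ^ k)%:R * tau%:R))); last first.
  move=> v /andP [_ vk]; rewrite -mulr_sumr big_split /= sumr_const_nat subn0 mulr_natl.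
  congr (_ * (_ + _)); rewrite -big_mkcond big_mkord.
  rewrite (bigD1 (Ordinal vk)) //= big1 ?addr0 // => i /andP [/eqP E ne].
  by case/negP: ne; apply/eqP/val_inj; rewrite /= -E.
rewrite sumr_const_nat subn0 -[_ *+ (b ^ k)]mulr_natr /X natrM natrD !natrX exprS.
move: (b ^ 2 - 1)%N => B'.
rewrite le_eqVlt; apply/orP; left; apply/eqP; ring.
Qed.

Variable rho : R.
Hypothesis rho01 : 0 < rho < 1.
Hypothesis rho_pair : forall (t1 t2 : R) (a d : nat), (0 < d)%N ->
    b%:R * t1 - t2 = a%:R / d%:R -> far_from_int b d (a %% d) ->
    w t1 * w t2 <= rho.

(** The weighted places are [K - i - 1] and [K + i] for [1 <= i < K], where the factors [i] and
    [i + 1] test for a change. The gap [K - 1], [K] would belong to [i = 0]. *)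
Definition central_weight (K : nat) (la : R) (j : nat) : R :=
  if (j < K.-1)%N || (K < j < K.*2)%N then la else 1.

(** The digits are those of the fractional part of [b ^ (M - K) l / d]. A change at [K - i - 1] or
    at [K + i] makes the product of the factors [i] and [i + 1] at most [rho]; its power [p] is then
    at most [la ^ 2], which pays for a change at both places. *)
Lemma central_block_pointwise (M K m d l p : nat) (la : R) :
  (0 < K)%N -> (K <= M)%N -> (K.*2 < m)%N -> (0 < d)%N ->
  0 < la <= 1 -> rho ^+ p <= la ^+ 2 ->
  (\prod_(1 <= i < K.+1) pal_factor b M (l%:R / (d * B)%:R) i) ^+ (2 * p) <=
  change_weight b m (central_weight K la) ((b ^ m * ((b ^ (M - K) * l) %% d)) %/ d).
Proof.
move=> K0 KM Km d0 /andP [la0 la1] rp; set f := pal_factor b M _.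
have f01 i : 0 <= f i <= 1 by exact: pal_factor01.
have f0 i : 0 <= f i by case/andP: (f01 i).
set z := (_ %/ d)%N.
pose far j := far_from_int b d ((b ^ (M - K + j) * l) %% d).
pose ch j := dig b (m - j.+1) z != dig b (m - j.+2) z.
have chfar j : (j.+1 < m)%N -> ch j -> far j.
  move=> jm /(change_far b1 d0 jm).
  by rewrite modnMmr mulnA -expnD [(j + _)%N]addnC.
case/andP: rho01 => rho0 rho1.
rewrite exprM.
apply: le_trans (_ : _ <= (\prod_(1 <= i < K) (f i * f i.+1)) ^+ p) _.
  apply: lerXn2r; rewrite ?nnegrE ?exprn_ge0 ?prod_nat_ge0 //.
    by move=> i; rewrite mulr_ge0.
  exact: sqr_prod_le_pairs.
rewrite -prodrXl.
apply: le_trans (_ : _ <= \prod_(1 <= i < K)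
   ((if ch (K - i.+1)%N then la else 1) * (if ch (K + i)%N then la else 1))) _.
  rewrite !big_nat; apply: ler_prod => i /andP [i0 iK].
  rewrite exprn_ge0 /=; last exact: mulr_ge0.
  have ff1 : (f i * f i.+1) ^+ p <= 1.
    case/andP: (f01 i) (f01 i.+1) => p1 p2 /andP [p3 p4].
    by apply: exprn_ile1; [exact: mulr_ge0 | exact: mulr_ile1].
  have [none|some] := boolP (ch (K - i.+1)%N || ch (K + i)%N); last first.
    by move: some; rewrite negb_or => /andP [/negbTE -> /negbTE ->]; rewrite mulr1.
  have h : f i * f i.+1 <= rho.
    case/orP: none => /chfar far1.
      apply: (pal_factor_pair_low b1 rho01 rho_pair); rewrite ?i0 ?(leq_trans iK) //.
      have -> : (M - i.+1 = M - K + (K - i.+1))%N by clear -iK KM; lia.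
      by apply: far1; clear -iK Km; lia.
    apply: (pal_factor_pair_high b1 rho01 rho_pair); rewrite ?i0 ?(leq_trans iK) //.
    have -> : (M + i = M - K + (K + i))%N by clear -KM; lia.
    by apply: far1; clear -iK Km; lia.
  apply: le_trans (_ : _ <= la ^+ 2) _.
    by apply: le_trans rp; apply: lerXn2r; rewrite ?nnegrE; [exact: mulr_ge0 | exact: ltW | exact: h].
  rewrite expr2; apply: ler_pM; rewrite ?(ltW la0) //; by case: ifP.
rewrite big_split /= /change_weight.
set g := fun j => if ch j then central_weight K la j else 1.
have g0 j : 0 <= g j.
  by rewrite /g /central_weight; do 2 case: ifP => // _; exact: ltW.
have gE j : (j < K.-1)%N || (K < j < K.*2)%N -> (if ch j then la else 1) = g j.
  by move=> h; rewrite /g /central_weight h.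
have g1 j : (j < K.-1)%N || (K < j < K.*2)%N = false -> g j = 1.
  by move=> h; rewrite /g /central_weight h; case: ifP.
rewrite -[leRHS]/(\prod_(0 <= j < m.-1) g j).
rewrite [leRHS](big_cat_nat (n := K.-1)) //=; last by lia.
rewrite [X in _ <= _ * X](big_cat_nat (n := K.+1)) //=; last 2 first.
- by lia.
- by lia.
rewrite [X in _ <= _ * (_ * X)](big_cat_nat (n := K.*2)) //=; last 2 first.
- by lia.
- by lia.
rewrite [X in _ <= _ * (X * _)]big_nat [X in _ <= _ * (X * _)]big1 ?mul1r; last first.
  by move=> j /andP [j1 j2]; apply: g1; lia.
rewrite [X in _ <= _ * (_ * X)]big_nat [X in _ <= _ * (_ * X)]big1 ?mulr1; last first.
  by move=> j /andP [j1 j2]; apply: g1; lia.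
rewrite le_eqVlt; apply/orP; left; apply/eqP; congr (_ * _).
  rewrite -{1}[1%N]add0n big_addn subn1 [RHS]big_nat_rev /=.
  apply: eq_big_nat => i /andP [_ iK]; rewrite -gE; last by lia.
  by have -> : (K - (i + 1).+1 = 0 + K.-1 - i.+1)%N by lia.
have -> : (K.*2 = K + K)%N by lia.
rewrite -[K.+1]add1n big_addn addnK; apply: eq_big_nat => i /andP [i0 iK].
by rewrite addnC gE //; lia.
Qed.

(** Reduced fractions with denominators below [b ^ (k + 1)] are told apart by [2 (k + 1)] leading
    digits, and [l %/ d] takes at most [B] values. So the sum is at most [B] times the sum of the
    change weights over all digit strings. *)
Lemma central_block_moment (M K k p : nat) (la : R) :
  (0 < K)%N -> (K <= M)%N -> (K <= k)%N ->
  0 < la <= 1 -> rho ^+ p <= la ^+ 2 ->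
  \sum_((b ^ k)%N <= d < (b ^ k.+1)%N | coprime d b) \sum_(0 <= l < d * B | coprime l d)
    (\prod_(1 <= i < K.+1) pal_factor b M (l%:R / (d * B)%:R) i) ^+ (2 * p) <=
  B%:R * b%:R ^+ (k.*2 + 4 - K.*2) * (1 + b%:R * la) ^+ K.*2 :> R.
Proof.
move=> K0 KM Kk la01 rp; case/andP: (la01) => la0 la1.
set m := k.+1.*2.
pose cw := change_weight b m (central_weight K la).
have Km : (K.*2 < m)%N by rewrite /m; clear -Kk; lia.
have cwt0 j : 0 <= central_weight K la j by rewrite /central_weight; case: ifP => // _; exact: ltW.
pose T := [seq p <- [seq (d, l) | d <- index_iota (b ^ k) (b ^ k.+1), l <- index_iota 0 (d * B)] |
   coprime p.1 b && coprime p.2 p.1].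
pose F (q : nat * nat) := (\prod_(1 <= i < K.+1) pal_factor b M (q.2%:R / (q.1 * B)%:R) i) ^+ (2 * p) : R.
pose z (q : nat * nat) := ((b ^ m * ((b ^ (M - K) * q.2) %% q.1)) %/ q.1)%N.
pose phi (q : nat * nat) := ((q.2 %/ q.1)%N, z q).
have TP q : q \in T -> [/\ (b ^ k <= q.1 < b ^ k.+1)%N, (q.2 < q.1 * B)%N, coprime q.1 b & coprime q.2 q.1].
  rewrite mem_filter => /andP [/andP [c1 c2]] /allpairsPdep [d [l [+ + E]]].
  by rewrite E in c1 c2 *; rewrite !mem_index_iota /=.
have d0 q : q \in T -> (0 < q.1)%N.
  by move=> /TP [/andP [h _] _ _ _]; apply: leq_trans h; rewrite expn_gt0 b0.
have -> : \sum_((b ^ k)%N <= d < (b ^ k.+1)%N | coprime d b) \sum_(0 <= l < d * B | coprime l d)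
    (\prod_(1 <= i < K.+1) pal_factor b M (l%:R / (d * B)%:R) i) ^+ (2 * p) =
    \sum_(q <- T) F q.
  rewrite big_filter [RHS]big_mkcond big_allpairs_dep [LHS]big_mkcond; apply: eq_bigr => d _ /=.
  by case: (coprime d b) => /=; [rewrite big_mkcond | rewrite big1].
apply: le_trans (_ : _ <= \sum_(s <- [seq (c, z) | c <- index_iota 0 B, z <- index_iota 0 (b ^ m)]) cw s.2) _.
  apply: (ler_sum_inj (phi := phi)).
  - rewrite filter_uniq // allpairs_uniq_dep ?iota_uniq //.
      by move=> d _; exact: iota_uniq.
    by move=> [d l] [d' l'] _ _ /= [-> ->].
  - move=> [d l] [d' l'] qT q'T; rewrite /phi /z /= => -[El Ez].
    case: (TP _ qT) (TP _ q'T) => /= [/andP [h1 h2] h3 h4 h5] [/andP [h1' h2'] h3' h4' h5'].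
    have d0' := d0 _ qT; have d0'' := d0 _ q'T; rewrite /= in d0' d0''.
    have cop e f : coprime e b -> coprime f e -> coprime ((b ^ (M - K) * f) %% e) e.
      by move=> c1 c2; rewrite coprime_modl coprimeMl c2 andbT coprimeXl // coprime_sym.
    have le : (d * d' <= b ^ m)%N.
      by rewrite /m -addnn expnD leq_mul // ltnW.
    have [Eh Ed] := quotient_inj d0' d0'' le (cop _ _ h4 h5) (cop _ _ h4' h5') Ez.
    subst d'; congr (_, _).
    rewrite (divn_eq l d) (divn_eq l' d) El; congr (_ + _)%N.
    have : (b ^ (M - K) * l == b ^ (M - K) * l' %[mod d])%N by apply/eqP.
    have canc x y : (x <= y)%N -> (b ^ (M - K) * y == b ^ (M - K) * x %[mod d])%N -> (y %% d = x %% d)%N.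
      move=> xy; rewrite eqn_mod_dvd ?leq_mul2l ?xy ?orbT // -mulnBr Gauss_dvdr; last first.
        by rewrite coprimeXr.
      by rewrite -eqn_mod_dvd // => /eqP.
    have [ll|ll] := leqP l l'; last by move=> h; apply: canc => //; exact: ltnW.
    by rewrite eq_sym => h; apply/esym; exact: canc.
  - move=> q qT; have [h1 h2 _ _] := TP _ qT; have dq := d0 _ qT.
    apply/allpairsPdep; exists (q.2 %/ q.1)%N, (z q); rewrite !mem_index_iota /=; split=> //.
      by rewrite ltn_divLR // mulnC.
    by rewrite /z ltn_divLR // ltn_pmul2l ?expn_gt0 ?b0 // ltn_mod.
  - move=> [c y] _; rewrite /cw /change_weight; apply: prod_nat_ge0 => j.
    by case: ifP.
  - move=> q qT; rewrite /F /cw /phi /=; apply: central_block_pointwise => //.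
    exact: d0.
rewrite big_allpairs_dep /=.
have -> : m = k.*2.+1.+1 by [].
rewrite (eq_bigr (fun _ => b%:R * \prod_(0 <= j < k.*2.+1) (1 + (b%:R - 1) * central_weight K la j))); last first.
  by move=> c _; rewrite /cw sum_change_weight.
rewrite sumr_const_nat subn0 -[leLHS]mulr_natl -!mulrA ler_wpM2l //.
have t0 j : 0 <= 1 + (b%:R - 1) * central_weight K la j.
  by rewrite addr_ge0 // mulr_ge0 // subr_ge0 ler1n.
have la_le : 1 + (b%:R - 1) * la <= 1 + b%:R * la.
  by rewrite lerD2l ler_wpM2r ?(ltW la0) // gerBl.
have bla1 : 1 <= 1 + b%:R * la by rewrite lerDl mulr_ge0 // ltW.
(* at most [2 k + 3 - 2 K] positions carry the trivial weight *)
rewrite (big_cat_nat (n := K.-1)) //=; last by clear -Kk; lia.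
rewrite [X in _ * (_ * X)](big_cat_nat (n := K.+1)) //=; last 2 first.
- by clear -K0 Kk; lia.
- by clear -K0 Kk; lia.
rewrite [X in _ * (_ * (_ * X))](big_cat_nat (n := K.*2)) //=; last by clear -K0 Kk; lia.
have low m1 m2 : \prod_(m1 <= j < m2) (1 + (b%:R - 1) * central_weight K la j) <= b%:R ^+ (m2 - m1) :> R.
  rewrite -prodr_const_nat; apply: ler_prod => j _; rewrite t0 /= /central_weight; case: ifP => _.
    apply: le_trans (_ : _ <= 1 + (b%:R - 1) * 1) _; last by rewrite mulr1 addrC subrK.
    by rewrite lerD2l ler_wpM2l // subr_ge0 ler1n.
  by rewrite mulr1 addrC subrK.
have high m1 m2 : (forall j, (m1 <= j < m2)%N -> (j < K.-1)%N || (K < j < K.*2)%N) ->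
  \prod_(m1 <= j < m2) (1 + (b%:R - 1) * central_weight K la j) <= (1 + b%:R * la) ^+ (m2 - m1) :> R.
  move=> h; rewrite -prodr_const_nat !big_nat; apply: ler_prod => j jm.
  by rewrite t0 /= /central_weight h.
have e1 : \prod_(0 <= j < K.-1) (1 + (b%:R - 1) * central_weight K la j) <= (1 + b%:R * la) ^+ K :> R.
  apply: le_trans (high 0 K.-1 _) _; first by move=> j /andP [_ ->].
  by apply: ler_weXn2l => //; clear; lia.
have e2 := low K.-1 K.+1.
have e3 : \prod_(K.+1 <= j < K.*2) (1 + (b%:R - 1) * central_weight K la j) <= (1 + b%:R * la) ^+ K :> R.
  apply: le_trans (high K.+1 K.*2 _) _; first by move=> j h; clear -h; lia.
  by apply: ler_weXn2l => //; clear; lia.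
have e4 := low K.*2 k.*2.+1.
have h2 : (K.+1 - K.-1 = 2)%N by clear -K0; lia.
rewrite h2 in e2.
have -> : b%:R ^+ (k.*2 + 4 - K.*2) * (1 + b%:R * la) ^+ K.*2 =
   b%:R * ((1 + b%:R * la) ^+ K * (b%:R ^+ 2 * ((1 + b%:R * la) ^+ K * b%:R ^+ (k.*2.+1 - K.*2)))) :> R.
  have -> : (k.*2 + 4 - K.*2 = 3 + (k.*2.+1 - K.*2))%N by clear -Kk; lia.
  rewrite -[X in (1 + _) ^+ X]addnn !exprD; ring.
rewrite ler_wpM2l //.
by do 3 ![apply: ler_pM; rewrite ?mulr_ge0 ?prod_nat_ge0 //].
Qed.

End Moments.

(** * Averages over denominators *)

Lemma sum_shells (V : nmodType) (b n : nat) (P : pred nat) (F : nat -> V) : (0 < b)%N ->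
  \sum_(1 <= d < b ^ n | P d) F d =
  \sum_(0 <= k < n) \sum_((b ^ k)%N <= d < (b ^ k.+1)%N | P d) F d.
Proof.
move=> b0; elim: n => [|n IH]; first by rewrite expn0 !big_geq.
rewrite big_nat_recr //= -IH (big_cat_nat (n := (b ^ n)%N)) //=.
  by rewrite expn_gt0 b0.
by rewrite leq_pexp2l.
Qed.

Lemma harmonic_le (R : realFieldType) (b n : nat) : (0 < b)%N ->
  \sum_(1 <= j < b ^ n) (j%:R)^-1 <= n%:R * b%:R :> R.
Proof.
move=> b0; rewrite (sum_shells _ predT) //.
apply: le_trans (_ : _ <= \sum_(0 <= k < n) b%:R) _; last first.
  by rewrite sumr_const_nat subn0 mulr_natl.
apply: ler_sum => k _.
have bk : 0 < (b ^ k)%:R :> R by rewrite ltr0n expn_gt0 b0.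
apply: le_trans (_ : _ <= \sum_((b ^ k)%N <= d < (b ^ k.+1)%N) ((b ^ k)%:R)^-1) _.
  rewrite big_nat [leRHS]big_nat; apply: ler_sum => d /andP [dk _].
  by rewrite lef_pV2 ?posrE ?ler_nat // ltr0n; apply: leq_trans dk; rewrite expn_gt0 b0.
rewrite sumr_const_nat -[leLHS]mulr_natl ler_pdivrMr // -natrM -expnS ler_nat.
exact: leq_subr.
Qed.

Section Shells.
Variables (R : realType) (b : nat).
Hypothesis b1 : (1 < b)%N.
Local Notation w := (@digit_factor R b).
Local Notation B := (b ^ 2 - 1)%N.

Let b0 : (0 < b)%N. Proof. exact: ltnW. Qed.
Let B0 : (0 < B)%N. Proof. by rewrite subn_gt0 -{1}(exp1n 2) ltn_exp2r. Qed.

Let pf01 M (t : R) i : 0 <= pal_factor b M t i <= 1.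
Proof. exact: pal_factor01. Qed.
Let pf0 M (t : R) i : 0 <= pal_factor b M t i.
Proof. by case/andP: (pf01 M t i). Qed.

Definition inner_product (M N : nat) (t : R) : R :=
  \prod_(1 <= i < N.+1) pal_factor b M t i.

Definition primitive_sum (M N d : nat) : R :=
  \sum_(0 <= l < d * B | coprime l d) inner_product M N (l%:R / (d * B)%:R).

Definition shell_sum (M N k : nat) : R :=
  \sum_((b ^ k)%N <= d < (b ^ k.+1)%N | coprime d b && (1 < d)%N)
     primitive_sum M N d / d%:R.

(** The average that bounds the discrepancy; the denominator is [q] and not [q B] because the
    classes modulo [B] have already been summed. *)
Definition fourier_error (M N q : nat) : R :=
  (\sum_(0 <= l < q * B | ~~ (q %| l)%N) inner_product M N (l%:R / (q * B)%:R)) / q%:R.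

Lemma inner_product01 M N t : 0 <= inner_product M N t <= 1.
Proof. by rewrite prod_nat_ge0 ?prod_nat_le1. Qed.

Lemma primitive_sum_ge0 M N d : 0 <= primitive_sum M N d.
Proof. by apply: sumr_ge0 => l _; case/andP: (inner_product01 M N (l%:R / (d * B)%:R)). Qed.

Lemma fourier_error_ge0 M N q : 0 <= fourier_error M N q.
Proof.
apply: divr_ge0 => //; apply: sumr_ge0 => l _.
by case/andP: (inner_product01 M N (l%:R / (q * B)%:R)).
Qed.

(** With [g = gcd(l, q)] write [q = g d] and [l = g l']. The fraction is unchanged,
    [1 / q = (1 / g) (1 / d)], and [d > 1] since [q] does not divide [l]. Letting [g] and [d] range
    independently gives the product. *)
Lemma sum_fourier_error_le (M N X : nat) :
  \sum_(1 <= q < X | coprime q b) fourier_error M N q <=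
  (\sum_(1 <= j < X) (j%:R)^-1) *
    \sum_(1 <= d < X | coprime d b && (1 < d)%N) primitive_sum M N d / d%:R.
Proof.
pose F (p : nat * nat) : R := inner_product M N (p.2%:R / (p.1 * B)%:R) / p.1%:R.
pose rT := [seq p <- [seq (q, l) | q <- index_iota 1 X, l <- index_iota 0 (q * B)] |
   coprime p.1 b && ~~ (p.1 %| p.2)%N].
pose sT1 := [seq p <- [seq (d, l) | d <- index_iota 1 X, l <- index_iota 0 (d * B)] |
   (coprime p.1 b && (1 < p.1)%N) && coprime p.2 p.1].
pose sT := [seq (g, p) | g <- index_iota 1 X, p <- sT1].
have -> : \sum_(1 <= q < X | coprime q b) fourier_error M N q = \sum_(p <- rT) F p.
  rewrite big_filter [RHS]big_mkcond big_allpairs_dep [LHS]big_mkcond; apply: eq_bigr => q _ /=.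
  case: (coprime q b) => /=; last by rewrite big1.
  rewrite /fourier_error mulr_suml [LHS]big_mkcond.
  by apply: eq_bigr => l _; case: ifP.
have -> : (\sum_(1 <= j < X) (j%:R)^-1) *
    \sum_(1 <= d < X | coprime d b && (1 < d)%N) primitive_sum M N d / d%:R =
    \sum_(s <- sT) s.1%:R^-1 * F s.2.
  rewrite big_allpairs_dep mulr_suml; apply: eq_bigr => g _ /=.
  rewrite -mulr_sumr; congr (_ * _).
  rewrite big_filter [RHS]big_mkcond big_allpairs_dep [LHS]big_mkcond; apply: eq_bigr => q _ /=.
  case: (coprime q b && _) => /=; last by rewrite big1.
  by rewrite /primitive_sum mulr_suml [LHS]big_mkcond.
pose phi (p : nat * nat) := let g := gcdn p.2 p.1 in (g, ((p.1 %/ g)%N, (p.2 %/ g)%N)).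
have rP p : p \in rT -> [/\ (0 < p.1 < X)%N, (p.2 < p.1 * B)%N, coprime p.1 b & ~~ (p.1 %| p.2)%N].
  rewrite mem_filter => /andP [/andP [c1 c2]] /allpairsPdep [q [l [+ + E]]].
  by rewrite E in c1 c2 *; rewrite !mem_index_iota /=.
apply: (ler_sum_inj (phi := phi)).
- rewrite filter_uniq // allpairs_uniq_dep ?iota_uniq //.
    by move=> q _; exact: iota_uniq.
  by move=> [q l] [q' l'] _ _ /= [-> ->].
- move=> [q l] [q' l'] _ _; rewrite /phi /= => -[Eg E1 E2].
  by congr (_, _); [rewrite -(divnK (dvdn_gcdr l q)) E1 Eg divnK ?dvdn_gcdr
     | rewrite -(divnK (dvdn_gcdl l q)) E2 Eg divnK ?dvdn_gcdl].
- move=> [q l] /rP /= [/andP [q0 qX] lB cq ndv].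
  have g0 : (0 < gcdn l q)%N by rewrite gcdn_gt0 q0 orbT.
  have gq : (gcdn l q <= q)%N by rewrite dvdn_leq ?dvdn_gcdr.
  apply/allpairsPdep; exists (gcdn l q), ((q %/ gcdn l q)%N, (l %/ gcdn l q)%N); split=> //.
    by rewrite mem_index_iota; lia.
  have qg0 : (0 < q %/ gcdn l q)%N by rewrite divn_gt0.
  have qg1 : (1 < q %/ gcdn l q)%N.
    rewrite ltn_neqAle qg0 andbT; apply: contra ndv => /eqP E.
    by rewrite -[q](divnK (dvdn_gcdr l q)) -E mul1n dvdn_gcdl.
  rewrite mem_filter /= qg1 andbT; apply/andP; split.
    apply/andP; split; first by apply: coprime_dvdl cq; apply/dvdnP; exists (gcdn l q); rewrite mulnC divnK ?dvdn_gcdr.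
    rewrite /coprime -(@eqn_pmul2r (gcdn l q)) // mul1n muln_gcdl.
    by rewrite !divnK ?dvdn_gcdl ?dvdn_gcdr.
  apply/allpairsPdep; exists (q %/ gcdn l q)%N, (l %/ gcdn l q)%N.
  rewrite !mem_index_iota qg0 /=; split=> //.
    by apply: leq_ltn_trans (leq_div _ _) qX.
  rewrite ltn_divLR // mulnAC divnK ?dvdn_gcdr //.
- move=> [g p] _ /=; rewrite mulr_ge0 ?invr_ge0 // /F divr_ge0 //.
  by case/andP: (inner_product01 M N (p.2%:R / (p.1 * B)%:R)).
- move=> [q l] /rP /= [/andP [q0 qX] lB cq ndv]; rewrite /F /=.
  have g0 : (0 < gcdn l q)%N by rewrite gcdn_gt0 q0 orbT.
  have qg0 : (0 < q %/ gcdn l q)%N by rewrite divn_gt0 // dvdn_leq ?dvdn_gcdr.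
  have g0R : (gcdn l q)%:R != 0 :> R by rewrite pnatr_eq0 -lt0n.
  have qg0R : (q %/ gcdn l q)%:R != 0 :> R by rewrite pnatr_eq0 -lt0n.
  have B0R : B%:R != 0 :> R by rewrite pnatr_eq0 -lt0n.
  have Eq : q%:R = (q %/ gcdn l q)%:R * (gcdn l q)%:R :> R by rewrite -natrM divnK ?dvdn_gcdr.
  have -> : l%:R / (q * B)%:R = (l %/ gcdn l q)%:R / (q %/ gcdn l q * B)%:R :> R.
    have El : l%:R = (l %/ gcdn l q)%:R * (gcdn l q)%:R :> R by rewrite -natrM divnK ?dvdn_gcdl.
    rewrite !natrM Eq [X in X / _ = _]El; move: (l %/ _)%:R g0R qg0R B0R => x.
    by move: (gcdn l q)%:R (q %/ _)%:R B%:R => g c B' *; field; apply/and3P.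
  rewrite mulrCA Eq le_eqVlt; apply/orP; left; apply/eqP; congr (_ * _).
  by rewrite invfM mulrC.
Qed.

Variable rho : R.
Hypothesis rho01 : 0 < rho < 1.
Hypothesis rho_pair : forall (t1 t2 : R) (a d : nat), (0 < d)%N ->
    b%:R * t1 - t2 = a%:R / d%:R -> far_from_int b d (a %% d) ->
    w t1 * w t2 <= rho.

Lemma shell_sum_le_pointwise (M N k : nat) : (N <= M)%N -> (0 < N)%N ->
  shell_sum M N k <= B%:R * (b ^ k.+1)%:R * Num.sqrt (rho ^+ (N.-1 %/ k.+1)).
Proof.
move=> NM N0; set s := Num.sqrt _.
have s0 : 0 <= s by exact: sqrtr_ge0.
apply: le_trans (_ : _ <= \sum_((b ^ k)%N <= d < (b ^ k.+1)%N) B%:R * s) _; last first.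
  rewrite sumr_const_nat -[leLHS]mulr_natl mulrCA -!mulrA ler_wpM2l // ler_wpM2r //.
  by rewrite ler_nat leq_subr.
rewrite /shell_sum big_mkcond big_nat [leRHS]big_nat; apply: ler_sum => d /andP [_ dk].
case: ifPn => [/andP [db d1]|_]; last by rewrite mulr_ge0.
have d0 : 0 < d%:R :> R by rewrite ltr0n ltnW.
rewrite ler_pdivrMr // /primitive_sum.
apply: le_trans (_ : _ <= \sum_(0 <= l < d * B) s) _; last first.
  rewrite sumr_const_nat subn0 -[leLHS]mulr_natl natrM le_eqVlt; apply/orP; left; apply/eqP; ring.
rewrite big_mkcond; apply: ler_sum => l _; case: ifPn => // ld.
rewrite -(ler_pXn2r (n := 2)) ?nnegrE //; last by case/andP: (inner_product01 M N (l%:R / (d * B)%:R)).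
rewrite sqr_sqrtr; last by rewrite exprn_ge0 //; case/andP: rho01 => /ltW.
exact: pal_factor_pointwise.
Qed.

(** If the central product is at most [t0], the other two are separated by the inequality between a
    product and the mean of squares. Otherwise its quotient by [t0] exceeds [1], and so does the
    power [p], while the whole product is at most [1]. *)
Lemma inner_product_le_blocks (M N K k p : nat) (t0 t : R) :
  (K + k + k <= N)%N -> 0 < t0 ->
  inner_product M N t <=
   t0 / 2 * (\prod_((K + 1)%N <= i < K + 1 + k) pal_factor b M t i) ^+ 2 +
   t0 / 2 * (\prod_((K + k + 1)%N <= i < K + k + 1 + k) pal_factor b M t i) ^+ 2 +
   (t0 ^+ p)^-1 * (\prod_(1 <= i < K.+1) pal_factor b M t i) ^+ p.
Proof.
move=> KN t00; set fA := \prod_((K + 1)%N <= i < _) _; set fB := \prod_((K + k + 1)%N <= i < _) _.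
set fC := \prod_(_ <= i < K.+1) _.
have fA0 : 0 <= fA by exact: prod_nat_ge0.
have fB0 : 0 <= fB by exact: prod_nat_ge0.
have fC0 : 0 <= fC by exact: prod_nat_ge0.
have fA1 : fA <= 1 by exact: prod_nat_le1.
have fB1 : fB <= 1 by exact: prod_nat_le1.
have le : inner_product M N t <= fC * fA * fB.
  rewrite /inner_product (big_cat_nat (n := K.+1)) //=; last by clear -KN; lia.
  rewrite -mulrA ler_wpM2l // (big_cat_nat (n := (K + 1 + k)%N)) /=; last 2 first.
  - by clear -KN; lia.
  - by clear -KN; lia.
  rewrite -[K.+1]addn1 ler_wpM2l //.
  have -> : (K + 1 + k = K + k + 1)%N by clear; lia.
  rewrite (big_cat_nat (n := (K + k + 1 + k)%N)) /=; last 2 first.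
  - by clear -KN; lia.
  - by clear -KN; lia.
  by rewrite ler_piMr // prod_nat_le1.
apply: le_trans le _.
have [small|large] := leP fC t0.
  apply: le_trans (_ : _ <= t0 / 2 * fA ^+ 2 + t0 / 2 * fB ^+ 2) _; last first.
    by rewrite lerDl mulr_ge0 ?exprn_ge0 // invr_ge0 exprn_ge0 // ltW.
  apply: le_trans (_ : _ <= t0 * (fA * fB)) _.
    by rewrite -mulrA ler_wpM2r // mulr_ge0.
  have := sqr_ge0 (fA - fB); nra.
apply: le_trans (_ : _ <= (t0 ^+ p)^-1 * fC ^+ p) _; last first.
  by rewrite lerDr addr_ge0 // mulr_ge0 ?exprn_ge0 // divr_ge0 // ltW.
apply: le_trans (_ : _ <= 1) _.
  have fC1 : fC <= 1 by exact: prod_nat_le1.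
  by rewrite mulr_ile1 ?mulr_ge0 // mulr_ile1.
rewrite mulrC ler_pdivlMr ?exprn_gt0 // mul1r.
by apply: lerXn2r; rewrite ?nnegrE // ltW.
Qed.

(** The preceding inequality is summed over the shell: the two outer blocks go to
    [block_second_moment], the central one to [central_block_moment]. *)
Lemma shell_sum_le_blocks (M N K k p tau : nat) (la t0 : R) :
  (0 < K)%N -> (K <= k)%N -> (K + k + k <= N)%N -> (N <= M)%N ->
  0 < t0 -> 0 < la <= 1 -> rho ^+ p <= la ^+ 2 ->
  (forall n, (0 < n)%N -> (n < b ^ (K + k + k).*2.+1)%N -> (size (divisors n) <= tau)%N) ->
  shell_sum M N k <= ((b ^ k)%:R)^-1 *
   (t0 * (B%:R * b%:R ^+ k.+1 * (b + tau)%:R) +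
    (t0 ^+ (2 * p))^-1 * (B%:R * b%:R ^+ (k.*2 + 4 - K.*2) * (1 + b%:R * la) ^+ K.*2)).
Proof.
move=> K0 Kk KN NM t00 la01 rp htau.
pose fA d l := (\prod_((K + 1)%N <= i < K + 1 + k) pal_factor b M (l%:R / (d * B)%:R) i) ^+ 2 : R.
pose fB d l := (\prod_((K + k + 1)%N <= i < K + k + 1 + k) pal_factor b M (l%:R / (d * B)%:R) i) ^+ 2 : R.
pose fC d l := (\prod_(1 <= i < K.+1) pal_factor b M (l%:R / (d * B)%:R) i) ^+ (2 * p) : R.
have fA0 d l : 0 <= fA d l by rewrite exprn_ge0 // prod_nat_ge0.
have fB0 d l : 0 <= fB d l by rewrite exprn_ge0 // prod_nat_ge0.
have bk : 0 < (b ^ k)%:R :> R by rewrite ltr0n expn_gt0 b0.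
have tp : 0 < (t0 ^+ (2 * p))^-1 by rewrite invr_gt0 exprn_gt0.
pose D := index_iota (b ^ k) (b ^ k.+1).
apply: le_trans (_ : _ <= ((b ^ k)%:R)^-1 * \sum_(d <- D | coprime d b)
  (t0 / 2 * \sum_(0 <= l < d * B) fA d l + t0 / 2 * \sum_(0 <= l < d * B) fB d l +
   (t0 ^+ (2 * p))^-1 * \sum_(0 <= l < d * B | coprime l d) fC d l)) _.
  rewrite mulr_sumr /shell_sum big_mkcond [leRHS]big_mkcond big_nat [leRHS]big_nat.
  apply: ler_sum => d /andP [dk _].
  have rhs0 : 0 <= \sum_(0 <= l < d * B | coprime l d) fC d l.
    by apply: sumr_ge0 => l _; rewrite exprn_ge0 // prod_nat_ge0.
  have rhsA : 0 <= \sum_(0 <= l < d * B) fA d l by apply: sumr_ge0.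
  have rhsB : 0 <= \sum_(0 <= l < d * B) fB d l by apply: sumr_ge0.
  have t2 : 0 <= t0 / 2 by rewrite divr_ge0 // ltW.
  have tot : 0 <= t0 / 2 * \sum_(0 <= l < d * B) fA d l + t0 / 2 * \sum_(0 <= l < d * B) fB d l +
     (t0 ^+ (2 * p))^-1 * \sum_(0 <= l < d * B | coprime l d) fC d l.
    by rewrite !addr_ge0 ?mulr_ge0 // ltW.
  case: (coprime d b) => //=; case: ifPn => d1; last by rewrite mulr_ge0 // invr_ge0 ltW.
  rewrite mulrC; apply: ler_pM; rewrite ?invr_ge0 ?primitive_sum_ge0 //.
    by rewrite lef_pV2 ?posrE ?ler_nat // ltr0n ltnW.
  rewrite /primitive_sum.
  apply: le_trans (_ : _ <= \sum_(0 <= l < d * B | coprime l d)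
     (t0 / 2 * fA d l + t0 / 2 * fB d l + (t0 ^+ (2 * p))^-1 * fC d l)) _.
    by apply: ler_sum => l _; exact: inner_product_le_blocks.
  rewrite !big_split /= -!mulr_sumr lerD2r; apply: lerD; rewrite ler_wpM2l //.
    by rewrite big_mkcond; apply: ler_sum => l _; case: ifP.
  by rewrite big_mkcond; apply: ler_sum => l _; case: ifP.
rewrite ler_wpM2l ?invr_ge0 ?(ltW bk) // !big_split /= -!mulr_sumr.
have hA : \sum_(d <- D | coprime d b) \sum_(0 <= l < d * B) fA d l <= B%:R * b%:R ^+ k.+1 * (b + tau)%:R.
  apply: block_second_moment => //; first by clear -KN NM; lia.
  move=> n n0 nlt; apply: htau => //; apply: leq_trans nlt _.
  by rewrite leq_pexp2l //; clear; lia.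
have hB : \sum_(d <- D | coprime d b) \sum_(0 <= l < d * B) fB d l <= B%:R * b%:R ^+ k.+1 * (b + tau)%:R.
  by apply: block_second_moment => //; clear -KN NM; lia.
have hC : \sum_(d <- D | coprime d b) \sum_(0 <= l < d * B | coprime l d) fC d l <=
   B%:R * b%:R ^+ (k.*2 + 4 - K.*2) * (1 + b%:R * la) ^+ K.*2.
  by apply: (central_block_moment b1 rho01 rho_pair) => //; clear -K0 Kk KN NM; lia.
apply: lerD; last by rewrite ler_wpM2l // ltW.
move: hA hB; move: (\sum_(d <- D | _) _) (\sum_(d <- D | _) _) (B%:R * _ * _) => x y z hA hB; nra.
Qed.

End Shells.

(** * Choice of the parameters on a shell *)

Lemma central_size_bounds (e k : nat) (K := (k %/ 2 + k %/ e + 1)%N) :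
  (6 <= e)%N -> (6 <= k)%N ->
  [/\ (0 < K)%N, (K <= k)%N, (k <= 2 * (k %/ 2) + 1)%N & (k <= (k %/ e + 1) * e)%N].
Proof.
move=> e6 k6; rewrite /K.
have ke : (k %/ e * 6 <= k)%N.
  by apply: leq_trans (leq_divM k e); rewrite leq_mul2l e6 orbT.
have k2 := divn_eq k 2; have k3 : (k %% 2 < 2)%N by rewrite ltn_mod.
split; [by rewrite addn1 | | |].
- by move: (k %/ e)%N ke => j ke; lia.
- by move: (k %/ 2)%N (k %% 2)%N k2 k3 => j r; lia.
by rewrite addn1 ltnW // ltn_ceil //; apply: leq_trans e6.
Qed.

Section Asymptotics.
Variables (R : realType) (b : nat).
Hypothesis b1 : (1 < b)%N.
Local Notation w := (@digit_factor R b).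
Local Notation B := (b ^ 2 - 1)%N.
Local Notation Lb := (ln (b%:R : R)).

Let b0 : (0 < b)%N. Proof. exact: ltnW. Qed.
Let bR : 0 < b%:R :> R. Proof. by rewrite ltr0n. Qed.
Let Lb0 : 0 < Lb. Proof. by rewrite ln_gt0 // ltr1n. Qed.

Lemma natr_expn_expR (j : nat) : (b ^ j)%:R = expR (j%:R * Lb) :> R.
Proof. by rewrite natrX expRM_natl lnK ?posrE. Qed.

Lemma exists_expr_le (rho la : R) : 0 < rho < 1 -> 0 < la -> exists2 p, (0 < p)%N & rho ^+ p <= la.
Proof.
move=> /andP [r0 r1] la0.
have lr : ln rho < 0 by rewrite ln_lt0 // r0.
pose p := (Num.truncn (ln la / ln rho)).+1.
exists p => //.
have h : ln la / ln rho <= p%:R.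
  have [x0|x0] := leP 0 (ln la / ln rho); last by apply: le_trans (ltW x0) _.
  by rewrite ltW // truncnS_gt.
rewrite -[leRHS]lnK ?posrE // -[rho]lnK ?posrE // -expRM_natl ler_expR.
by rewrite -ler_ndivrMr // mulrC.
Qed.

(** The excess [k / e] of [K] over [k / 2] gains [b ^ (2 k / e)] in the central block, and [la] and
    [t0] give back only half of the exponent. The outer blocks gain [t0] against the divisor
    bound. *)
Lemma shell_power_saving (rho : R) (e : nat) : 0 < rho < 1 ->
  (forall (t1 t2 : R) (a d : nat), (0 < d)%N ->
    b%:R * t1 - t2 = a%:R / d%:R -> far_from_int b d (a %% d) ->
    w t1 * w t2 <= rho) ->
  (6 <= e)%N ->
  exists eta C : R, [/\ 0 < eta, 0 < C &
   forall M N k, (6 <= k)%N -> (k %/ 2 + k %/ e + 1 + k + k <= N)%N -> (N <= M)%N ->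
     shell_sum R b M N k <= C * expR (- (eta * k%:R))].
Proof.
move=> rho01 rho_pair e6.
have eR : 0 < e%:R :> R by rewrite ltr0n (leq_trans _ e6).
have e6R : 6 <= e%:R :> R by rewrite ler_nat.
have Lb_lt : Lb <= b%:R by exact: ltW (ln_sublinear bR).
(* Small enough for [(1 + b la) ^ (2 K) <= b ^ (k / (2 e))]. *)
pose la : R := Lb / (4 * b%:R * e%:R).
have den0 : 0 < 4 * b%:R * e%:R :> R by rewrite !mulr_gt0.
have la01 : 0 < la <= 1.
  rewrite /la divr_gt0 //= ler_pdivrMr // mul1r; nra.
case/andP: (la01) => la0 la1.
have [p p0 rp] := exists_expr_le rho01 (exprn_gt0 2 la0).
have pR : 0 < p%:R :> R by rewrite ltr0n.
(* The threshold [t0] will be [b ^ (- th k)], so that [t0 ^ (- 2 p)] equals [b ^ (k / (2 e))]. *)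
pose th : R := 1 / (4 * e%:R * p%:R).
have th0 : 0 < th by rewrite divr_gt0 // !mulr_gt0.
have thE : 2 * p%:R * th = 1 / (2 * e%:R) by rewrite /th; field; rewrite !gt_eqF.
(* The block frequencies are below [b ^ (6 k + 1)]; with [12 <= m th] their differences have
   [O(b ^ (th k / 2))] divisors, which uses up half of the gain from [t0]. *)
pose m := (Num.truncn (12 / th)).+1.
have mth : 12 <= m%:R * th.
  by rewrite -ler_pdivrMr // ltW // truncnS_gt.
have mR : 0 < m%:R :> R by rewrite ltr0n.
have [Ct [Ct0 HCt]] := size_divisors_exp_le m.
have CtR : 0 < Ct%:R :> R by rewrite ltr0n.
pose C' : R := expR ((ln Ct%:R + Lb) / m%:R).
have C'0 : 0 < C' by exact: expR_gt0.
exists (th / 2 * Lb), (B%:R * b%:R * (b%:R + C') + B%:R * b%:R ^+ 5); split.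
- by rewrite mulr_gt0 // divr_gt0.
- rewrite ltr_wpDl ?mulr_ge0 ?addr_ge0 ?(ltW C'0) //.
  by rewrite mulr_gt0 ?exprn_gt0 // ltr0n subn_gt0 -{1}(exp1n 2) ltn_exp2r.
move=> M N k k6 KN NM.
set K := (k %/ 2 + k %/ e + 1)%N in KN.
have [K0 Kk ku2 kue] := central_size_bounds e6 k6.
rewrite -/K in K0 Kk.
have exp1 : ((K + k + k).*2.+1 <= 6 * k + 1)%N by clear -Kk; lia.
have exp2 : (K.*2 <= 2 * k)%N by clear -Kk; lia.
have exp3 : (K.*2 <= k.*2 + 4)%N by clear -Kk; lia.
have kR : 6 <= k%:R :> R by rewrite ler_nat.
have K2 : k%:R + 2 * (k%:R / e%:R) - 1 <= 2 * K%:R :> R.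
  have h1 : k%:R <= 2 * (k %/ 2)%:R + 1 :> R.
    by rewrite -natrM -[X in _ + X]/(1%:R) -natrD ler_nat.
  have h2 : k%:R / e%:R <= (k %/ e)%:R + 1 :> R.
    by rewrite ler_pdivrMr // -[X in _ + X]/(1%:R) -natrD -natrM ler_nat.
  rewrite /K !natrD; lra.
pose t0 := expR (- (th * k%:R * Lb)).
have t00 : 0 < t0 by exact: expR_gt0.
pose X := expR ((ln Ct%:R + (6 * k + 1)%:R * Lb) / m%:R).
pose tau := Num.truncn X.
have tauX : tau%:R <= X by rewrite truncn_le // expR_ge0.
have htau n : (0 < n)%N -> (n < b ^ (K + k + k).*2.+1)%N -> (size (divisors n) <= tau)%N.
  move=> n0 nlt; rewrite /tau truncn_ge_nat ?expR_ge0 //.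
  rewrite -(ler_pXn2r (n := m)) ?nnegrE ?expR_ge0 // /X -expRM_natl mulrC mulfVK ?gt_eqF //.
  rewrite expRD lnK ?posrE // -natr_expn_expR -natrX -natrM ler_nat.
  apply: leq_trans (HCt n n0) _; rewrite leq_mul2l; apply/orP; right.
  apply: leq_trans (ltnW nlt) _; exact: leq_pexp2l.
apply: le_trans (shell_sum_le_blocks b1 rho01 rho_pair K0 Kk KN NM t00 la01 rp htau) _.
pose E := expR (- (th / 2 * Lb * k%:R)).
rewrite -[X in _ <= _ * X]/E.
have part1 : ((b ^ k)%:R)^-1 * (t0 * (B%:R * b%:R ^+ k.+1 * (b + tau)%:R)) <=
    B%:R * b%:R * (b%:R + C') * E.
  have -> : ((b ^ k)%:R)^-1 * (t0 * (B%:R * b%:R ^+ k.+1 * (b + tau)%:R)) =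
     B%:R * b%:R * ((b%:R + tau%:R) * t0) :> R.
    rewrite exprS natrX natrD; field; by rewrite expf_neq0 // gt_eqF.
  rewrite -[leRHS]mulrA ler_wpM2l ?mulr_ge0 // !mulrDl; apply: lerD.
    rewrite ler_wpM2l // ler_expR lerN2.
    have : 0 <= th * Lb * k%:R by rewrite !mulr_ge0 // ltW.
    have -> : th / 2 * Lb * k%:R = th * Lb * k%:R / 2 by ring.
    have -> : th * k%:R * Lb = th * Lb * k%:R by ring.
    by move: (th * Lb * _) => y; lra.
  apply: le_trans (_ : _ <= X * t0) _; first by rewrite ler_wpM2r // ltW.
  rewrite /X /t0 /C' /E -!expRD ler_expR.
  rewrite natrD natrM.
  have h : 6 * k%:R / m%:R * Lb <= th / 2 * k%:R * Lb.
    rewrite ler_wpM2r ?(ltW Lb0) // ler_pdivrMr //.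
    have : 12 * k%:R <= m%:R * th * k%:R by rewrite ler_wpM2r.
    lra.
  have -> : (ln Ct%:R + (6 * k%:R + 1) * Lb) / m%:R =
     (ln Ct%:R + Lb) / m%:R + 6 * k%:R / m%:R * Lb by field; rewrite gt_eqF.
  lra.
have part2 : ((b ^ k)%:R)^-1 * ((t0 ^+ (2 * p))^-1 *
    (B%:R * b%:R ^+ (k.*2 + 4 - K.*2) * (1 + b%:R * la) ^+ K.*2)) <= B%:R * b%:R ^+ 5 * E.
  have q1 : (1 + b%:R * la) ^+ K.*2 <= expR (k%:R * Lb / (2 * e%:R)).
    apply: le_trans (_ : _ <= expR (b%:R * la) ^+ K.*2) _.
      apply: lerXn2r; rewrite ?nnegrE ?expR_ge0 ?expR_ge1Dx //.
      by rewrite addr_ge0 // mulr_ge0 // ltW.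
    rewrite -expRM_natl ler_expR.
    have -> : b%:R * la = Lb / (4 * e%:R) by rewrite /la; field; rewrite !gt_eqF.
    have -> : k%:R * Lb / (2 * e%:R) = (2 * k%:R) * (Lb / (4 * e%:R)).
      by field; rewrite gt_eqF.
    by rewrite ler_wpM2r ?divr_ge0 ?(ltW Lb0) // ?mulr_ge0 // -natrM ler_nat.
  have q2 : (t0 ^+ (2 * p))^-1 = expR (k%:R * Lb / (2 * e%:R)).
    rewrite /t0 -expRM_natl -expRN; congr expR; rewrite natrM.
    transitivity (2 * p%:R * th * (k%:R * Lb)); first by ring.
    by rewrite thE; field; rewrite gt_eqF.
  have q3 : ((b ^ k)%:R)^-1 * b%:R ^+ (k.*2 + 4 - K.*2) <= b%:R ^+ 5 * expR (- (2 * (k%:R * Lb / e%:R))).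
    rewrite -!natrX !natr_expn_expR -expRN -!expRD ler_expR.
    rewrite natrB //.
    rewrite natrD -!muln2 !natrM.
    have : (k%:R + 2 * (k%:R / e%:R) - 1) * Lb <= 2 * K%:R * Lb by rewrite ler_wpM2r // ltW.
    have -> : k%:R * Lb / e%:R = k%:R / e%:R * Lb by field; rewrite gt_eqF.
    move: (k%:R / e%:R) => y.
    move: Lb k%:R K%:R => L x z h; nra.
  apply: le_trans (_ : _ <= B%:R * ((b%:R ^+ 5 * expR (- (2 * (k%:R * Lb / e%:R)))) *
     (expR (k%:R * Lb / (2 * e%:R)) * expR (k%:R * Lb / (2 * e%:R))))) _.
    have -> : ((b ^ k)%:R)^-1 * ((t0 ^+ (2 * p))^-1 *
      (B%:R * b%:R ^+ (k.*2 + 4 - K.*2) * (1 + b%:R * la) ^+ K.*2)) =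
      B%:R * ((((b ^ k)%:R)^-1 * b%:R ^+ (k.*2 + 4 - K.*2)) * ((t0 ^+ (2 * p))^-1 *
        (1 + b%:R * la) ^+ K.*2)) by ring.
    rewrite ler_wpM2l // ler_pM //.
      have bla0 : 0 <= 1 + b%:R * la by rewrite addr_ge0 // mulr_ge0 // ltW.
      by rewrite mulr_ge0 ?invr_ge0 ?exprn_ge0 // ltW.
    by rewrite q2 ler_wpM2l ?expR_ge0.
  rewrite -[leRHS]mulrA ler_wpM2l // -[leLHS]mulrA ler_wpM2l ?exprn_ge0 //.
  rewrite /E -!expRD ler_expR.
  have -> : - (2 * (k%:R * Lb / e%:R)) + (k%:R * Lb / (2 * e%:R) + k%:R * Lb / (2 * e%:R)) =
     - (k%:R * Lb * (1 / e%:R)) by field; rewrite gt_eqF.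
  rewrite lerN2.
  have -> : th / 2 * Lb * k%:R = k%:R * Lb * (th / 2) by ring.
  rewrite ler_wpM2l ?mulr_ge0 ?(ltW Lb0) //.
  rewrite /th ler_pdivrMr // ler_pdivrMr ?mulr_gt0 //.
  have p1 : 1 <= p%:R :> R by rewrite ler1n.
  have -> : 1 / e%:R * 2 * (4 * e%:R * p%:R) = 8 * p%:R :> R by field; rewrite gt_eqF.
  lra.
rewrite mulrDr mulrDl; exact: lerD.
Qed.

End Asymptotics.

(** The hypothesis reads [k <= (2 / 5) (N + 1) (1 - 5 / e)]. Thus three blocks of total length about
    [5 k / 2 + k / e] fit into the inner [N - N %/ e] places. *)
Lemma shell_index_bounds (e k N : nat) : (6 <= e)%N -> (e < k)%N ->
  (5 * e * k <= (2 * N + 2) * (e - 5))%N ->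
  (k %/ 2 + k %/ e + 1 + k + k <= N - N %/ e)%N.
Proof.
move=> e6 ek h.
have k2 : (2 * (k %/ 2) <= k)%N by rewrite mulnC leq_divM.
have ke : (k %/ e * e <= k)%N by exact: leq_divM.
have Ne : (N %/ e * e <= N)%N by exact: leq_divM.
have kN : (5 * k <= 2 * N + 2)%N.
  rewrite -(leq_pmul2r (m := e)); last by lia.
  by apply: leq_trans (_ : _ <= (2 * N + 2) * (e - 5))%N _; [lia | rewrite leq_mul2l leq_subr orbT].
rewrite leq_subRL; last by apply: leq_trans Ne; rewrite leq_pmulr //; lia.
rewrite -(leq_pmul2r (m := 2 * e)); last by lia.
move: h; rewrite mulnBr; move: (k %/ 2)%N (k %/ e)%N (N %/ e)%N k2 ke Ne => x y z k2 ke Ne h.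
have h1 : (2 * x * e <= k * e)%N by rewrite leq_mul2r k2 orbT.
have h2 : ((2 * N + 2) * 5 <= (2 * N + 2) * e)%N by rewrite leq_mul2l; lia.
nia.
Qed.

Lemma shell_count_bound (e N : nat) : (6 <= e)%N ->
  (((2 * N + 2) * (e - 5)) %/ (5 * e) <= N.+1)%N.
Proof.
move=> e6; have -> : (N.+1 = (N.+1 * (5 * e)) %/ (5 * e))%N by rewrite mulnK //; lia.
apply: leq_div2r; rewrite [(N.+1 * _)%N]mulnA.
apply: (@leq_trans ((2 * N + 2) * e)%N); first by rewrite leq_mul2l leq_subr orbT.
by rewrite leq_mul2r; apply/orP; right; lia.
Qed.

(** * Decay of the sum over all shells *)

Section Decay.
Variables (R : realType) (b : nat).
Hypothesis b1 : (1 < b)%N.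
Local Notation B := (b ^ 2 - 1)%N.
Local Notation Lb := (ln (b%:R : R)).

Let b0 : (0 < b)%N. Proof. exact: ltnW. Qed.
Let bR : 0 < b%:R :> R. Proof. by rewrite ltr0n. Qed.
Let Lb0 : 0 < Lb. Proof. by rewrite ln_gt0 // ltr1n. Qed.

(** For [j > 0] raise [1 + v <= exp v], with [v = a u / j], to the power [j]. *)
Lemma pow_le_expR (a : R) (j : nat) : 0 < a -> exists2 C : R, 0 < C &
  forall u : R, 0 <= u -> u ^+ j <= C * expR (a * u).
Proof.
move=> a0; case: j => [|j].
  by exists 1 => // u u0; rewrite expr0 mul1r -expR0 ler_expR mulr_ge0 // ltW.
have ja : 0 < a / j.+1%:R by rewrite divr_gt0.
exists ((a / j.+1%:R) ^- j.+1); first by rewrite invr_gt0 exprn_gt0.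
move=> u u0.
have -> : expR (a * u) = expR (a / j.+1%:R * u) ^+ j.+1.
  by rewrite -expRM_natl; congr expR; rewrite !mulrA [_ * a]mulrC mulfK ?pnatr_eq0.
rewrite mulrC ler_pdivlMr ?exprn_gt0 // -exprMn.
have ja' := ltW ja.
apply: lerXn2r; rewrite ?nnegrE ?expR_ge0 //; first exact: mulr_ge0.
by apply: le_trans (expR_ge1Dx _); rewrite [u * _]mulrC lerDr.
Qed.

Lemma natr_pow_le_expR (a : R) (j : nat) : 0 < a -> exists2 C : R, 0 < C &
  forall N : nat, (N + 2)%:R ^+ j <= C * expR (a * Num.sqrt N%:R).
Proof.
move=> a0; have [C C0 H] := pow_le_expR (j * 2) a0.
exists (2 ^+ j * C * expR a); first by rewrite !mulr_gt0 ?exprn_gt0 ?expR_gt0.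
move=> N; set u := Num.sqrt _.
have u0 : 0 <= u by exact: sqrtr_ge0.
have uE : u ^+ 2 = N%:R by rewrite sqr_sqrtr.
have := H (u + 1) (addr_ge0 u0 ler01).
rewrite mulrDr mulr1 expRD => h.
apply: le_trans (_ : _ <= (2 * (u + 1) ^+ 2) ^+ j) _.
  have s0 : 0 <= 2 * (u + 1) ^+ 2 by rewrite mulr_ge0 // sqr_ge0.
  apply: lerXn2r; rewrite ?nnegrE //.
  by rewrite natrD -uE; nra.
rewrite exprMn -exprM mulnC -!mulrA ler_wpM2l ?exprn_ge0 //.
by rewrite [expR a * _]mulrC.
Qed.

(** The pointwise bound saves [exp (c N / k)] against a loss of [b ^ k], the moments save a power of
    [b ^ k]. Splitting at [k] of order [sqrt N] makes both savings [exp (c sqrt N)]; this is the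
    origin of the square root in the theorem. *)
Lemma shell_sum_decay (e : nat) : (6 <= e)%N ->
  exists c C : R, [/\ 0 < c, 0 < C &
   forall M N k, (0 < N)%N -> (N - N %/ e <= M)%N ->
     (5 * e * k <= (2 * N + 2) * (e - 5))%N ->
     shell_sum R b M (N - N %/ e) k <= C * expR (- (c * Num.sqrt N%:R))].
Proof.
move=> e6.
have [rho [rho0 rho1 rho_pair]] := digit_factor_pair R b1.
have rho01 : 0 < rho < 1 by rewrite rho0 rho1.
have [eta [C1 [eta0 C10 power]]] := shell_power_saving b1 rho01 rho_pair e6.
pose lr := - ln rho.
have lr0 : 0 < lr by rewrite oppr_gt0 ln_lt0.
(* By [8 Lb tau ^ 2 = lr], as long as [k + 1 <= tau sqrt N] the exponent saved is, up to a constant,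
   at least twice that of [b ^ (k + 1)]. *)
pose tau := Num.sqrt (lr / (8 * Lb)).
have tau0 : 0 < tau by rewrite sqrtr_gt0 divr_gt0 // mulr_gt0.
have tauE : 8 * Lb * (tau * tau) = lr.
  have := sqr_sqrtr (ltW (divr_gt0 lr0 (mulr_gt0 (ltr0n R 8 : 0 < 8) Lb0))).
  by rewrite -/tau expr2 => ->; field; rewrite gt_eqF.
pose c := Num.min (tau * Lb) (eta * tau).
have c0 : 0 < c by rewrite lt_min !mulr_gt0.
have c1 : c <= tau * Lb by rewrite ge_min lexx.
have c2 : c <= eta * tau by rewrite ge_min lexx orbT.
pose BB : R := B%:R.
have BB0 : 0 <= BB by exact: ler0n.
pose CA := BB * expR lr.
pose CB := BB * (b ^ e.+1)%:R * expR (c * (e.+1%:R / tau)).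
pose CC := C1 * expR eta.
have CA0 : 0 <= CA by rewrite mulr_ge0 ?expR_ge0.
have CB0 : 0 <= CB by rewrite !mulr_ge0 ?expR_ge0.
have CC0 : 0 < CC by rewrite mulr_gt0 ?expR_gt0.
exists c, (CA + CB + CC); split=> //; first by rewrite ltr_wpDl // addr_ge0.
move=> M N k N0 NM hk; set u := Num.sqrt _.
have u0 : 0 <= u by exact: sqrtr_ge0.
have uE : u * u = N%:R by rewrite -expr2 sqr_sqrtr.
set r := (N - N %/ e)%N in NM *.
have Nr : (N <= 2 * r)%N /\ (0 < r)%N.
  rewrite /r; have : (N %/ e * 6 <= N)%N.
    by apply: leq_trans (leq_divM N e); rewrite leq_mul2l e6 orbT.
  by clear -N0; move: (N %/ e)%N => x; lia.
case: Nr => Nr r0.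
have E0 : 0 < expR (- (c * u)) by exact: expR_gt0.
have tot x : x = CA \/ x = CB \/ x = CC -> x * expR (- (c * u)) <= (CA + CB + CC) * expR (- (c * u)).
  move=> hx; rewrite ler_wpM2r ?(ltW E0) //.
  by case: hx => [->|[->|->]]; lra.
have pw := shell_sum_le_pointwise b1 rho01 rho_pair k NM r0.
have [small|large] := leP (k.+1%:R) (tau * u).
  apply: le_trans (tot CA _); last by left.
  apply: le_trans pw _; rewrite natr_expn_expR // -/BB /CA -!mulrA ler_wpM2l //.
  have -> : rho ^+ (r.-1 %/ k.+1) = expR (- (lr / 2) * (r.-1 %/ k.+1)%:R) ^+ 2.
    rewrite -expRM_natl -[rho in LHS]lnK ?posrE // -expRM_natl; congr expR.
    by rewrite /lr; field.
  rewrite sqrtr_sqr ger0_norm ?expR_ge0 // -!expRD ler_expR.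
  have j1 : N%:R <= 2 * k.+1%:R * ((r.-1 %/ k.+1)%:R + 2) :> R.
    rewrite -natrM -[X in _ * (_ + X)]/(2%:R) -natrD -natrM ler_nat.
    have := ltn_ceil r.-1 (ltn0Sn k); move: (r.-1 %/ k.+1)%N => j.
    by clear -Nr r0; nia.
  move: j1 small; move: (r.-1 %/ k.+1)%:R (ltr0n R k.+1 : 0 < k.+1%:R = true) => j.
  move: (k.+1%:R : R) => x x0 j1 small.
  have j2 : u <= 2 * tau * (j + 2).
    have [j20|j20] := leP (j + 2) 0.
      have : 2 * x * (j + 2) <= 0 by rewrite mulr_ge0_le0 // mulr_ge0 // ltW.
      by have : (1 : R) <= N%:R by [rewrite ler1n]; lra.
    have : u * u <= u * (2 * tau * (j + 2)).
      rewrite uE; apply: le_trans j1 _.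
      have : x * (j + 2) <= tau * u * (j + 2) by rewrite ler_wpM2r // ltW.
      lra.
    have u1 : 0 < u by rewrite sqrtr_gt0 ltr0n.
    by rewrite ler_pM2l.
  have j3 : 4 * Lb * tau * u <= lr * (j + 2).
    rewrite -tauE; have := ler_wpM2l (ltW (mulr_gt0 (mulr_gt0 (ltr0n R 4 : 0 < 4) Lb0) tau0)) j2.
    lra.
  have j4 : x * Lb <= tau * u * Lb by rewrite ler_wpM2r // ltW.
  have j5 : c * u <= tau * Lb * u by rewrite ler_wpM2r.
  lra.
(* If [k <= e], then [tau sqrt N < e + 1], so [N] is bounded and a constant absorbs everything. *)
have [ke|ke] := leqP k e.
  apply: le_trans (tot CB _); last by right; left.
  apply: le_trans pw _; rewrite -/BB /CB -!mulrA ler_wpM2l // ler_pM ?sqrtr_ge0 //.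
    by rewrite ler_nat leq_pexp2l.
  apply: le_trans (_ : _ <= 1) _.
    by rewrite -sqrtr1 ler_wsqrtr // exprn_ile1 // ltW.
  rewrite -expRD -[leLHS]expR0 ler_expR -mulrBr mulr_ge0 ?(ltW c0) // subr_ge0.
  rewrite ler_pdivlMr // mulrC; apply: le_trans (ltW large) _.
  by rewrite ler_nat.
apply: le_trans (tot CC _); last by right; right.
apply: le_trans (power M r k _ _ NM) _; [exact: leq_trans e6 (ltnW ke) | exact: shell_index_bounds |].
rewrite /CC -mulrA ler_wpM2l ?(ltW C10) // -expRD ler_expR.
have h1 : c * u <= eta * tau * u by rewrite ler_wpM2r.
have h2 : eta * (tau * u) <= eta * k.+1%:R by rewrite ler_wpM2l // ltW.
move: h2; rewrite -addn1 natrD mulrDr mulr1; lra.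
Qed.

(** There are at most [N + 2] shells, and the harmonic sum is at most [b (N + 2)]; half of the decay
    absorbs the square of [N + 2]. *)
Lemma sum_fourier_error_decay (e : nat) : (6 <= e)%N ->
  exists c C : R, [/\ 0 < c, 0 < C &
   forall M N X, (0 < N)%N -> (N - N %/ e <= M)%N ->
     (X <= b ^ (((2 * N + 2) * (e - 5)) %/ (5 * e)).+1)%N ->
     \sum_(1 <= q < X | coprime q b) fourier_error R b M (N - N %/ e) q
     <= C * expR (- (c * Num.sqrt N%:R))].
Proof.
move=> e6.
have [c [C [c0 C0 H]]] := shell_sum_decay e6.
have [C2 C20 H2] := @natr_pow_le_expR (c / 2) 2 (divr_gt0 c0 (ltr0n R 2 : 0 < 2)).
exists (c / 2), (b%:R * C2 * C); split; rewrite ?divr_gt0 ?mulr_gt0 //.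
move=> M N X N0 NM XN; set r := (N - N %/ e)%N in NM *.
set n := (_ %/ _).+1 in XN.
have nN : (n <= N + 2)%N.
  by rewrite [leqRHS]addn2 /n ltnS; exact: shell_count_bound.
apply: le_trans (sum_fourier_error_le R b1 M r X) _.
have ext (F : nat -> R) (P : pred nat) : (forall d, 0 <= F d) ->
   \sum_(1 <= d < X | P d) F d <= \sum_(1 <= d < b ^ n | P d) F d.
  move=> F0; have [X0|X0] := ltnP 0 X; last first.
    by rewrite big_geq ?(leq_trans X0) // sumr_ge0.
  by rewrite [leRHS](big_cat_nat (n := X)) //= lerDl sumr_ge0.
have H0 : \sum_(1 <= j < X) (j%:R)^-1 <= n%:R * b%:R :> R.
  apply: le_trans (ext (fun j => j%:R^-1) predT _) _; last exact: harmonic_le.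
  by move=> d; rewrite invr_ge0.
have pos d : 0 <= primitive_sum R b M r d / d%:R by rewrite divr_ge0 // primitive_sum_ge0.
have S0 : \sum_(1 <= d < X | coprime d b && (1 < d)%N) primitive_sum R b M r d / d%:R <=
    n%:R * (C * expR (- (c * Num.sqrt N%:R))).
  apply: le_trans (ext _ _ pos) _; rewrite sum_shells //.
  rewrite mulr_natl -[n in leRHS]subn0 -sumr_const_nat big_nat [leRHS]big_nat.
  apply: ler_sum => k /andP [_ kn]; apply: H => //.
  rewrite ltnS in kn; rewrite mulnC; apply: leq_trans (leq_divM _ (5 * e)).
  by rewrite leq_mul2r kn orbT.
apply: le_trans (ler_pM _ _ H0 S0) _.
- by apply: sumr_ge0 => j _; rewrite invr_ge0.
- by apply: sumr_ge0.
have nn : n%:R ^+ 2 <= C2 * expR (c / 2 * Num.sqrt N%:R).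
  by apply: le_trans (H2 N); apply: lerXn2r; rewrite ?nnegrE // ler_nat.
have -> : n%:R * b%:R * (n%:R * (C * expR (- (c * Num.sqrt N%:R)))) =
  n%:R ^+ 2 * (b%:R * C * expR (- (c * Num.sqrt N%:R))) by ring.
apply: le_trans (ler_wpM2r _ nn) _.
  by rewrite !mulr_ge0 ?expR_ge0 // ltW.
have -> : C2 * expR (c / 2 * Num.sqrt N%:R) * (b%:R * C * expR (- (c * Num.sqrt N%:R))) =
  b%:R * C2 * C * (expR (c / 2 * Num.sqrt N%:R) * expR (- (c * Num.sqrt N%:R))) by ring.
rewrite ler_wpM2l ?mulr_ge0 ?(ltW C0) ?(ltW C20) // -expRD ler_expR; lra.
Qed.

End Decay.

(** * Discrepancy *)

Lemma dig_mul_expn_low b i m c : (0 < b)%N -> (i < m)%N -> dig b i (c * b ^ m) = 0%N.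
Proof.
move=> b0 im; rewrite -[(c * _)%N]addn0 dig_add_low //.
by rewrite /dig div0n mod0n.
Qed.

Lemma dig_add_high b i m c v : (0 < b)%N -> (m <= i)%N -> (v < b ^ m)%N ->
  dig b i (c * b ^ m + v) = dig b i (c * b ^ m).
Proof.
move=> b0 mi vm; rewrite -(subnKC mi) -!dig_div.
by rewrite divnMDl ?expn_gt0 ?b0 // (divn_small vm) addn0 mulnK ?expn_gt0 ?b0.
Qed.

(** With the outer digits fixed, the palindrome is a constant plus a digit form in the inner digits,
    to which the bounds for complete blocks apply. *)
Lemma pal_add b M m c v : (0 < b)%N -> (m <= M.+1)%N -> (v < b ^ m)%N ->
  pal b M (c * b ^ m + v) = (pal b M (c * b ^ m) + digit_form b (pal_weight b M) m v)%N.
Proof.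
move=> b0 mM vm; rewrite /pal /digit_form.
rewrite (big_cat_nat (n := m)) //= [in RHS](big_cat_nat (n := m)) //=.
rewrite [X in (_ = X + _ + _)%N]big_nat [X in (_ = X + _ + _)%N]big1 ?add0n; last first.
  by move=> i /andP [_ im]; rewrite dig_mul_expn_low.
rewrite addnC; congr (_ + _)%N; apply: eq_big_nat => i /andP [h1 h2].
  by rewrite dig_add_high.
by rewrite dig_add_low.
Qed.

Lemma pal_widen b M r u : (0 < b)%N -> (M <= r)%N -> (u < b ^ M.+1)%N ->
  pal b r u = (b ^ (r - M) * pal b M u)%N.
Proof.
move=> b0 Mr uM; rewrite /pal (big_cat_nat (n := M.+1)) //=.
rewrite [X in (_ + X)%N]big_nat [X in (_ + X)%N]big1 ?addn0; last first.
  move=> i /andP [Mi _]; rewrite /dig divn_small ?mod0n ?mul0n //.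
  by apply: leq_trans uM _; rewrite leq_pexp2l.
rewrite big_distrr /=; apply: eq_big_nat => i /andP [_ iM].
rewrite mulnCA; congr (_ * _)%N; rewrite /pal_weight; case: eqP => _.
  by rewrite -expnD subnK.
by rewrite mulnDr -!expnD; congr (b ^ _ + b ^ _)%N; lia.
Qed.

(** * Palindromes of a single length *)

Section Levels.
Variables (R : realType) (b : nat).
Hypothesis b1 : (1 < b)%N.
Local Notation B := (b ^ 2 - 1)%N.

Let b0 : (0 < b)%N. Proof. exact: ltnW. Qed.
Let B0 : (0 < B)%N. Proof. by rewrite subn_gt0 -{1}(exp1n 2) ltn_exp2r. Qed.

Variables (q a : nat).
Hypothesis q0 : (0 < q)%N.
Hypothesis qB : coprime q B.

Definition class_deviation (n : nat) : R := (n == a %[mod q])%N%:R - q%:R^-1.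
Local Notation G := class_deviation.

Lemma residue_set_fourier_error (M r n0 : nat) (U : pred nat) :
  `|\sum_(0 <= v < b ^ r.+1 | U ((n0 + digit_form b (pal_weight b M) r.+1 v) %% B)%N)
      G (n0 + digit_form b (pal_weight b M) r.+1 v)| <=
  b%:R ^+ r.+1 * fourier_error R b M r q.
Proof.
apply: le_trans (residue_set_discrepancy_le R b1 (pal_weight b M) r.+1 n0 a U q0 B0 qB) _.
rewrite -mulrA ler_wpM2l ?exprn_ge0 // /fourier_error mulrC ler_wpM2r ?invr_ge0 //.
apply: ler_sum => l _; rewrite big_ltn // /inner_product.
rewrite ler_piMl ?digit_factor_le1 //.
by apply: prod_nat_ge0 => i; exact: digit_factor_ge0.
Qed.

(** The right side is nonnegative, so the sum over any part of a block is dominated by the sum over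
    the whole block, at the price of [2 / q] per term. *)
Lemma class_deviation_norm_le n : `|G n| <= G n + 2 * q%:R^-1.
Proof.
have qi : 0 <= q%:R^-1 :> R by rewrite invr_ge0.
rewrite /G; case: (n == a %[mod q])%N.
  have q1 : q%:R^-1 <= 1 :> R by rewrite invf_le1 ?ltr0n // ler1n.
  by rewrite ger0_norm ?subr_ge0 //; lra.
by rewrite sub0r normrN ger0_norm //; lra.
Qed.

Lemma partial_block_le (M r n0 : nat) (P : pred nat) :
  `|\sum_(0 <= v < b ^ r.+1 | P v) G (n0 + digit_form b (pal_weight b M) r.+1 v)| <=
  b%:R ^+ r.+1 * fourier_error R b M r q + 2 * b%:R ^+ r.+1 / q%:R.
Proof.
apply: le_trans (ler_norm_sum _ _ _) _.
apply: le_trans (_ : _ <= \sum_(0 <= v < b ^ r.+1)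
   (G (n0 + digit_form b (pal_weight b M) r.+1 v) + 2 * q%:R^-1)) _.
  rewrite big_mkcond; apply: ler_sum => v _.
  apply: le_trans (class_deviation_norm_le _); case: ifP => // _; exact: normr_ge0.
rewrite big_split /= sumr_const_nat subn0; apply: lerD.
  have := residue_set_fourier_error M r n0 predT.
  by apply: le_trans; exact: ler_norm.
by rewrite -[leLHS]mulr_natr natrX mulrAC.
Qed.

(** [W] is the string of the upper [M - r] digits of [u]. Blocks with [W < W0] lie below [Y], those
    with [W > W0] above it, and only [W0] is cut, which gives the extra term. Inside a block
    coprimality with [b] does not vary, since [r < M] makes all inner weights multiples of [b];
    coprimality with [B] is a condition modulo [B]. *)
Lemma level_long (M r Y : nat) : (r < M)%N ->
  `|\sum_((b ^ M)%N <= u < (b ^ M.+1)%N | (pal b M u <= Y)%N && coprime (pal b M u) (b ^ 3 - b))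
      G (pal b M u)| <=
  b%:R ^+ M.+1 * fourier_error R b M r q + 2 * b%:R ^+ r.+1 / q%:R.
Proof.
move=> rM.
have Err0 := fourier_error_ge0 R b1 M r q.
pose c u := [&& (b ^ M <= u)%N, (pal b M u <= Y)%N & coprime (pal b M u) (b ^ 3 - b)].
have -> : \sum_((b ^ M)%N <= u < (b ^ M.+1)%N | (pal b M u <= Y)%N && coprime (pal b M u) (b ^ 3 - b))
      G (pal b M u) = \sum_(0 <= u < b ^ M.+1 | c u) G (pal b M u).
  rewrite [RHS](big_cat_nat (n := (b ^ M)%N)) ?leq_pexp2l //=.
  rewrite [X in _ = X + _]big_nat_cond [X in _ = X + _]big1 ?add0r; last first.
    by move=> u /andP [/andP [_ ul]]; rewrite /c leqNgt ul.
  rewrite big_nat_cond [RHS]big_nat_cond; apply: eq_bigl => u.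
  by rewrite /c; case: (b ^ M <= u)%N.
have EM : (b ^ M.+1 = b ^ (M - r) * b ^ r.+1)%N by rewrite -expnD; congr (b ^ _)%N; lia.
rewrite EM big_mkcond big_nat_mul_digits.
pose Z := (Y %/ b ^ M)%N; pose W0 := (Z %/ b ^ r.+1)%N.
have main W : (W < b ^ (M - r))%N ->
  `|\sum_(0 <= v < b ^ r.+1) (if c (W * b ^ r.+1 + v)%N then G (pal b M (W * b ^ r.+1 + v)) else 0)|
   <= b%:R ^+ r.+1 * fourier_error R b M r q + (if W == W0 then 2 * b%:R ^+ r.+1 / q%:R else 0).
  move=> WM; rewrite -big_mkcond.
  set n0 := pal b M (W * b ^ r.+1).
  pose n v := (n0 + digit_form b (pal_weight b M) r.+1 v)%N.
  have nE v : (v < b ^ r.+1)%N -> pal b M (W * b ^ r.+1 + v) = n v.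
    by move=> vr; rewrite pal_add // ltnW.
  have -> : \sum_(0 <= v < b ^ r.+1 | c (W * b ^ r.+1 + v)%N) G (pal b M (W * b ^ r.+1 + v)) =
     \sum_(0 <= v < b ^ r.+1 | c (W * b ^ r.+1 + v)%N) G (n v).
    by rewrite big_nat_cond [RHS]big_nat_cond; apply: eq_bigr => v /andP [/andP [_ vr] _]; rewrite nE.
  have ex0 : 0 <= b%:R ^+ r.+1 * fourier_error R b M r q.
    by rewrite mulr_ge0 // exprn_ge0.
  have [_|WW] := eqVneq W W0; first exact: partial_block_le.
  rewrite addr0.
  have zero : (forall v, (v < b ^ r.+1)%N -> ~~ c (W * b ^ r.+1 + v)%N) ->
    `|\sum_(0 <= v < b ^ r.+1 | c (W * b ^ r.+1 + v)%N) G (n v)| <= b%:R ^+ r.+1 * fourier_error R b M r q.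
    move=> h; rewrite big_nat_cond big1 ?normr0 // => v /andP [/andP [_ vr]].
    by rewrite (negbTE (h v vr)).
  have uM v : (v < b ^ r.+1)%N -> (W * b ^ r.+1 + v < b ^ M.+1)%N.
    move=> vr; rewrite EM; have : (W.+1 * b ^ r.+1 <= b ^ (M - r) * b ^ r.+1)%N by rewrite leq_mul2r WM orbT.
    by rewrite mulSn; lia.
  have bM0 : (0 < b ^ M)%N by rewrite expn_gt0 b0.
  have br0 : (0 < b ^ r.+1)%N by rewrite expn_gt0 b0.
  have [lt|gt|eq] := ltngtP W W0; last first.
  - by rewrite eq eqxx in WW.
  - apply: zero => v vr; rewrite /c; apply/negP => /and3P [_ le _].
    have : (Z < W * b ^ r.+1 + v)%N.
      apply: leq_trans (leq_addr _ _).
      apply: leq_trans (ltn_ceil Z br0) _.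
      by rewrite leq_mul2r gt orbT.
    rewrite ltnNge; case/negP.
    rewrite -(pal_div b0 (uM v vr)) /Z; exact: leq_div2r.
  have full v : (v < b ^ r.+1)%N -> (pal b M (W * b ^ r.+1 + v) <= Y)%N.
    move=> vr; apply: leq_trans (leq_divM Y (b ^ M)); rewrite -/Z.
    apply: ltnW; rewrite -ltn_divLR // pal_div ?uM //.
    apply: leq_trans (leq_divM Z (b ^ r.+1)); rewrite -/W0.
    have : (W.+1 * b ^ r.+1 <= W0 * b ^ r.+1)%N by rewrite leq_mul2r lt orbT.
    by rewrite mulSn; lia.
  have [lead|lead] := leqP (b ^ (M - r.+1)) W; last first.
    apply: zero => v vr; rewrite /c negb_and -ltnNge; apply/orP; left.
    have EM' : (b ^ M = b ^ (M - r.+1) * b ^ r.+1)%N by rewrite -expnD subnK.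
    have : (W.+1 * b ^ r.+1 <= b ^ (M - r.+1) * b ^ r.+1)%N by rewrite leq_mul2r lead orbT.
    by rewrite EM' mulSn; lia.
  have dvb v : (b %| digit_form b (pal_weight b M) r.+1 v)%N.
    rewrite /digit_form big_nat; apply: dvdn_sum => i /andP [_ ir]; apply: dvdn_mull.
    rewrite /pal_weight; case: eqP => i0; first by rewrite dvdn_exp //; apply: leq_ltn_trans rM.
    by rewrite dvdn_add // dvdn_exp // ?subn_gt0 ?addn_gt0 ?(leq_trans ir) //; apply/orP; left; apply: leq_ltn_trans rM.
  have nb v : coprime (n v) b = coprime n0 b.
    by rewrite -[LHS]coprime_modl -[RHS]coprime_modl /n -modnDmr (eqP (dvb v)) addn0.
  have cE v : (v < b ^ r.+1)%N -> c (W * b ^ r.+1 + v)%N = coprime n0 b && coprime (n v %% B) B.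
    move=> vr; rewrite /c full // nE // expn3_subE coprimeMr nb coprime_modl.
    suff -> : (b ^ M <= W * b ^ r.+1 + v)%N by [].
    apply: leq_trans (leq_addr _ _).
    by rewrite -(subnK rM) expnD leq_mul2r lead orbT.
  have [cop|ncop] := boolP (coprime n0 b); last first.
    by apply: zero => v vr; rewrite cE // (negbTE ncop).
  rewrite big_nat_cond (eq_bigl (fun v => (0 <= v < b ^ r.+1)%N && coprime (n v %% B) B)); last first.
    move=> v; case: (ltnP v (b ^ r.+1)) => [vr|]; last by rewrite !andbF.
    by rewrite cE // cop.
  rewrite -big_nat_cond; exact: (residue_set_fourier_error M r n0 (fun z => coprime z B)).
apply: le_trans (ler_norm_sum _ _ _) _.
apply: le_trans (_ : _ <= \sum_(0 <= W < b ^ (M - r)) (b%:R ^+ r.+1 * fourier_error R b M r q +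
    (if W == W0 then 2 * b%:R ^+ r.+1 / q%:R else 0))) _.
  by rewrite big_nat [leRHS]big_nat; apply: ler_sum => W /andP [_ WM]; exact: main.
rewrite big_split /= sumr_const_nat subn0; apply: lerD.
  by rewrite -[leLHS]mulr_natl mulrA natrX -exprD; have -> : (M - r + r.+1 = M.+1)%N by lia.
have p0 : 0 <= 2 * b%:R ^+ r.+1 / q%:R :> R by rewrite divr_ge0 // mulr_ge0 // exprn_ge0.
have [lt|ge] := ltnP W0 (b ^ (M - r)).
  rewrite big_mkord (bigD1 (Ordinal lt)) //= eqxx big1 ?addr0 // => i ne.
  by rewrite ifF //; apply/negbTE; apply: contra ne => /eqP E; apply/eqP/val_inj.
rewrite big_nat big1 // => W /andP [_ WM]; rewrite ifF //.
by apply/negbTE; rewrite neq_ltn (leq_trans WM ge).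
Qed.

End Levels.

Section LevelShort.
Variables (R : realType) (b : nat).
Hypothesis b1 : (1 < b)%N.
Local Notation B := (b ^ 2 - 1)%N.

Let b0 : (0 < b)%N. Proof. exact: ltnW. Qed.

(* Multiplying by [b ^ (r - M)] embeds the palindromes of length [2 M + 1] into
   the numbers [pal b r v] with [v < b ^ r.+1]. *)
Lemma level_short (q a M r Y : nat) : (0 < q)%N -> coprime q B -> coprime q b -> (M <= r)%N ->
  `|\sum_((b ^ M)%N <= u < (b ^ M.+1)%N | (pal b M u <= Y)%N && coprime (pal b M u) (b ^ 3 - b))
      class_deviation R q a (pal b M u)| <=
  b%:R ^+ r.+1 * fourier_error R b r r q + 2 * b%:R ^+ r.+1 / q%:R.
Proof.
move=> q0 qB qb Mr.
apply: le_trans (ler_norm_sum _ _ _) _.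
(* [q] is coprime to [b], so multiplying both sides by [b ^ (r - M)] gives an equivalent
   congruence. *)
pose a' := (b ^ (r - M) * a)%N.
have key := residue_set_fourier_error R b1 a' q0 qB r r 0 predT.
apply: le_trans (_ : _ <= \sum_(0 <= v < b ^ r.+1)
   (class_deviation R q a' (0 + digit_form b (pal_weight b r) r.+1 v) + 2 * q%:R^-1)) _; last first.
  rewrite big_split /= sumr_const_nat subn0; apply: lerD.
    by apply: le_trans key; exact: ler_norm.
  by rewrite -[leLHS]mulr_natr natrX mulrAC.
have pos v : 0 <= class_deviation R q a' (0 + digit_form b (pal_weight b r) r.+1 v) + 2 * q%:R^-1.
  by apply: le_trans (class_deviation_norm_le R a' q0 _).
rewrite [leRHS](big_cat_nat (n := (b ^ M)%N)) //=; last by rewrite leq_pexp2l // (leq_trans Mr).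
rewrite [X in _ <= _ + X](big_cat_nat (n := (b ^ M.+1)%N)) ?leq_pexp2l //=.
apply: le_trans (_ : _ <= \sum_((b ^ M)%N <= v < (b ^ M.+1)%N)
   (class_deviation R q a' (0 + digit_form b (pal_weight b r) r.+1 v) + 2 * q%:R^-1)) _; last first.
  have h1 : 0 <= \sum_(0 <= v < b ^ M)
     (class_deviation R q a' (0 + digit_form b (pal_weight b r) r.+1 v) + 2 * q%:R^-1) by apply: sumr_ge0.
  have h2 : 0 <= \sum_((b ^ M.+1)%N <= v < (b ^ r.+1)%N)
     (class_deviation R q a' (0 + digit_form b (pal_weight b r) r.+1 v) + 2 * q%:R^-1) by apply: sumr_ge0.
  lra.
rewrite big_mkcond big_nat [leRHS]big_nat; apply: ler_sum => u /andP [_ uM].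
case: ifP => // _; rewrite add0n.
have -> : digit_form b (pal_weight b r) r.+1 u = (b ^ (r - M) * pal b M u)%N.
  by rewrite -(pal_widen b0 Mr uM).
have -> : class_deviation R q a' (b ^ (r - M) * pal b M u) = class_deviation R q a (pal b M u).
  rewrite /class_deviation /a'; congr (_%:R - _); congr nat_of_bool.
  have canc x y : (x <= y)%N -> (b ^ (r - M) * y == b ^ (r - M) * x %[mod q])%N = (y == x %[mod q])%N.
    move=> xy; rewrite !eqn_mod_dvd ?leq_mul2l ?xy ?orbT // -mulnBr Gauss_dvdr //.
    by rewrite coprimeXr.
  have [le|le] := leqP a (pal b M u); first exact: canc.
  by rewrite eq_sym [RHS]eq_sym; apply: canc; exact: ltnW.
exact: class_deviation_norm_le.
Qed.

End LevelShort.

Lemma eqmodz_nat (q : nat) (a : int) : (0 < q)%N ->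
  exists a0 : nat, forall n : nat, (n%:Z == a %[mod q%:Z])%Z = (n == a0 %[mod q])%N.
Proof.
move=> q0; have q0' : q%:Z != 0 by rewrite eqz_nat -lt0n.
exists `|(a %% q%:Z)%Z|%N => n.
have E : (a %% q%:Z)%Z = `|(a %% q%:Z)%Z|%N :> int by rewrite gez0_abs // modz_ge0.
by rewrite -[X in _ == X](modz_mod a) E !modz_nat eqz_nat.
Qed.

(** * Summation over the moduli *)

Section Assembly.
Variables (R : realType) (b : nat).
Hypothesis b1 : (1 < b)%N.
Local Notation Lb := (ln (b%:R : R)).

Let b0 : (0 < b)%N. Proof. exact: ltnW. Qed.
Let bR : 0 < b%:R :> R. Proof. by rewrite ltr0n. Qed.
Let Lb0 : 0 < Lb. Proof. by rewrite ln_gt0 // ltr1n. Qed.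

(** Free of [y] and [a], hence a bound for both suprema. The [maxn] unites the long lengths with the
    short ones, which are embedded at level [r]. *)
Definition discrepancy_bound (N r q : nat) : R :=
  \sum_(0 <= M < N.+1) (b%:R ^+ N.+1 * fourier_error R b (maxn M r) r q + 2 * b%:R ^+ r.+1 / q%:R).

Lemma discrepancy_le (N r q : nat) (y : R) (a : int) :
  (0 < q)%N -> coprime q (b ^ 3 - b) -> (r <= N)%N ->
  (Num.truncn y < b ^ N.+1.*2)%N ->
  `|discrepancy b q y a| <= discrepancy_bound N r q.
Proof.
move=> q0 cop rN yN.
move: cop; rewrite expn3_subE coprimeMr => /andP [qb qB].
have [a0 Ea] := eqmodz_nat a q0.
rewrite /discrepancy /pal_star.
under eq_bigr do rewrite Ea.
rewrite (big_pal_star (class_deviation R q a0) b1 yN).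
apply: le_trans (ler_norm_sum _ _ _) _.
rewrite /discrepancy_bound big_nat [leRHS]big_nat; apply: ler_sum => M /andP [_ MN].
have b1R : 1 <= b%:R :> R by rewrite ler1n.
have [Mr|rM] := leqP M r.
  apply: le_trans (level_short R b1 a0 _ q0 qB qb Mr) _.
  rewrite lerD2r ler_wpM2r ?(fourier_error_ge0 R b1) //.
  by rewrite ler_weXn2l // ltnS.
apply: le_trans (level_long R b1 a0 q0 qB _ rM) _.
rewrite lerD2r ler_wpM2r ?(fourier_error_ge0 R b1) //.
by rewrite ler_weXn2l.
Qed.

Lemma discrepancy_bound_ge0 N r q : 0 <= discrepancy_bound N r q.
Proof.
apply: sumr_ge0 => M _; apply: addr_ge0.
  by apply: mulr_ge0; [exact: exprn_ge0 | exact: fourier_error_ge0].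
by apply: divr_ge0 => //; apply: mulr_ge0 => //; exact: exprn_ge0.
Qed.

(** The Fourier terms decay by [sum_fourier_error_decay]. The cut blocks contribute [b ^ r] times a
    power of [N + 2], and [r = N - N %/ e] lies below [N] by about [N / e]. *)
Lemma sum_discrepancy_bound_decay (e : nat) : (6 <= e)%N ->
  exists c C : R, [/\ 0 < c, 0 < C &
   forall N X, (0 < N)%N -> (0 < X)%N ->
     (X <= b ^ (((2 * N + 2) * (e - 5)) %/ (5 * e)).+1)%N ->
     \sum_(1 <= q < X | coprime q (b ^ 3 - b)) discrepancy_bound N (N - N %/ e) q
     <= C * (b%:R ^+ N * expR (- (c * Num.sqrt N%:R)))].
Proof.
move=> e6.
have [c [C [c0 C0 H]]] := sum_fourier_error_decay R b1 e6.
have eR : 0 < e%:R :> R by rewrite ltr0n (leq_trans _ e6).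
(* Half of each of the two rates; the other half absorbs [(N + 2) ^ 2]. *)
pose c' := Num.min (c / 2) (Lb / (2 * e%:R)).
have c'0 : 0 < c' by rewrite lt_min !divr_gt0 // mulr_gt0.
have c'1 : c' <= c / 2 by rewrite ge_min lexx.
have c'2 : c' <= Lb / (2 * e%:R) by rewrite ge_min lexx orbT.
have [C2 C20 H2] := natr_pow_le_expR 2 c'0.
exists c', (C2 * (b%:R * C + 2 * b%:R ^+ 3)); split=> //.
  by rewrite mulr_gt0 // addr_gt0 ?mulr_gt0 ?exprn_gt0.
move=> N X N0 X0 XN; set r := (N - N %/ e)%N; set u := Num.sqrt _.
have u0 : 0 <= u by exact: sqrtr_ge0.
have uN : u <= N%:R.
  have u1 : 1 <= u by rewrite -sqrtr1 ler_wsqrtr // ler1n.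
  have : u ^+ 2 = N%:R by rewrite sqr_sqrtr.
  by move=> <-; rewrite expr2 ler_peMl.
set n := (_ %/ _).+1 in XN.
have nN : (n <= N + 2)%N by rewrite [leqRHS]addn2 /n ltnS; exact: shell_count_bound.
have step1 : \sum_(1 <= q < X | coprime q (b ^ 3 - b)) discrepancy_bound N r q <=
  \sum_(1 <= q < X | coprime q b) discrepancy_bound N r q.
  rewrite big_mkcond [leRHS]big_mkcond; apply: ler_sum => q _.
  rewrite expn3_subE coprimeMr; case: (coprime q b) => //=.
  by case: ifP => // _; exact: discrepancy_bound_ge0.
apply: le_trans step1 _.
rewrite /discrepancy_bound exchange_big /=.
have harm : \sum_(1 <= q < X | coprime q b) q%:R^-1 <= (N + 2)%:R * b%:R :> R.
  apply: le_trans (_ : _ <= \sum_(1 <= q < b ^ n) q%:R^-1) _.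
    rewrite big_mkcond [leRHS](big_cat_nat (n := X)) //=.
    apply: le_trans (_ : _ <= \sum_(1 <= q < X) q%:R^-1) _.
      by apply: ler_sum => q _; case: ifP => // _; rewrite invr_ge0.
    by rewrite lerDl; apply: sumr_ge0 => q _; rewrite invr_ge0.
  apply: le_trans (harmonic_le R n b0) _.
  by rewrite ler_wpM2r // ler_nat.
have inner M : \sum_(1 <= q < X | coprime q b)
    (b%:R ^+ N.+1 * fourier_error R b (maxn M r) r q + 2 * b%:R ^+ r.+1 / q%:R) <=
    b%:R ^+ N.+1 * (C * expR (- (c * u))) + 2 * b%:R ^+ r.+1 * ((N + 2)%:R * b%:R).
  rewrite big_split /= -!mulr_sumr; apply: lerD.
    rewrite ler_wpM2l ?exprn_ge0 //; apply: H => //; exact: leq_maxr.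
  by rewrite ler_wpM2l // mulr_ge0 // exprn_ge0.
apply: le_trans (ler_sum _ (fun M _ => inner M)) _.
rewrite sumr_const_nat subn0 -[leLHS]mulr_natl.
have N1 : N.+1%:R <= (N + 2)%:R :> R by rewrite ler_nat addn2.
have N2 : (N + 2)%:R <= (N + 2)%:R ^+ 2 :> R by rewrite expr2 ler_peMr // ler1n addn2.
have br : b%:R ^+ r <= b%:R ^+ N * (b%:R * expR (- (Lb / e%:R * u))).
  have -> : b%:R ^+ N * (b%:R * expR (- (Lb / e%:R * u))) = expR ((N%:R + 1) * Lb - Lb / e%:R * u).
    by rewrite expRD mulrDl expRD mul1r -natr_expn_expR // natrX [X in _ = _ * X * _]lnK ?posrE // mulrA.
  rewrite -natrX natr_expn_expR // ler_expR.
  have h : N%:R / e%:R <= (N %/ e)%:R + 1 :> R.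
    rewrite ler_pdivrMr // -[X in _ + X]/(1%:R) -natrD -natrM ler_nat addn1.
    by rewrite ltnW // ltn_ceil // (leq_trans _ e6).
  have -> : r%:R = N%:R - (N %/ e)%:R :> R by rewrite natrB // leq_div.
  have h2 : u / e%:R <= N%:R / e%:R by rewrite ler_wpM2r // invr_ge0 ltW.
  have -> : (N%:R + 1) * Lb - Lb / e%:R * u = (N%:R + 1 - u / e%:R) * Lb by ring.
  by rewrite ler_wpM2r ?(ltW Lb0) //; lra.
have D1 : 0 <= b%:R ^+ N.+1 * (C * expR (- (c * u))).
  by rewrite !mulr_ge0 ?exprn_ge0 ?expR_ge0 // ltW.
have E1 : expR (- (c * u)) <= expR (- (2 * c' * u)).
  by rewrite ler_expR lerN2 ler_wpM2r //; lra.
have E2 : expR (- (Lb / e%:R * u)) <= expR (- (2 * c' * u)).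
  rewrite ler_expR lerN2 ler_wpM2r //.
  have -> : Lb / e%:R = 2 * (Lb / (2 * e%:R)) by field; rewrite gt_eqF.
  by rewrite ler_wpM2l.
set E := expR (- (2 * c' * u)) in E1 E2.
have E0 : 0 < E by exact: expR_gt0.
have S1 : N.+1%:R * (b%:R ^+ N.+1 * (C * expR (- (c * u))) + 2 * b%:R ^+ r.+1 * ((N + 2)%:R * b%:R)) <=
   (N + 2)%:R ^+ 2 * ((b%:R * C + 2 * b%:R ^+ 3) * (b%:R ^+ N * E)).
  have -> : (N + 2)%:R ^+ 2 * ((b%:R * C + 2 * b%:R ^+ 3) * (b%:R ^+ N * E)) =
    (N + 2)%:R * ((N + 2)%:R * (b%:R ^+ N.+1 * (C * E)) +
       2 * b%:R * (b%:R ^+ N * (b%:R * E)) * ((N + 2)%:R * b%:R)).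
    by rewrite [b%:R ^+ N.+1]exprS; ring.
  apply: ler_pM => //.
    by rewrite addr_ge0 // !mulr_ge0 ?exprn_ge0.
  apply: lerD.
    apply: le_trans (_ : _ <= 1 * (b%:R ^+ N.+1 * (C * E))) _.
      by rewrite mul1r ler_wpM2l ?exprn_ge0 // ler_wpM2l // ltW.
    rewrite ler_wpM2r ?mulr_ge0 ?exprn_ge0 ?(ltW C0) ?(ltW E0) //.
    by rewrite ler1n addn2.
  rewrite ler_wpM2r ?mulr_ge0 // exprS mulrA ler_wpM2l ?mulr_ge0 //.
  apply: le_trans br _; rewrite ler_wpM2l ?exprn_ge0 // ler_wpM2l //.
apply: le_trans S1 _.
apply: le_trans (ler_wpM2r _ (H2 N)) _.
  by rewrite !mulr_ge0 ?addr_ge0 ?mulr_ge0 ?exprn_ge0 // ltW.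
have -> : C2 * expR (c' * Num.sqrt N%:R) * ((b%:R * C + 2 * b%:R ^+ 3) * (b%:R ^+ N * E)) =
   C2 * (b%:R * C + 2 * b%:R ^+ 3) * (b%:R ^+ N * (expR (c' * u) * E)) by rewrite /u; ring.
rewrite ler_wpM2l ?mulr_ge0 ?addr_ge0 ?mulr_ge0 ?exprn_ge0 ?(ltW C0) ?(ltW C20) //.
rewrite ler_wpM2l ?exprn_ge0 // /E -expRD ler_expR; lra.
Qed.

(** For [N >= 4] use [size_pal_star_ge] with [K = N - 4]; for smaller [N] the palindrome [1]
    suffices, as [b ^ N <= b ^ 4]. *)
Lemma size_pal_star_lower (N : nat) (x : R) : 1 <= x ->
  (N <= 1)%N || (b ^ N.*2 <= Num.truncn x)%N ->
  b%:R ^+ N <= b%:R ^+ 4 * (size (pal_star b x))%:R :> R.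
Proof.
move=> x1 hN.
have nat_le : (b ^ N <= b ^ 4 * size (pal_star b x))%N.
  have [N4|N4] := leqP 4 N; last first.
    have s1 : (0 < size (pal_star b x))%N.
      rewrite lt0n size_eq0; apply/eqP => E.
      have : 1%N \in pal_star b x.
        rewrite /pal_star mem_filter mem_iota coprime1n andbT /= add1n ltnS truncn_gt0 x1 !andbT.
        have L1 : trunc_log b 1 = 0%N by apply: trunc_log_eq; rewrite ?expn0 ?expn1.
        by apply/palindromicP; rewrite L1; split=> // j; rewrite leqn0 => /eqP ->.
      by rewrite E.
    apply: leq_trans (_ : _ <= b ^ 4 * 1)%N _; last by rewrite leq_mul2l s1 orbT.
    by rewrite muln1 leq_pexp2l // ltnW.
  have hx : (b ^ N.*2 <= Num.truncn x)%N by case/orP: hN => //; lia.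
  have -> : (b ^ N = b ^ 4 * b ^ (N - 4))%N by rewrite -expnD subnKC.
  rewrite leq_mul2l; apply/orP; right; apply: size_pal_star_ge => //.
  by apply: leq_trans hx; rewrite leq_pexp2l //; lia.
by rewrite -!natrX -natrM ler_nat.
Qed.

End Assembly.

(** From [x < b ^ (2 N + 2)] and [1 / e <= eps], the moduli stay below [b] to the power [(2 N + 2)
    (1 / 5 - 1 / e) = (2 N + 2) (e - 5) / (5 e)], which is the bound on the shell index. *)
Lemma truncn_powR_lt (R : realType) (b e N : nat) (x eps : R) :
  (1 < b)%N -> (6 <= e)%N -> e%:R^-1 <= eps -> 1 <= x -> x < (b ^ N.+1.*2)%:R ->
  ((Num.truncn (x `^ (1 / 5 - eps))).+1 <= b ^ (((2 * N + 2) * (e - 5)) %/ (5 * e)).+1)%N.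
Proof.
move=> b1 e6 e_eps x1 xb.
have b0 : (0 < b)%N by exact: ltnW.
have Lb0 : 0 < ln (b%:R : R) by rewrite ln_gt0 // ltr1n.
have e5 : (5 <= e)%N by exact: ltnW.
have eR : 0 < e%:R :> R by rewrite ltr0n (leq_trans _ e6).
have e6R : 6 <= e%:R :> R by rewrite ler_nat.
have x0 : 0 < x by exact: lt_le_trans x1.
rewrite truncn_lt_nat ?powR_ge0 //.
apply: le_lt_trans (_ : _ <= x `^ (1 / 5 - e%:R^-1)) _.
  by apply: ler_powR => //; rewrite lerD2l lerN2.
set n := (_ %/ _)%N.
have nb : (2 * N + 2)%:R * (1 / 5 - e%:R^-1) <= n.+1%:R :> R.
  have -> : 1 / 5 - e%:R^-1 = (e - 5)%N%:R / (5 * e)%N%:R :> R.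
    by rewrite natrB // natrM; field; rewrite gt_eqF.
  rewrite mulrA ler_pdivrMr ?ltr0n ?muln_gt0 ?(leq_trans _ e6) // -!natrM ler_nat.
  by rewrite ltnW // ltn_ceil // muln_gt0 (leq_trans _ e6).
have pos : 0 < 1 / 5 - e%:R^-1 :> R.
  have : e%:R^-1 <= 1 / 6 :> R by rewrite div1r lef_pV2 ?posrE.
  by move: (e%:R^-1) => y; lra.
rewrite natr_expn_expR // /powR gt_eqF // ltr_expR.
apply: lt_le_trans (_ : _ < (2 * N + 2)%:R * (1 / 5 - e%:R^-1) * ln b%:R) _; last first.
  by rewrite ler_wpM2r // ltW.
rewrite mulrAC [X in _ < X]mulrC ltr_pM2l //.
have E : N.+1.*2 = (2 * N + 2)%N by rewrite -mul2n mulnS addnC.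
rewrite E natr_expn_expR // in xb.
rewrite -[X in _ < X]expRK ltr_ln ?posrE ?expR_gt0 //.
Qed.

Local Open Scope classical_set_scope.
Local Open Scope ring_scope.

Theorem theorem1p5 (R : realType) (b : nat) (hb : (2 <= b)%N)
    (eps : R) (heps : 0 < eps) :
  exists sigma C : R,
    [/\ 0 < sigma, 0 < C &
      forall x : R, 1 <= x ->
        (\sum_(1 <= q < (Num.truncn (x `^ (1 / 5 - eps))).+1
               | coprime q (b ^ 3 - b))
           ereal_sup [set ereal_sup [set `|discrepancy b q y a|%:E
                                    | a in [set: int]]
                     | y in [set y : R | (y <= x)%R]]
         <= (C * ((size (pal_star b x))%:R / expR (sigma * Num.sqrt (ln x))))%:E)%E].
Proof.
have four n : (0 < n)%N -> (n.+1.*2 <= 4 * n)%N by clear; lia.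
have b0 : (0 < b)%N by exact: ltnW.
have Lb0 : 0 < ln (b%:R : R) by rewrite ln_gt0 // ltr1n.
(* Ensures [1 / e <= eps] while [1 / 5 - 1 / e] stays positive. *)
pose e := maxn 6 (Num.truncn eps^-1).+1.
have e6 : (6 <= e)%N by exact: leq_maxl.
have eR : 0 < e%:R :> R by rewrite ltr0n (leq_trans _ e6).
have e_eps : e%:R^-1 <= eps.
  rewrite invf_ple ?posrE //; apply: le_trans (ltW (truncnS_gt _)) _.
  by rewrite ler_nat leq_maxr.
have [c [C [c0 C0 H]]] := sum_discrepancy_bound_decay R hb e6.
have sL0 : 0 < Num.sqrt (ln (b%:R : R)) by rewrite sqrtr_gt0.
(* From [ln x <= (2 N + 2) ln b <= 4 N ln b] follows [sigma sqrt (ln x) <= c sqrt N]; the factor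
   [b ^ 4] comes from [size_pal_star_lower]. *)
exists (c / (2 * Num.sqrt (ln b%:R))), (C * b%:R ^+ 4); split.
- by rewrite divr_gt0 // mulr_gt0.
- by rewrite mulr_gt0 // exprn_gt0 // ltr0n.
move=> x x1; have x0 : 0 < x by exact: lt_le_trans x1.
set Y := Num.truncn x; have Y0 : (0 < Y)%N by rewrite truncn_gt0.
(* In general [b ^ (2 N) <= x < b ^ (2 N + 2)]; for small [x] the maximum with [1] keeps the upper
   bound and secures [2 N + 2 <= 4 N]. *)
pose N := maxn 1 (trunc_log (b ^ 2) Y).
have b2 : (1 < b ^ 2)%N by rewrite -{1}(exp1n 2) ltn_exp2r.
have /andP [Ylo Yhi] := trunc_log_bounds b2 Y0.
have N0 : (0 < N)%N by exact: leq_maxl.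
have YN : (Y < b ^ N.+1.*2)%N.
  apply: leq_trans Yhi _; rewrite -expnM mul2n leq_exp2l // leq_double ltnS.
  exact: leq_maxr.
have xb : x < (b ^ N.+1.*2)%:R.
  by apply: lt_le_trans (truncnS_gt x) _; rewrite ler_nat.
have XN := truncn_powR_lt hb e6 e_eps x1 xb.
set X := (Num.truncn _).+1 in XN *.
pose r := (N - N %/ e)%N.
have hsum := H N X N0 (ltn0Sn _) XN.
apply: (@le_trans _ _ (\sum_(1 <= q < X | coprime q (b ^ 3 - b)) (discrepancy_bound R b N r q)%:E)%E).
  rewrite big_nat_cond [leRHS]big_nat_cond; apply: lee_sum => q /andP [/andP [q0 _] cop].
  apply: ge_ereal_sup => _ [y /= yx <-]; apply: ge_ereal_sup => _ [a _ <-].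
  rewrite lee_fin; apply: discrepancy_le => //; first exact: leq_subr.
  by apply: leq_ltn_trans YN; exact: le_truncn.
rewrite sumEFin lee_fin; apply: le_trans hsum _.
have szN : b%:R ^+ N <= b%:R ^+ 4 * (size (pal_star b x))%:R :> R.
  apply: size_pal_star_lower => //.
  have [t1|t1] := leqP (trunc_log (b ^ 2) Y) 1; first by rewrite /N (maxn_idPl t1).
  by rewrite /N (maxn_idPr (ltnW t1)) orbC -mul2n expnM Ylo.
have lnx : Num.sqrt (ln x) <= 2 * Num.sqrt (ln b%:R) * Num.sqrt N%:R.
  have -> : 2 * Num.sqrt (ln b%:R) * Num.sqrt N%:R = Num.sqrt (2 ^+ 2 * ln b%:R * N%:R) :> R.
    have p1 : 0 <= 2 ^+ 2 * ln b%:R :> R by rewrite mulr_ge0 // ltW.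
    by rewrite (sqrtrM _ p1) sqrtrM // sqrtr_sqr ger0_norm.
  apply: ler_wsqrtr.
  apply: le_trans (_ : _ <= N.+1.*2%:R * ln b%:R) _.
    rewrite natr_expn_expR // in xb.
    by rewrite -[leRHS]expRK ler_ln ?posrE ?expR_gt0 // ltW.
  have -> : 2 ^+ 2 * ln b%:R * N%:R = (4 * N)%:R * ln b%:R :> R by rewrite natrM; ring.
  by rewrite ler_wpM2r ?(ltW Lb0) // ler_nat four.
have expo : expR (- (c * Num.sqrt N%:R)) <=
    (expR (c / (2 * Num.sqrt (ln b%:R)) * Num.sqrt (ln x)))^-1.
  rewrite -expRN ler_expR lerN2 mulrAC ler_pdivrMr ?mulr_gt0 //.
  by rewrite -mulrA ler_wpM2l ?(ltW c0) // [Num.sqrt N%:R * _]mulrC.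
rewrite -[leRHS]mulrA ler_wpM2l ?(ltW C0) // [leRHS]mulrA.
by apply: ler_pM; rewrite ?exprn_ge0 ?expR_ge0.
Qed.
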